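(* Let $(X_n)_{n\in\mathbb{N}}$ be a stationary sequence of almost surely bounded real random variables with $EX_1=\mu$. Assume that the block length satisfies $p(n)\to\infty$, $p(n)=p(2^l)$ for $2^l\le n<2^{l+1}$, $l=1,2,\ldots$, and $p^2(n)/n\to0$, and that one of the following two conditions holds: 1. $(X_n)_{n\in\mathbb{N}}$ is strongly mixing with mixing coefficients $\alpha(k)$, $\operatorname{Var}\big(n^{1/2}(\bar X_n-\mu)\big)\to\sigma^2$ for some $\sigma^2>0$, and $$\sum_{n=1}^\infty\frac{p^2(n)\,\alpha(p(n))}{n}<\infty,\qquad \sum_{n=1}^\infty\frac{p^3(n)}{n^2}<\infty.$$ 2. $(X_n)_{n\in\mathbb{N}}$ is near epoch dependent, with approximation constants $(a_l)$, on a stationary absolutely regular process $(Z_n)_{n\in\mathbb{Z}}$ with absolute regularity coefficients $\beta(k)$, and $\sum_{k=0}^\infty k^2(a_k+\beta(k))<\infty$; in this case put $\sigma^2=\operatorname{Var}(X_1)+2\sum_{i=2}^\infty\operatorname{Cov}(X_1,X_i)$. Then, as $n\to\infty$, $$\operatorname{Var}^*\big(\sqrt{kp}\,\bar X^*_{n,kp}\big)\to\sigma^2\quad\text{a.s.},$$ and, almost surely (that is, for almost every realization of $(X_n)_{n\in\mathbb{N}}$, with respect to $P^*$), $$\sqrt{kp}\,(\bar X^*_{n,kp}-\bar X_{n,kp})\to N(0,\sigma^2)\quad\text{in distribution}.$$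
   Context: $N(0,\sigma^2)$ is a Gaussian random variable with mean $0$ and variance $\sigma^2$. Mixing. For a process and $a\le l$ let $\mathcal F_a^l$ be the $\sigma$-field generated by its members with index in $[a,l]$. The strong mixing coefficient of $(X_n)_{n\in\mathbb{N}}$ is $\alpha(k)=\sup\{|P(A\cap B)-P(A)P(B)|: A\in\mathcal F_1^n,\ B\in\mathcal F_{n+k}^\infty,\ n\in\mathbb{N}\}$; the process is strongly mixing if $\alpha(k)\to0$. The absolute regularity coefficient of a process $(Z_n)_{n\in\mathbb{Z}}$ is $\beta(k)=\sup_nE\sup\{|P(A\mid\mathcal F_{-\infty}^n)-P(A)|:A\in\mathcal F_{n+k}^\infty\}$; the process is absolutely regular if $\beta(k)\to0$ as $k\to\infty$. Near epoch dependence. The stationary process $(X_n)_{n\in\mathbb{N}}$ is near epoch dependent on a process $(Z_n)_{n\in\mathbb{Z}}$ with approximation constants $(a_l)$ if $E|X_1-E(X_1\mid\mathcal F_{-l}^l)|\le a_l$ for $l=0,1,2,\ldots$, where $\lim_{l\to\infty}a_l=0$ and $\mathcal F_{-l}^l$ is the $\sigma$-field generated by $Z_{-l},\ldots,Z_l$. Here $(X_n)$ and $(Z_n)$ are defined on the same probability space and are jointly stationary: for every $m\in\mathbb{N}$ the joint law of $\big((X_{n+m})_{n\in\mathbb{N}},(Z_{n+m})_{n\in\mathbb{Z}}\big)$ equals that of $\big((X_n)_{n\in\mathbb{N}},(Z_n)_{n\in\mathbb{Z}}\big)$. Nonoverlapping block bootstrap. Let $p=p(n)\in\mathbb{N}$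 be the block length, $p\to\infty$, $p=o(n)$, and $k=k(n)=\lfloor n/p\rfloor$ the number of blocks. Put $B_i=\{(i-1)p+1,\ldots,ip\}$ and $I_i=(X_{(i-1)p+1},\ldots,X_{ip})$, $i=1,\ldots,k$. Given $(X_n)_{n\in\mathbb{N}}$, the bootstrap sample $X_1^*,\ldots,X_{kp}^*$ is obtained by drawing $k$ blocks independently: the vectors $(X^*_{(j-1)p+1},\ldots,X^*_{jp})$, $j=1,\ldots,k$, are conditionally independent and each equals $I_i$ with probability $1/k$, $i=1,\ldots,k$. $P^*,E^*,\operatorname{Var}^*$ denote probability, expectation and variance conditionally on $(X_n)_{n\in\mathbb{N}}$. Set $\bar X^*_{n,kp}=\frac1{kp}\sum_{i=1}^{kp}X_i^*$, $\bar X_{n,kp}=\frac1{kp}\sum_{i=1}^{kp}X_i=E^*\bar X^*_{n,kp}$, $\bar X_n=\frac1n\sum_{i=1}^nX_i$. *)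

(* Defs.v *)
From HB Require Import structures.
From mathcomp Require Import all_boot all_order all_algebra.
From mathcomp Require Import all_classical all_reals all_analysis.

Set Implicit Arguments.
Unset Strict Implicit.
Unset Printing Implicit Defensive.

Import Order.TTheory GRing.Theory Num.Theory.
Import numFieldNormedType.Exports.

Local Open Scope classical_set_scope.
Local Open Scope ring_scope.

(* Sequences (X_n) with n = 1, 2, ... are functions on nat whose value at 0 is
   never used. *)

Section processes.
Context {d d' : measure_display} {T : measurableType d} {E : measurableType d'}.

Definition sigma_field (I : Type) (D : set I) (Z : I -> T -> E) :
    set (set T) :=
  <<s \bigcup_(i in D) preimage_set_system setT (Z i) measurable >>.

End processes.

(* I -> E with its product (cylinder) sigma-algebra. *)
Definition path_space (I : Type) (d : measure_display) (E : measurableType d) :=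
  g_sigma_algebraType
    (\bigcup_(i in [set: I])
       preimage_set_system setT (fun f : I -> E => f i) measurable).

Section stationarity.
Context {d d' : measure_display} {T : measurableType d} {E : measurableType d'}
        {R : realType} (P : probability T R).

Definition same_law (d0 : measure_display) (S : measurableType d0)
    (f g : T -> S) :=
  forall A : set S, measurable A -> P (f @^-1` A) = P (g @^-1` A).

Definition path_from (m : nat) (X : nat -> T -> R) (w : T) :
    path_space nat R :=
  fun n => X (n.+1 + m)%N w.

Definition path_fromZ (m : nat) (Z : int -> T -> E) (w : T) :
    path_space int E :=
  fun n => Z (n + m%:Z) w.

Definition stationary (X : nat -> T -> R) :=
  forall m : nat, same_law (path_from m X) (path_from 0 X).

Definition jointly_stationary (X : nat -> T -> R) (Z : int -> T -> E) :=
  forall m : nat,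
    same_law (fun w => (path_from m X w, path_fromZ m Z w))
             (fun w => (path_from 0 X w, path_fromZ 0 Z w)).

End stationarity.

Section conditioning.
Context {d : measure_display} {T : measurableType d} {R : realType}
        (P : probability T R).

(* Y is a version of E(X | G), for a sub-sigma-algebra G. *)
Definition is_condexp (G : set (set T)) (X Y : T -> R) :=
  [/\ forall B : set R, measurable B -> G (Y @^-1` B),
      P.-integrable setT (EFin \o Y) &
      forall A, G A ->
        (\int[P]_(w in A) (Y w)%:E = \int[P]_(w in A) (X w)%:E)%E].

(* g is the P-essential supremum of the family H: a supremum over uncountably
   many random variables defined up to null sets is to be taken in this
   sense. *)
Definition is_ess_supremum (H : set (T -> R)) (g : T -> R) :=
  [/\ measurable_fun setT g,
      forall h, H h -> {ae P, forall w, h w <= g w} &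
      forall g' : T -> R, measurable_fun setT g' ->
        (forall h, H h -> {ae P, forall w, h w <= g' w}) ->
        {ae P, forall w, g w <= g' w}].

End conditioning.

Section mixing.
Context {d d' : measure_display} {T : measurableType d} {E : measurableType d'}
        {R : realType} (P : probability T R).

Definition alpha_mixing (X : nat -> T -> R) (k : nat) : R :=
  sup [set x : R | exists n A B,
    [/\ (1 <= n)%N,
        sigma_field [set i | (1 <= i <= n)%N] X A,
        sigma_field [set i | (n + k <= i)%N] X B &
        x = `|fine (P (A `&` B)) - fine (P A) * fine (P B)| ] ].

Definition strongly_mixing (X : nat -> T -> R) :=
  alpha_mixing X k @[k --> \oo] --> (0 : R).

Definition conditional_deviations (Z : int -> T -> E) (n : int) (k : nat) :
    set (T -> R) :=
  [set h | exists A c,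
    [/\ sigma_field [set i | n + k%:Z <= i] Z A,
        is_condexp P (sigma_field [set i | i <= n] Z) \1_A c &
        h = fun w => `|c w - fine (P A)| ] ].

Definition absolute_regularity_coefficients (Z : int -> T -> E)
    (beta : nat -> R) :=
  forall k, exists S : int -> T -> R,
    (forall n, is_ess_supremum P (conditional_deviations Z n k) (S n)) /\
    (beta k)%:E = ereal_sup (range (fun n => 'E_P[S n]))%E.

Definition near_epoch_dependent (X : nat -> T -> R) (Z : int -> T -> E)
    (a : nat -> R) :=
  [/\ jointly_stationary P X Z,
      forall l : nat, exists2 Y : T -> R,
        is_condexp P (sigma_field [set i | - l%:Z <= i <= l%:Z] Z) (X 1%N) Y &
        ('E_P[(fun w => `|X 1%N w - Y w|)%R] <= (a l)%:E)%E &
      a l @[l --> \oo] --> (0 : R)].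

End mixing.

Section bootstrap.
Context {R : realType}.

Definition mean (x : nat -> R) (m : nat) : R :=
  m%:R^-1 * \sum_(1 <= i < m.+1) x i.

Definition nblocks (p n : nat) : nat := (n %/ p)%N.

(* The draws of k blocks out of k, with replacement: the j-th drawn block is
   the block of index J j, both being counted from 0. *)
Definition draws (k : nat) := {ffun 'I_k -> 'I_k}.

(* The entries X*_1, ..., X*_{kp} of the bootstrap sample from x given by the
   draw J (and 0 at the other indices). *)
Definition boot_sample (x : nat -> R) (p k : nat) (J : draws k) (i : nat) : R :=
  if insub (i.-1 %/ p)%N is Some j then x (J j * p + (i.-1 %% p).+1)%N else 0.

(* Independent draws, each uniform on the k blocks. *)
Definition draw_weight (k : nat) (J : draws k) : R := \prod_(j < k) k%:R^-1.

Definition boot_prob (k : nat) (A : set (draws k)) : R :=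
  \sum_(J : draws k | J \in A) draw_weight J.

Definition boot_expectation (k : nat) (f : draws k -> R) : R :=
  \sum_(J : draws k) draw_weight J * f J.

Definition boot_variance (k : nat) (f : draws k -> R) : R :=
  boot_expectation (fun J => (f J - boot_expectation f) ^+ 2).

Definition boot_mean (x : nat -> R) (p k : nat) (J : draws k) : R :=
  mean (boot_sample x p J) (k * p).

Definition boot_scaled_variance (x : nat -> R) (p n : nat) : R :=
  let k := nblocks p n in
  boot_variance (fun J : draws k => Num.sqrt (k * p)%:R * boot_mean x p J).

Definition boot_cdf (x : nat -> R) (p n : nat) (t : R) : R :=
  let k := nblocks p n in
  boot_prob [set J : draws k |
    Num.sqrt (k * p)%:R * (boot_mean x p J - mean x (k * p)) <= t].

(* normal_prob m s is parameterized by the standard deviation s and is not the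
   degenerate law when s = 0. *)
Definition gaussian (sigma2 : R) : set R -> \bar R :=
  if sigma2 == 0 then \d_(0 : R) else normal_prob 0 (Num.sqrt sigma2).

Definition cvg_in_distribution (F : nat -> R -> R) (nu : set R -> \bar R) :=
  let G := fun t : R => fine (nu [set x | x <= t]) in
  forall t, {for t, continuous G} -> F n t @[n --> \oo] --> G t.

End bootstrap.

Section conditions.
Context {d : measure_display} {T : measurableType d} {R : realType}
        (P : probability T R).

Definition mixing_condition (X : nat -> T -> R) (p : nat -> nat)
    (mu sigma2 : R) :=
  [/\ strongly_mixing P X,
      0 < sigma2,
      ('V_P[(fun w => Num.sqrt n%:R * (mean (X ^~ w) n - mu))%R]
         @[n --> \oo] --> sigma2%:E)%E,
      (\sum_(1 <= n <oo)
         ((p n)%:R ^+ 2 * alpha_mixing P X (p n) / n%:R)%R%:E < +oo)%E &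
      (\sum_(1 <= n <oo) ((p n)%:R ^+ 3 / n%:R ^+ 2 : R)%R%:E < +oo)%E].

Definition ned_condition (X : nat -> T -> R) (sigma2 : R) :=
  exists (d' : measure_display) (E : measurableType d')
         (Z : int -> {RV P >-> E}) (a beta : nat -> R),
  [/\ near_epoch_dependent P X Z a,
      absolute_regularity_coefficients P Z beta,
      beta k @[k --> \oo] --> (0 : R),
      (\sum_(0 <= k <oo) (k%:R ^+ 2 * (a k + beta k))%R%:E < +oo)%E &
      sigma2 = fine 'V_P[X 1%N] +
        2 * limn (fun n => \sum_(2 <= i < n) fine (covariance P (X 1%N) (X i)))].

End conditions.

(* Main.v *)
Require Import Defs.
From HB Require Import structures.
From mathcomp Require Import all_boot all_order all_algebra.
From mathcomp Require Import all_classical all_reals all_analysis.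
From mathcomp Require Import measurable_realfun.
From mathcomp Require Import ring lra zify.

Set Implicit Arguments.
Unset Strict Implicit.
Unset Printing Implicit Defensive.

Import Order.TTheory GRing.Theory Num.Theory.
Import numFieldNormedType.Exports.

Local Open Scope classical_set_scope.
Local Open Scope ring_scope.

(** The bootstrap sum is, given the data, a sum of [k] independent draws from
    the finite population of the standardized block sums
    [xi_a = (S_a - S) / sqrt (k p)], where [S_a] is the sum of the [a]-th block
    and [S] the average of the [S_a]. Two facts therefore suffice, along almost
    every path: the population variance [\sum_a xi_a ^ 2] tends to [sigma2],
    and the entries of the population tend to 0 uniformly. The second one is
    immediate, as [X] is bounded and [p ^ 2 = o(n)].

    That the two facts imply the limit theorem is [boot_clt]. It is proved by
    Stein's method. Replacing one draw by an independent copy and expanding a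
    function [g] to first order compares [E (W g(W))] with [v E (g'(W))], where
    [v] is the population variance ([stein_bound]); the error is of the order
    of the largest entry as soon as [g'] is Lipschitz. Such a [g] solves
    Stein's equation when its right hand side is a ramp, a continuous
    approximation of the indicator of a half-line ([stein_solution]). The
    choice [g = id] gives the variance of the bootstrap sum.

    With [X = Y + mu], the population variance is [\sum_a S_a ^ 2 / (k p)]
    minus [(\sum_a S_a) ^ 2 / (k ^ 2 p)], [S_a] being now a block sum of [Y].
    Write [e q] for the second moment of a sum of [q] consecutive entries; both
    conditions yield [e n / n --> sigma2], which controls the second term. The
    first one converges if the deviations of [\sum_(i < m) S_i ^ 2] from
    [m e(p)] are negligible. For [2 ^ l <= n < 2 ^ (l + 1)] the block length
    does not depend on [n], sums of squares are monotone in [m], and [e p] is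
    [O(p)]; hence it is enough to control the deviations at boundedly many grid
    points in each dyadic interval. There they tend to 0 almost surely if their
    normalized second moments are summable over [l]. This reduction to second
    moments is [bootstrap_reduction].

    Under strong mixing, the squares of blocks that do not touch each other are
    nearly uncorrelated by the covariance inequality, and the two summability
    assumptions on [p] are exactly what Cauchy's condensation turns into the
    summability over [l] ([bootstrap_mixing]).

    Under near epoch dependence, products of entries of [Y] over two distant
    index sets are approximated by functions of two distant windows of [Z].
    Absolute regularity bounds the dependence of two such windows, because
    [P (A & B) - P A * P B] is the integral over [A] of [P(B | past) - P B].
    This gives covariances of products of at most four entries which decay with
    the gap [g] at a rate [rho g] with [\sum_g (g + 1) ^ 2 rho g] finite
    ([decoupling]). Splitting a product of four entries at its largest gap
    bounds the fourth moment of a block sum by a multiple of [p ^ 2]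
    ([fourth_moment_bound]); so the deviations over [m] blocks have second
    moment [O(m p ^ 2)], which is [O(2 ^ l p)], and [p(2 ^ l) / 2 ^ l] is
    summable since [p ^ 2 = O(n)]. Finally, [e n / n] is a Cesaro mean of the
    partial sums of the covariance series, so that it converges to the
    prescribed [sigma2] ([variance_limit]). *)

(** * Calculus of one variable *)

Section calculus.
Context {R : realType}.

Lemma is_derive_cont (f : R -> R) (x l : R) : is_derive x 1 f l ->
  {for x, continuous f}.
Proof. by case=> df _; exact/differentiable_continuous/derivable1_diffP. Qed.

Lemma MVT_everywhere (f df : R -> R) (a b : R) :
  (forall x : R, is_derive x 1 f (df x)) -> a < b ->
  exists2 c, a < c < b & f b - f a = df c * (b - a).
Proof.
move=> fdf ab; have cf : {within `[a, b], continuous f}.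
  by apply: continuous_subspaceT => y; exact: is_derive_cont (fdf y).
have [c] := MVT ab (fun x _ => fdf x) cf.
by rewrite in_itv/= => cab e; exists c.
Qed.

(** The mean value theorem replaces the increment by an intermediate slope,
    which differs from [g1 x] by at most [L * |h|]. *)
Lemma taylor1_lipschitz (g g1 : R -> R) (L : R) :
  (forall x : R, is_derive x 1 g (g1 x)) ->
  (forall x y, `|g1 y - g1 x| <= L * `|y - x|) ->
  forall x h, `|g (x + h) - g x - h * g1 x| <= L * h ^+ 2.
Proof.
move=> gg1 lip x h.
have L0 : 0 <= L by have := le_trans (normr_ge0 _) (lip 0 1); rewrite subr0 normr1 mulr1.
have key c : `|c - x| <= `|h| -> g (x + h) - g x = g1 c * h ->
    `|g (x + h) - g x - h * g1 x| <= L * h ^+ 2.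
  move=> cx ->; rewrite (mulrC h) -mulrBl normrM.
  apply: (le_trans (ler_wpM2r (normr_ge0 h) (lip x c))).
  by rewrite -mulrA ler_wpM2l// -real_normK ?num_real// expr2 ler_wpM2r.
have [h0|h0|h0] := ltgtP h 0.
- have xh : x + h < x by rewrite gtrDl.
  have [c /andP[c1 c2] e] := MVT_everywhere gg1 xh.
  apply: (key c); last by lra.
  by rewrite !ltr0_norm; lra.
- have xh : x < x + h by rewrite ltrDl.
  have [c /andP[c1 c2] e] := MVT_everywhere gg1 xh.
  apply: (key c); last by lra.
  by rewrite !gtr0_norm; lra.
- by apply: (key x); rewrite ?h0 ?subrr ?addr0 ?subrr ?mulr0 ?normr0.
Qed.

Lemma lipschitz_of_bounded_derive (f df : R -> R) (L : R) :
  (forall x : R, is_derive x 1 f (df x)) -> (forall x, `|df x| <= L) ->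
  forall x y, `|f y - f x| <= L * `|y - x|.
Proof.
move=> fdf bdf x y; wlog xy : x y / x <= y => [H|].
  by have [/H//|/ltW/H] := leP x y; rewrite distrC (distrC x).
move: xy; rewrite le_eqVlt => /orP[/eqP ->|xy]; first by rewrite !subrr normr0 mulr0.
have [c _ ->] := MVT_everywhere fdf xy.
by rewrite normrM ler_wpM2r.
Qed.

(** A negative value would be followed by smaller ones only, against the
    limit 0 at infinity. *)
Lemma decreasing_to0_ge0 (f df : R -> R) :
  (forall x : R, 0 < x -> is_derive x 1 f (df x)) ->
  (forall x, 0 < x -> df x <= 0) ->
  f x @[x --> +oo] --> 0 -> forall x, 0 < x -> 0 <= f x.
Proof.
move=> fdf df0 f0 x x0; rewrite leNgt; apply/negP => fx0.
have fNx : 0 < - f x by rewrite oppr_gt0.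
have /cvgr0Pnorm_lt/(_ _ fNx) H := f0.
near (pinfty_nbhs R) => y.
have xy : x < y by near: y; apply: nbhs_pinfty_gt; exact: num_real.
have : `|f y| < - f x by near: y.
have fxy (z : R) : z \in `]x, y[ -> is_derive z 1 f (df z).
  by rewrite in_itv/= => /andP[xz _]; apply: fdf; exact: lt_trans xz.
have cf : {within `[x, y], continuous f}.
  apply: continuous_in_subspaceT => z; rewrite inE/= in_itv/= => /andP[xz _].
  by apply: is_derive_cont (fdf _ _); exact: lt_le_trans xz.
have [c] := MVT xy fxy cf.
rewrite in_itv/= => /andP[xc _] e.
have : df c * (y - x) <= 0.
  by rewrite mulr_le0_ge0 ?subr_ge0 ?(ltW xy)// df0// (lt_trans x0).
rewrite -e => e1; rewrite ltr0_norm; lra.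
Unshelve. all: by end_near. Qed.

(** The derivative of [k] vanishes at [u], so that [k] can be continued by a
    constant on the left of [u] without a kink. *)
Lemma is_derive_max (k dk : R -> R) (u : R) :
  (forall x : R, is_derive x 1 k (dk x)) -> dk u = 0 ->
  forall x : R, is_derive x 1 (fun x => k (Num.max x u)) (dk (Num.max x u)).
Proof.
move=> kdk dku x.
have [xu|ux|->] := ltgtP x u.
- rewrite dku.
  apply: (@near_eq_is_derive _ _ _ (cst (k u))).
  near=> y => /=; rewrite max_r//= ltW//; near: y; exact: lt_nbhsl.
- apply: (@near_eq_is_derive _ _ _ k).
  near=> y => /=; rewrite max_l//= ltW//; near: y; exact: lt_nbhsr.
- rewrite dku.
  have [dk1 dk2] := kdk u.
  have lim0 : h^-1 *: (k (Num.max (h *: (1:R) + u) u) - k (Num.max u u)) @[h --> (0:R)^'] --> (0:R).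
    have /cvgr0Pnorm_lt dk0 : h^-1 *: (k (h *: (1:R) + u) - k u) @[h --> (0:R)^'] --> (0:R).
      have : h^-1 *: (k (h *: (1:R) + u) - k u) @[h --> (0:R)^'] --> dk u.
        by rewrite -dk2; exact: dk1.
      by rewrite dku.
    apply/cvgr0Pnorm_lt => e e0.
    near=> h.
    apply: (@le_lt_trans _ _ `|h^-1 *: (k (h *: (1:R) + u) - k u)|); last first.
      by near: h; exact: dk0.
    rewrite maxxx -[h *: _]/(h * 1) mulr1.
    by have [hu|hu] := leP (h + u) u => //; rewrite ?subrr ?scaler0 ?normr0.
  by apply: DeriveDef; [apply/cvg_ex; exists 0|apply/cvg_lim => //]; exact: lim0.
Unshelve. all: by end_near. Qed.

End calculus.

(** The rules of derivation for functions given by their values, the form in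
    which derivatives are computed below. *)
Section pointwise_derivatives.
Context {R : realType}.
Implicit Types (f g : R -> R) (x a b c : R).

Lemma derC c x : is_derive x (1:R) (fun _ : R => c) (0:R).
Proof. exact: (is_derive_cst c x (1:R)). Qed.

Lemma derI x : is_derive x (1:R) (fun y : R => y) (1:R).
Proof. exact: (is_derive_id x (1:R)). Qed.

Lemma derN f x a : is_derive x 1 f a -> is_derive x 1 (fun y => - f y) (- a).
Proof. by move=> fa; exact: (is_deriveN fa). Qed.

Lemma derD f g x a b : is_derive x 1 f a -> is_derive x 1 g b ->
  is_derive x 1 (fun y => f y + g y) (a + b).
Proof. by move=> fa gb; exact: (is_deriveD fa gb). Qed.

Lemma derB f g x a b : is_derive x 1 f a -> is_derive x 1 g b ->
  is_derive x 1 (fun y => f y - g y) (a - b).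
Proof. by move=> fa gb; exact: derD fa (derN gb). Qed.

Lemma derM f g x a b : is_derive x 1 f a -> is_derive x 1 g b ->
  is_derive x 1 (fun y => f y * g y) (a * g x + f x * b).
Proof.
move=> fa gb; apply: (is_derive_eq (is_deriveM fa gb)).
by rewrite addrC -[_ *: a]/(g x * a) mulrC.
Qed.

Lemma derV f x a : f x != 0 -> is_derive x 1 f a ->
  is_derive x 1 (fun y => (f y)^-1) (- a / (f x) ^+ 2).
Proof.
move=> f0 fa; apply: (is_derive_eq (is_deriveV f0 fa)).
by rewrite -[_ *: a]/(- f x ^- 2 * a) mulNr mulNr mulrC.
Qed.

End pointwise_derivatives.

(** * Stein's equation *)

(** [phi] and [Phi] stand for the density and the distribution function of
    [N(0, s)]; the hypotheses are the properties of the normal law on which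
    Stein's method rests. *)
Section stein.
Context {R : realType} (s c : R) (phi Phi : R -> R).
Hypothesis s0 : 0 < s.
Hypothesis phi0 : forall x, 0 < phi x.
Hypothesis phic : forall x, phi x <= c.
Hypothesis phiN : forall x, phi (- x) = phi x.
Hypothesis dphi : forall x : R, is_derive x 1 phi (- x / s * phi x).
Hypothesis dPhi : forall x : R, is_derive x 1 Phi (phi x).
Hypothesis Phiy : Phi x @[x --> +oo] --> (1 : R).
Hypothesis PhiNy : Phi x @[x --> -oo] --> (0 : R).

Let c0 : 0 <= c. Proof. exact: le_trans (ltW (phi0 0)) (phic 0). Qed.

Let sx0 x : 0 < x ^+ 2 + s. Proof. by rewrite ltr_wpDl// sqr_ge0. Qed.

Lemma Phi_nd x y : x <= y -> Phi x <= Phi y.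
Proof.
rewrite le_eqVlt => /orP[/eqP->//|xy].
have [z _ e] := MVT_everywhere dPhi xy.
by rewrite -subr_ge0 e mulr_ge0 ?ltW// subr_gt0.
Qed.

Lemma cvgV_y0 : (x^-1 @[x --> +oo] --> (0:R)).
Proof.
apply/cvgr0Pnorm_lt => e e0; near=> x.
have x0 : 0 < x by near: x; apply: nbhs_pinfty_gt; exact: num_real.
rewrite gtr0_norm ?invr_gt0// invf_plt ?posrE//.
by near: x; apply: nbhs_pinfty_gt; exact: num_real.
Unshelve. all: by end_near. Qed.

Lemma dominated_y0 (f : R -> R) (b : R) : (forall x, 0 < x -> `|f x| <= b / x) ->
  f x @[x --> +oo] --> (0:R).
Proof.
move=> fb; apply/norm_cvg0P.
apply: (@squeeze_cvgr _ _ _ _ (fun=> 0) (fun x => b / x)).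
- near=> x; rewrite normr_ge0 fb//; near: x; apply: nbhs_pinfty_gt; exact: num_real.
- exact: cvg_cst.
- rewrite -[X in _ --> X](mulr0 b); apply: cvgMr; exact: cvgV_y0.
Unshelve. all: by end_near. Qed.

Let tail0 : 1 - Phi x @[x --> +oo] --> (0:R).
Proof. by rewrite -[X in _ --> X](subrr (1:R)); apply: cvgB => //; exact: cvg_cst. Qed.

(** The two bounds on the Mills ratio [(1 - Phi x) / phi x] hold because the
    difference of their sides decreases to 0 at infinity. *)
Lemma mills_upper x : 0 < x -> 1 - Phi x <= s * phi x / x.
Proof.
move=> x0; rewrite -subr_ge0.
apply: (@decreasing_to0_ge0 _ (fun x => s * phi x / x - (1 - Phi x))
         (fun x => - (s * phi x / x ^+ 2)) _ _ _ x x0) => [y y0|y y0|].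
- have d1 := derM (derM (derC s y) (dphi y)) (derV (lt0r_neq0 y0) (derI y)).
  apply: (is_derive_eq (derB d1 (derB (derC 1 y) (dPhi y)))).
  by field; rewrite !gt_eqF.
- by rewrite oppr_le0 divr_ge0 ?sqr_ge0// mulr_ge0 ?ltW.
- rewrite -[X in _ --> X](subrr (0:R)); apply: cvgB; last exact: tail0.
  apply: (@dominated_y0 _ (s * c)) => y y0.
  rewrite ger0_norm ?divr_ge0 ?mulr_ge0 ?(ltW s0) ?(ltW y0) ?(ltW (phi0 _))//.
  by rewrite ler_pM2r ?invr_gt0// ler_pM2l.
Qed.

Lemma mills_lower x : 0 < x -> s * phi x * x / (x ^+ 2 + s) <= 1 - Phi x.
Proof.
move=> x0; rewrite -subr_ge0.
apply: (@decreasing_to0_ge0 _ (fun x => 1 - Phi x - s * phi x * x / (x ^+ 2 + s))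
         (fun x => - (phi x * 2 * s ^+ 2 / (x ^+ 2 + s) ^+ 2)) _ _ _ x x0)
   => [y y0|y y0|].
- have d1 := derM (derM (derC s y) (dphi y)) (derI y).
  have d2 := derV (f := fun y => y * y + s) (lt0r_neq0 (sx0 y)) (derD (derM (derI y) (derI y)) (derC s y)).
  apply: (is_derive_eq (derB (derB (derC 1 y) (dPhi y)) (derM d1 d2))).
  by field; rewrite !gt_eqF//.
- by rewrite oppr_le0 divr_ge0 ?sqr_ge0// !mulr_ge0 ?sqr_ge0// ltW.
- rewrite -[X in _ --> X](subrr (0:R)); apply: cvgB; first exact: tail0.
  apply: (@dominated_y0 _ (s * c)) => y y0.
  rewrite ger0_norm ?divr_ge0 ?mulr_ge0 ?(ltW s0) ?(ltW y0) ?(ltW (phi0 _)) ?(ltW (sx0 _))//.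
  rewrite -(mulrA (s * _)); apply: ler_pM.
  - by rewrite mulr_ge0 ?ltW.
  - by rewrite divr_ge0 ?ltW.
  - by rewrite ler_pM2l.
  by rewrite ler_pdivrMr// (mulrC y^-1) ler_pdivlMr// -expr2 lerDl ltW.
Qed.

(** [Phi x + Phi (- x)] has derivative 0, and tends to 1 at infinity. *)
Lemma Phi_opp x : Phi (- x) = 1 - Phi x.
Proof.
pose h y := Phi y + Phi (- y).
have dh (z : R) : is_derive z 1 h ((fun=> 0) z).
  have dN := is_derive1_comp (dPhi (- z)) (derN (derI z)).
  by apply: (is_derive_eq (derD (dPhi z) dN)); rewrite phiN mulrN1 subrr.
have hx y : h y = h x.
  apply/eqP; rewrite -subr_eq0 -normr_le0 -(mul0r `|y - x|).
  by apply: lipschitz_of_bounded_derive dh _ x y => z; rewrite normr0.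
have h1 : h y @[y --> +oo] --> (1 + 0 : R).
  by apply: cvgD => //; exact/cvgNy_compNP.
have h2 : h y @[y --> +oo] --> h x.
  by rewrite (_ : h = cst (h x)); [exact: cvg_cst|apply/funext].
have := cvg_unique _ h1 h2; rewrite addr0 /h => /(_ (@Rhausdorff R)) ->.
by rewrite addrAC subrr add0r.
Qed.

Section solution.
Variables (t b : R).
Hypothesis tb : t < b.

(* [kap u] is a primitive of [(x - u) * phi x], and [K u] is the primitive of
   [Num.max (x - u) 0 * phi x] that vanishes on the left of [u]. *)
Let kap u x := - (s * phi x) - u * Phi x.

Let dkap (u x : R) : is_derive x 1 (kap u) ((x - u) * phi x).
Proof.
have d1 := derM (derC s x) (dphi x); have d2 := derM (derC u x) (dPhi x).
apply: (is_derive_eq (derB (derN d1) d2)); field; exact: lt0r_neq0.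
Qed.

Let K u x := kap u (Num.max x u) - kap u u.

Let dK (u x : R) : is_derive x 1 (K u) (Num.max (x - u) 0 * phi x).
Proof.
have uu0 : (u - u) * phi u = 0 by rewrite subrr mul0r.
have d1 := is_derive_max (dkap u) uu0 x.
apply: (is_derive_eq (derB d1 (derC _ x))); rewrite subr0.
have [xu|xu] := leP x u.
  by rewrite subrr mul0r max_r ?mul0r// subr_le0.
by rewrite max_l// subr_ge0 ltW.
Qed.

(* A primitive of [Phi]. *)
Let F2 u := u * Phi u + s * phi u.
(** The mean of [ramp] under [N(0, s)]: the average of [Phi] over [t, b]. *)
Definition smooth_prob := (F2 b - F2 t) / (b - t).
(** Equal to 1 on the left of [t], to 0 on the right of [b], linear between. *)
Definition ramp x := 1 - (Num.max (x - t) 0 - Num.max (x - b) 0) / (b - t).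
(* [H] is the primitive of [(ramp - smooth_prob) * phi] that vanishes at both
   infinities, which makes [g] the bounded solution of Stein's equation. As
   [k] is the derivative of [x * g x], the function [g1] is Lipschitz as soon
   as [k] is bounded. *)
Let H x := (1 - smooth_prob) * Phi x - (K t x - K b x) / (b - t).
Let g x := (s * phi x)^-1 * H x.
Let g1 x := (ramp x - smooth_prob + x * g x) / s.
Let k x := g x + x * g1 x.

Let bt0 : 0 < b - t. Proof. by rewrite subr_gt0. Qed.

Lemma smooth_prob_bounds : Phi t <= smooth_prob <= Phi b.
Proof.
have dF2 (u : R) : is_derive u 1 F2 (Phi u).
  have d1 := derM (derI u) (dPhi u); have d2 := derM (derC s u) (dphi u).
  apply: (is_derive_eq (derD d1 d2)); field; exact: lt0r_neq0.
have [z /andP[tz zb] e] := MVT_everywhere dF2 tb.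
by rewrite /smooth_prob e mulfK ?gt_eqF// !Phi_nd ?ltW.
Qed.

Let dg (x : R) : is_derive x 1 g (g1 x).
Proof.
have dH : is_derive x 1 H ((ramp x - smooth_prob) * phi x).
  have d1 := derM (derC (1 - smooth_prob) x) (dPhi x).
  have d2 := derM (derB (dK t x) (dK b x)) (derC (b - t)^-1 x).
  apply: (is_derive_eq (derB d1 d2)); rewrite /ramp; field; exact: lt0r_neq0.
have sphi0 : s * phi x != 0 by rewrite gt_eqF ?mulr_gt0.
have d3 := derV (f := fun y => s * phi y) sphi0 (derM (derC s x) (dphi x)).
apply: (is_derive_eq (derM d3 dH)); rewrite /g1 /g; field.
by rewrite !gt_eqF.
Qed.

Lemma ramp_ge0 x : 0 <= ramp x.
Proof.
rewrite /ramp subr_ge0 ler_pdivrMr// mul1r.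
have := tb; have [h1|h1] := leP (x - t) 0; have [h2|h2] := leP (x - b) 0; lra.
Qed.

Lemma ramp_left x : x <= t -> ramp x = 1.
Proof.
move=> xt; rewrite /ramp !max_r ?subrr ?mul0r ?subr0// subr_le0//.
by rewrite (le_trans xt)// ltW.
Qed.

Lemma ramp_right x : b <= x -> ramp x = 0.
Proof.
move=> xb; rewrite /ramp !max_l ?subr_ge0//; last by rewrite (le_trans _ xb)// ltW.
rewrite (_ : _ - _ - _ = b - t); last by ring.
by rewrite divff ?subrr// gt_eqF.
Qed.

Lemma ramp_le1 x : ramp x <= 1.
Proof.
rewrite /ramp gerBl divr_ge0 ?(ltW bt0)//.
have := tb; have [h1|h1] := leP (x - t) 0; have [h2|h2] := leP (x - b) 0; lra.
Qed.

(* The Mills ratio, up to the factor [s]. On both tails, [g x] is a multiple of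
   [q |x|], and [k x] the same multiple of the quantity bounded in [q_bound]. *)
Let q y := (1 - Phi y) / (s * phi y).

(* The two Mills bounds agree to first order, so that the terms of order [y]
   cancel. *)
Let q_bound y : 0 < y -> `|q y * (1 + y ^+ 2 / s) - y / s| <= y^-1.
Proof.
move=> y0; have sp : 0 < s * phi y by rewrite mulr_gt0.
have u1 : q y <= y^-1.
  by rewrite /q ler_pdivrMr// (le_trans (mills_upper y0))// mulrC.
have u2 : y / (y ^+ 2 + s) <= q y.
  rewrite /q ler_pdivlMr// (le_trans _ (mills_lower y0))//.
  by rewrite mulrC mulrA.
have e : 1 + y ^+ 2 / s = (y ^+ 2 + s) / s by field; exact: lt0r_neq0.
have p1 : 0 < (y ^+ 2 + s) / s by rewrite divr_gt0.
rewrite e ger0_norm ?subr_ge0.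
  rewrite lerBlDr (le_trans (ler_wpM2r (ltW p1) u1))//.
  rewrite le_eqVlt; apply/orP; left; apply/eqP; field.
  by rewrite !lt0r_neq0.
apply: le_trans (ler_wpM2r (ltW p1) u2).
rewrite le_eqVlt; apply/orP; left; apply/eqP; field.
by rewrite !lt0r_neq0.
Qed.

Let k_left x : x <= t -> x < 0 -> `|k x| <= `|1 - smooth_prob| * (- x)^-1.
Proof.
move=> xt x0; have xb : x <= b by rewrite (le_trans xt)// ltW.
have Kx u : x <= u -> K u x = 0 by move=> xu; rewrite /K max_r// subrr.
have gE : g x = (1 - smooth_prob) * q (- x).
  rewrite /g /H !Kx// subrr mul0r subr0 /q phiN Phi_opp subKr; field.
  by rewrite !lt0r_neq0.
have nx : 0 < - x by rewrite oppr_gt0.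
rewrite (_ : k x = (1 - smooth_prob) *
   (q (- x) * (1 + (- x) ^+ 2 / s) - (- x) / s)); last first.
  by rewrite /k /g1 gE ramp_left//; field; rewrite lt0r_neq0.
by rewrite normrM ler_wpM2l// q_bound.
Qed.

Let k_right x : b <= x -> 0 < x -> `|k x| <= `|smooth_prob| * x^-1.
Proof.
move=> bx x0; have tx : t <= x by rewrite (le_trans _ bx)// ltW.
have gE : g x = smooth_prob * q x.
  rewrite /g /H /K !max_l// /q /smooth_prob /F2 /kap; field.
  by rewrite !lt0r_neq0.
rewrite (_ : k x = smooth_prob * (q x * (1 + x ^+ 2 / s) - x / s)); last first.
  by rewrite /k /g1 gE ramp_right//; field; rewrite lt0r_neq0.
by rewrite normrM ler_wpM2l// q_bound.
Qed.

Let k_bounded : exists L, forall x, `|k x| <= L.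
Proof.
have ck : continuous k.
  move=> x; apply: cvgD; first exact: is_derive_cont (dg x).
  apply: cvgM; first exact: cvg_id.
  apply: cvgM; last exact: cvg_cst.
  apply: cvgD; last first.
    apply: cvgM; first exact: cvg_id.
    exact: is_derive_cont (dg x).
  apply: cvgB; last exact: cvg_cst.
  apply: cvgB; first exact: cvg_cst.
  apply: cvgM; last exact: cvg_cst.
  have cmax (u : R) : {for x, continuous (fun x : R => Num.max (x - u) 0)}.
    apply: (@continuous_max R _ (fun x => x - u) (fun=> 0)).
      by apply: cvgB; [exact: cvg_id|exact: cvg_cst].
    exact: cvg_cst.
  by apply: cvgB; exact: cmax.
pose A := `|t| + `|b| + 1.
have A1 : 1 <= A by rewrite lerDr addr_ge0.
have cnk : {within `[- A, A], continuous (fun x => `|k x|)}.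
  apply: continuous_subspaceT => x; apply: continuous_comp; first exact: ck.
  exact: norm_continuous.
have AA : - A <= A by lra.
have [z _ zmax] := EVT_max AA cnk.
exists (`|k z| + `|1 - smooth_prob| + `|smooth_prob|) => x.
have k0 := normr_ge0 (k z); have m0 := normr_ge0 smooth_prob.
have m1 := normr_ge0 (1 - smooth_prob).
have tA := ler_norm t; have bA := ler_norm b.
have tA' := ler_norm (- t); have bA' := ler_norm (- b); rewrite !normrN in tA' bA'.
have nt := normr_ge0 t; have nb := normr_ge0 b.
have [xA|xA] := ltP x (- A).
  have xt : x <= t by rewrite /A in xA; lra.
  have x0 : x < 0 by lra.
  apply: (le_trans (k_left xt x0)).
  have : (- x)^-1 <= 1 by rewrite invf_le1; lra.
  move=> /(ler_wpM2l m1); lra.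
have [Ax|Ax] := ltP A x.
  have xb : b <= x by rewrite /A in Ax; lra.
  have x0 : 0 < x by lra.
  apply: (le_trans (k_right xb x0)).
  have : x^-1 <= 1 by rewrite invf_le1; lra.
  move=> /(ler_wpM2l m0); lra.
have := zmax x; rewrite in_itv/= xA Ax => /(_ isT); lra.
Qed.

(** Stein's equation for a ramp has a solution with a Lipschitz derivative:
    expressed through the equation, [g1] is built from the Lipschitz ramp and
    from [x * g x], whose derivative is bounded. *)
Lemma stein_solution : exists (g g1 : R -> R) (L : R),
  [/\ forall x : R, is_derive x 1 g (g1 x),
      forall x y, `|g1 y - g1 x| <= L * `|y - x| &
      forall x, s * g1 x - x * g x = ramp x - smooth_prob].
Proof.
have [L kL] := k_bounded.
exists g, g1, ((2 / (b - t) + L) / s); split; [exact: dg| |]; last first.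
  by move=> x; rewrite /g1 mulrC divfK ?lt0r_neq0// addrK.
have dxg (x : R) : is_derive x 1 (fun x : R => x * g x) (k x).
  by apply: (is_derive_eq (derM (derI x) (dg x))); rewrite mul1r.
move=> x y; have xgL := lipschitz_of_bounded_derive dxg kL x y.
have maxL u : `|Num.max (y - u) 0 - Num.max (x - u) 0| <= `|y - x|.
  have := ler_norm (y - x); have := ler_norm (- (y - x)); rewrite normrN => h1 h2.
  rewrite ler_norml; have [h3|h3] := leP (x - u) 0; have [h4|h4] := leP (y - u) 0; lra.
have rL : `|ramp y - ramp x| <= 2 / (b - t) * `|y - x|.
  rewrite /ramp (_ : _ - _ = - ((Num.max (y - t) 0 - Num.max (x - t) 0) -
     (Num.max (y - b) 0 - Num.max (x - b) 0)) / (b - t)); last by ring.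
  rewrite mulNr normrN normrM (gtr0_norm (_ : 0 < (b - t)^-1)) ?invr_gt0//.
  rewrite mulrAC ler_pM2r ?invr_gt0//.
  by rewrite (le_trans (ler_normB _ _))// mulr_natl mulr2n lerD.
rewrite /g1 -mulrBl normrM (gtr0_norm (_ : 0 < s^-1)) ?invr_gt0// mulrAC.
rewrite ler_pM2r ?invr_gt0// mulrDl.
apply: le_trans (lerD rL xgL); apply: le_trans (ler_normD _ _).
by rewrite le_eqVlt; apply/orP; left; apply/eqP; congr (`| _ |); ring.
Qed.

End solution.

End stein.

(** * The normal law *)

Section normal_law.
Context {R : realType} (sigma : R).
Hypothesis sigma0 : 0 < sigma.

Let s0 : sigma != 0. Proof. exact: lt0r_neq0. Qed.

Definition Phi (t : R) : R := fine (normal_prob 0 sigma [set x | x <= t]).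

Let phi := normal_pdf 0 sigma.

Lemma normal_pdf_gt0 x : 0 < phi x.
Proof. by rewrite /phi normal_pdfE// mulr_gt0 ?expR_gt0 ?normal_peak_gt0. Qed.

Lemma normal_pdf_even x : phi (- x) = phi x.
Proof. by rewrite /phi normal_pdfE// /normal_fun !subr0 sqrrN. Qed.

Lemma is_derive_normal_pdf (x : R) : is_derive x 1 phi (- x / sigma ^+ 2 * phi x).
Proof.
rewrite /phi normal_pdfE// /normal_fun.
have d1 := derM (derN (derM (derB (derI x) (derC 0 x)) (derB (derI x) (derC 0 x))))
  (derC (sigma ^+ 2 *+ 2)^-1 x).
have d2 := is_derive1_comp (is_derive_expR _) d1.
apply: (is_derive_eq (derM (derC (normal_peak sigma) x) d2)) => /=.
rewrite !subr0 -!expr2 expr2; field.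
exact: s0.
Qed.

Lemma PhiE t : Phi t = (\int[lebesgue_measure]_(x in `]-oo, t]) phi x)%R.
Proof. by rewrite /Phi /normal_prob /Rintegral set_itvNyc. Qed.

Lemma is_derive_Phi (x : R) : is_derive x 1 Phi (phi x).
Proof.
rewrite (_ : Phi = fun t => (\int[lebesgue_measure]_(x in `]-oo, t]) phi x)%R); last first.
  by apply/funext => t; exact: PhiE.
have xx1 : x < x + 1 by rewrite ltrDl.
have ix : lebesgue_measure.-integrable `]-oo, x + 1] (EFin \o phi).
  exact: integrableS (integrable_normal_pdf 0 sigma).
have := continuous_FTC1 xx1 ix; rewrite ltNyr => /(_ isT).
move=> /(_ (@continuous_normal_pdf _ 0 _ s0 x))[d e].
by apply: DeriveDef => //; rewrite -derive1E.
Qed.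

(* The limits of [Phi] at both infinities are those of the distribution
   function of the identity, as a random variable under the normal law. *)
Let idTR : measurableTypeR R -> R := idfun.

#[local] HB.instance Definition _ :=
  @isMeasurableFun.Build _ _ _ _ idTR (@measurable_id _ _ setT).

Let N := (normal_prob 0 sigma : probability (measurableTypeR R) R).

Let cdf_id : cdf (idTR : {RV N >-> R}) = EFin \o Phi.
Proof.
apply/funext => t; rewrite /cdf /distribution /pushforward /= /Phi fineK.
  by rewrite set_itvNyc.
by rewrite -set_itvNyc fin_num_measure.
Qed.

Lemma Phi_cvgy : Phi x @[x --> +oo] --> (1 : R).
Proof.
by have := @cvg_cdfy1 _ _ _ _ (idTR : {RV N >-> R}); rewrite cdf_id => /fine_cvgP[].
Qed.

Lemma Phi_cvgNy : Phi x @[x --> -oo] --> (0 : R).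
Proof.
by have := @cvg_cdfNy0 _ _ _ _ (idTR : {RV N >-> R}); rewrite cdf_id => /fine_cvgP[].
Qed.

End normal_law.

(** * Resampling *)

Section draws_expectation.
Context {R : realType} (k : nat).
Hypothesis k0 : (0 < k)%N.
Implicit Types (J : draws k) (F G : draws k -> R).

Let kR0 : (k%:R : R) != 0. Proof. by rewrite pnatr_eq0 -lt0n. Qed.

Lemma draw_weightE J : draw_weight J = k%:R^-1 ^+ k :> R.
Proof. by rewrite /draw_weight prodr_const card_ord. Qed.

Lemma boot_expectationE F : boot_expectation F = k%:R^-1 ^+ k * \sum_J F J.
Proof. by rewrite /boot_expectation big_distrr/=; apply: eq_bigr => J _; rewrite draw_weightE. Qed.

Lemma boot_expectation_cst c : boot_expectation (fun _ : draws k => c) = c :> R.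
Proof.
rewrite boot_expectationE sumr_const card_ffun !card_ord -[c *+ _]mulr_natl natrX mulrA.
by rewrite -exprMn mulVf// expr1n mul1r.
Qed.

Lemma boot_expectationD F G :
  boot_expectation (fun J => F J + G J) = boot_expectation F + boot_expectation G.
Proof. by rewrite !boot_expectationE big_split mulrDr. Qed.

Lemma boot_expectationZ c F :
  boot_expectation (fun J => c * F J) = c * boot_expectation F.
Proof. by rewrite !boot_expectationE -big_distrr/= mulrCA. Qed.

Lemma boot_expectationB F G :
  boot_expectation (fun J => F J - G J) = boot_expectation F - boot_expectation G.
Proof. by rewrite !boot_expectationE sumrB mulrBr. Qed.

Lemma boot_expectation_sum (I : finType) (F : I -> draws k -> R) :
  boot_expectation (fun J => \sum_i F i J) = \sum_i boot_expectation (F i).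
Proof.
rewrite boot_expectationE exchange_big/= big_distrr/=.
by apply: eq_bigr => i _; rewrite boot_expectationE.
Qed.

Lemma boot_expectation_le F G : (forall J, F J <= G J) ->
  boot_expectation F <= boot_expectation G.
Proof.
move=> FG; rewrite !boot_expectationE ler_wpM2l ?exprn_ge0 ?invr_ge0//.
exact: ler_sum.
Qed.

Lemma boot_expectation_norm F :
  `|boot_expectation F| <= boot_expectation (fun J => `|F J|).
Proof.
rewrite !boot_expectationE normrM ger0_norm ?exprn_ge0 ?invr_ge0//.
by rewrite ler_wpM2l ?exprn_ge0 ?invr_ge0// ler_norm_sum.
Qed.

Definition redraw J (j a : 'I_k) : draws k := [ffun i => if i == j then a else J i].

(** Drawing the [j]-th entry once more does not change the law of the draw:
    exchanging it with the old entry is an involution of the pairs [(J, a)]. *)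
Lemma boot_expectation_redraw (j : 'I_k) F :
  boot_expectation F = boot_expectation (fun J => k%:R^-1 * \sum_a F (redraw J j a)).
Proof.
rewrite boot_expectationZ !boot_expectationE mulrCA; congr *%R.
rewrite pair_bigA/=.
pose h (q : draws k * 'I_k) := (redraw q.1 j q.2, q.1 j).
have hK : involutive h.
  move=> [J a]; rewrite /h/= ffunE eqxx; congr (_, _).
  by apply/ffunP => i; rewrite !ffunE; case: eqP => [->|].
rewrite (reindex_inj (inv_inj hK))/=.
rewrite -(pair_bigA _ (fun J a => F (redraw (redraw J j a) j (J j))))/=.
rewrite [in RHS](eq_bigr (fun J => k%:R * F J)) => [|J _].
  by rewrite -big_distrr/= mulrA mulVf// mul1r.
rewrite (eq_bigr (fun=> F J)) => [|a _].
  by rewrite sumr_const card_ord mulr_natl.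
by congr F; case: (hK (J, a)).
Qed.

End draws_expectation.

Section stein_bound.
Context {R : realType} (k : nat) (xi : 'I_k -> R) (delta : R).
Hypothesis k0 : (0 < k)%N.
Hypothesis xi0 : \sum_a xi a = 0.
Hypothesis xid : forall a, `|xi a| <= delta.

Definition boot_sum (J : draws k) : R := \sum_j xi (J j).
Let v := \sum_a xi a ^+ 2.
Let v0 : 0 <= v. Proof. by apply: sumr_ge0 => a _; exact: sqr_ge0. Qed.
Let W := boot_sum.
Notation EJ := boot_expectation.

Lemma boot_sum_redraw J j a : W (redraw J j a) = W J - xi (J j) + xi a.
Proof.
rewrite /W /boot_sum (bigD1 j)//= (bigD1 (P := xpredT) j)//= ffunE eqxx.
rewrite (eq_bigr (fun i => xi (J i))); first by ring.
by move=> i /negbTE ij; rewrite ffunE ij.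
Qed.

(** In [W * g W], replace the [j]-th summand by an independent copy [xi a], and
    [W] by [y + xi a] where [y] leaves out the [j]-th summand. As [xi] is
    centered, [g y] may be subtracted, and the expansion of [g] at [y] leaves
    [xi a ^ 2 * g1 y], whose sum over [j] and average over [a] is close to
    [v * g1 W]. *)
Lemma stein_bound (g g1 : R -> R) (L : R) :
  (forall x h, `|g (x + h) - g x - h * g1 x| <= L * h ^+ 2) ->
  (forall x y, `|g1 y - g1 x| <= L * `|y - x|) ->
  `|EJ (fun J => W J * g (W J)) - v * EJ (fun J => g1 (W J))| <= 2 * L * delta * v.
Proof.
move=> gT lip.
have L0 : 0 <= L by have := le_trans (normr_ge0 _) (lip 0 1); rewrite subr0 normr1 mulr1.
have e1 : EJ (fun J => W J * g (W J)) =
    EJ (fun J => \sum_j k%:R^-1 * \sum_a xi a * g (W J - xi (J j) + xi a)).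
  under [LHS]congr1 do under eq_fun do rewrite {1}/W /boot_sum mulr_suml.
  rewrite !boot_expectation_sum; apply: eq_bigr => j _.
  rewrite (boot_expectation_redraw k0 j); congr EJ; apply/funext => J.
  congr *%R; apply: eq_bigr => a _.
  by rewrite boot_sum_redraw ffunE eqxx.
have kR0 : (k%:R : R) != 0 by rewrite pnatr_eq0 -lt0n.
have e2 : v * EJ (fun J => g1 (W J)) =
    EJ (fun J => \sum_(j < k) k%:R^-1 * \sum_a xi a ^+ 2 * g1 (W J)).
  rewrite -boot_expectationZ; congr EJ; apply/funext => J.
  by rewrite sumr_const card_ord -[_ *+ k]mulr_natl mulrA divff// mul1r -mulr_suml.
rewrite e1 e2 -boot_expectationB.
apply: (le_trans (boot_expectation_norm _)).
rewrite -[leRHS](boot_expectation_cst k0); apply: boot_expectation_le => J.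
rewrite -sumrB; apply: (le_trans (ler_norm_sum _ _ _)).
have -> : 2 * L * delta * v = \sum_(j < k) k%:R^-1 * (2 * L * delta * v).
  by rewrite sumr_const card_ord -[_ *+ k]mulr_natl mulrA divff// mul1r.
apply: ler_sum => j _.
rewrite -mulrBr normrM ger0_norm ?invr_ge0// ler_wpM2l ?invr_ge0//.
set y := W J - xi (J j).
have -> : \sum_a xi a * g (y + xi a) = \sum_a xi a * (g (y + xi a) - g y).
  under [RHS]eq_bigr do rewrite mulrBr.
  by rewrite sumrB -mulr_suml xi0 mul0r subr0.
rewrite -sumrB mulr_sumr; apply: (le_trans (ler_norm_sum _ _ _)); apply: ler_sum => a _.
have -> : xi a * (g (y + xi a) - g y) - xi a ^+ 2 * g1 (W J) =
  xi a * (g (y + xi a) - g y - xi a * g1 y) + xi a ^+ 2 * (g1 y - g1 (W J)) by ring.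
have -> : 2 * L * delta * xi a ^+ 2 = delta * (L * xi a ^+ 2) + xi a ^+ 2 * (L * delta).
  by ring.
apply: (le_trans (ler_normD _ _)); apply: lerD.
  by rewrite normrM ler_pM.
rewrite normrM (ger0_norm (sqr_ge0 (xi a))) ler_wpM2l ?sqr_ge0//.
apply: (le_trans (lip _ _)); rewrite ler_wpM2l//.
by rewrite /y (_ : _ - _ - _ = - xi (J j)) ?normrN//; ring.
Qed.

(** For [g = id] the expansion in [stein_bound] is exact. *)
Lemma boot_sum_variance : EJ (fun J => W J ^+ 2) = v.
Proof.
have := @stein_bound id (fun=> 1) 0 _ _.
rewrite mulr0 !mul0r boot_expectation_cst// mulr1 normr_le0 subr_eq0.
under [X in EJ X]eq_fun do rewrite -expr2.
move=> h; apply/eqP; apply: h => x y; last by rewrite subrr normr0 mul0r.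
by rewrite /= (_ : _ - _ = 0) ?normr0 ?mul0r//; ring.
Qed.

(** The difference between [s] and the variance [v] costs [|s - v|] times a mean
    of [|g1 W|], which grows at most linearly. *)
Lemma stein_error (g g1 f : R -> R) (L s m : R) :
  (forall x : R, is_derive x 1 g (g1 x)) ->
  (forall x y, `|g1 y - g1 x| <= L * `|y - x|) ->
  (forall x, s * g1 x - x * g x = f x - m) ->
  `|EJ (fun J => f (W J)) - m| <=
    2 * L * delta * v + `|s - v| * (`|g1 0| + L * (1 + v)).
Proof.
move=> gg1 lip stein.
have L0 : 0 <= L by have := le_trans (normr_ge0 _) (lip 0 1); rewrite subr0 normr1 mulr1.
have SB := stein_bound (taylor1_lipschitz gg1 lip) lip.
have -> : EJ (fun J => f (W J)) - m =
   - (EJ (fun J => W J * g (W J)) - v * EJ (fun J => g1 (W J))) +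
   (s - v) * EJ (fun J => g1 (W J)).
  rewrite -[in LHS](boot_expectation_cst k0 m) -boot_expectationB.
  under [in LHS]eq_fun do rewrite -stein.
  by rewrite boot_expectationB boot_expectationZ; ring.
apply: (le_trans (ler_normD _ _)); rewrite normrN lerD// normrM ler_wpM2l//.
apply: (le_trans (boot_expectation_norm _)).
rewrite -boot_sum_variance.
rewrite -[1](boot_expectation_cst k0) -boot_expectationD -boot_expectationZ.
rewrite -[`|g1 0|](boot_expectation_cst k0) -boot_expectationD.
apply: boot_expectation_le => J.
have := ler_normD (g1 0) (g1 (W J) - g1 0); rewrite addrC subrK => h.
apply: (le_trans h); rewrite lerD2l (le_trans (lip _ _))// subr0 ler_wpM2l//.
have := sqr_ge0 (`|W J| - 1); have := normr_ge0 (W J).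
by rewrite -[W J ^+ 2]real_normK ?num_real//; nra.
Qed.

Lemma boot_prob_le (A : set (draws k)) (F : draws k -> R) :
  (forall J, 0 <= F J) -> (forall J, A J -> 1 <= F J) -> boot_prob A <= EJ F.
Proof.
move=> F0 F1; rewrite /boot_prob /boot_expectation big_mkcond/=.
apply: ler_sum => J _; rewrite draw_weightE.
have w0 : 0 <= k%:R^-1 ^+ k :> R by rewrite exprn_ge0 ?invr_ge0.
by case: ifPn => [/set_mem/F1 h|_]; rewrite ?mulr_ge0// ler_peMr.
Qed.

Lemma boot_prob_ge (A : set (draws k)) (F : draws k -> R) :
  (forall J, F J <= 1) -> (forall J, ~ A J -> F J <= 0) -> EJ F <= boot_prob A.
Proof.
move=> F0 F1; rewrite /boot_prob /boot_expectation [leRHS]big_mkcond/=.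
apply: ler_sum => J _; rewrite draw_weightE.
have w0 : 0 <= k%:R^-1 ^+ k :> R by rewrite exprn_ge0 ?invr_ge0.
case: ifPn => [_|/negP h]; first by rewrite ler_piMr.
by rewrite mulr_ge0_le0// F1// => /mem_set.
Qed.

End stein_bound.

(** * The central limit theorem for the resampled sums *)

Section clt.
Context {R : realType} (k : nat -> nat) (xi : forall n, 'I_(k n) -> R)
  (delta : nat -> R).
Arguments xi : clear implicits.
Hypothesis k0 : \forall n \near \oo, (0 < k n)%N.
Hypothesis xi0 : \forall n \near \oo, \sum_a xi n a = 0.
Hypothesis xid : \forall n \near \oo, forall a, `|xi n a| <= delta n.
Hypothesis delta0 : delta n @[n --> \oo] --> (0 : R).

Let v n := \sum_a xi n a ^+ 2.
Let Fn n t := boot_prob [set J | boot_sum (xi n) J <= t] : R.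

(** The indicator of a half-line lies between two ramps of width [e]. *)
Lemma boot_clt_nondegenerate (sigma : R) : 0 < sigma ->
  v n @[n --> \oo] --> sigma ^+ 2 ->
  forall t e, 0 < e -> \forall n \near \oo,
    Phi sigma (t - e) - e <= Fn n t <= Phi sigma (t + e) + e.
Proof.
move=> sigma0 vs t e e0.
have ss0 : 0 < sigma ^+ 2 by rewrite exprn_gt0.
pose phi := normal_pdf 0 sigma.
have key u b : u < b -> \forall n \near \oo,
  `|boot_expectation (fun J => ramp u b (boot_sum (xi n) J)) -
    smooth_prob (sigma ^+ 2) phi (Phi sigma) u b| <= e.
  move=> ub.
  have [g [g1 [L [gg1 lip st]]]] := stein_solution ss0 (normal_pdf_gt0 sigma0)
    (fun x => normal_pdf_ub 0 x (lt0r_neq0 sigma0)) (normal_pdf_even sigma0)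
    (is_derive_normal_pdf sigma0) (is_derive_Phi sigma0) (Phi_cvgy sigma)
    (Phi_cvgNy sigma) ub.
  have err0 : (2 * L * delta n * v n + `|sigma ^+ 2 - v n| * (`|g1 0| + L * (1 + v n)))
      @[n --> \oo] --> 2 * L * 0 * sigma ^+ 2 +
         `|sigma ^+ 2 - sigma ^+ 2| * (`|g1 0| + L * (1 + sigma ^+ 2)).
    apply: cvgD; apply: cvgM => //.
      by apply: cvgM => //; exact: cvg_cst.
      by apply: cvg_norm; apply: cvgB => //; exact: cvg_cst.
    apply: cvgD; first exact: cvg_cst.
    apply: cvgM; first exact: cvg_cst.
    by apply: cvgD => //; exact: cvg_cst.
  rewrite mulr0 mul0r subrr normr0 mul0r addr0 in err0.
  have H := cvgr_le _ err0 _ e0.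
  near=> n.
  have Hn : 2 * L * delta n * v n + `|sigma ^+ 2 - v n| * (`|g1 0| + L * (1 + v n)) <= e.
    by near: n; exact: H.
  apply: le_trans Hn; apply: (stein_error _ _ _ gg1 lip st).
  - by near: n.
  - by near: n.
  - by near: n.
have te : t - e < t by rewrite gtrBl.
have te' : t < t + e by rewrite ltrDl.
have K1 := key _ _ te; have K2 := key _ _ te'.
near=> n.
have kn : (0 < k n)%N by near: n.
have /andP[b1 b2] := smooth_prob_bounds ss0 (normal_pdf_gt0 sigma0)
  (is_derive_normal_pdf sigma0) (is_derive_Phi sigma0) te.
have /andP[b3 b4] := smooth_prob_bounds ss0 (normal_pdf_gt0 sigma0)
  (is_derive_normal_pdf sigma0) (is_derive_Phi sigma0) te'.
have h1 : `|boot_expectation (fun J => ramp (t - e) t (boot_sum (xi n) J)) -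
    smooth_prob (sigma ^+ 2) phi (Phi sigma) (t - e) t| <= e by near: n.
have h2 : `|boot_expectation (fun J => ramp t (t + e) (boot_sum (xi n) J)) -
    smooth_prob (sigma ^+ 2) phi (Phi sigma) t (t + e)| <= e by near: n.
have i1 : boot_expectation (fun J => ramp (t - e) t (boot_sum (xi n) J)) <= Fn n t.
  apply: boot_prob_ge => J; first exact: (ramp_le1 te).
  by move=> /negP; rewrite -ltNge => /ltW h; rewrite (ramp_right te).
have i2 : Fn n t <= boot_expectation (fun J => ramp t (t + e) (boot_sum (xi n) J)).
  apply: boot_prob_le => J; first exact: (ramp_ge0 te').
  by move=> h; rewrite (ramp_left te').
move: h1 h2; rewrite !ler_distl => /andP[h1 h1'] /andP[h2 h2'].
by apply/andP; split; rewrite -/phi in b1 b2 b3 b4; lra.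
Unshelve. all: by end_near. Qed.

(** Only continuity points of the limit matter, so that bounds up to a shift of
    the argument are enough. *)
Lemma boot_clt (sigma2 : R) : 0 <= sigma2 ->
  v n @[n --> \oo] --> sigma2 -> cvg_in_distribution Fn (gaussian sigma2).
Proof.
move=> s0 vs.
pose G t := fine (gaussian sigma2 [set x | x <= t]).
suff H : forall t e, 0 < e -> \forall n \near \oo,
    G (t - e) - e <= Fn n t <= G (t + e) + e.
  move=> /= t Gt; apply/cvgrPdist_le => e e0.
  have e20 : 0 < e / 2 by rewrite divr_gt0.
  have /cvgrPdist_le/(_ _ e20)[h /= h0 hG] := Gt.
  pose z := Num.min (h / 2) (e / 2).
  have z0 : 0 < z by rewrite /z lt_min !divr_gt0.
  have zh : z <= h / 2 by rewrite /z ge_min lexx.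
  have ze : z <= e / 2 by rewrite /z ge_min lexx orbT.
  have := H t z z0; apply: filterS => n /andP[n1 n2].
  have zlt : z < h by lra.
  have d1 : `|t - (t - z)| < h by rewrite (_ : t - (t - z) = z) ?gtr0_norm//; ring.
  have d2 : `|t - (t + z)| < h.
    by rewrite (_ : t - (t + z) = - z) ?normrN ?gtr0_norm//; ring.
  have := hG _ d1; have := hG _ d2; rewrite !ler_distl -/(G (t - z)) -/(G (t + z)) -/(G t).
  by move=> /andP[g1 g2] /andP[g3 g4]; apply/andP; split; lra.
rewrite /G /gaussian; case: eqVneq => [s20|s20] t e e0; last first.
  have s20' : 0 < sigma2 by rewrite lt_neqAle eq_sym s20.
  apply: boot_clt_nondegenerate; rewrite ?sqrtr_gt0//.
  by rewrite sqr_sqrtr.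
rewrite s20 in vs.
(* The limit is the Dirac mass at 0, and Chebyshev's inequality applies. *)
have e30 : 0 < e * e ^+ 2 by rewrite mulr_gt0 ?exprn_gt0.
have ve := cvgr_le _ vs _ e30.
near=> n.
have kn : (0 < k n)%N by near: n.
have vn : v n <= e * e ^+ 2 by near: n; exact: ve.
have xin : \sum_a xi n a = 0 by near: n.
have xidn : forall a, `|xi n a| <= delta n by near: n.
have ve2 : v n / e ^+ 2 <= e by rewrite ler_pdivrMr// exprn_gt0.
have EW : boot_expectation (fun J => (e ^+ 2)^-1 * boot_sum (xi n) J ^+ 2) = v n / e ^+ 2.
  by rewrite boot_expectationZ (boot_sum_variance kn xin xidn) mulrC.
have F01 : 0 <= Fn n t <= 1.
  apply/andP; split.
    by rewrite -[0](boot_expectation_cst kn) boot_prob_ge// => J _.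
  by rewrite -[leRHS](boot_expectation_cst kn) boot_prob_le// => J _.
move: F01 => /andP[F0 F1].
have G0 (u : R) : u < 0 -> fine (\d_(0 : R) [set x | x <= u]) = 0.
  by move=> u0; rewrite diracE memNset//= => /(lt_le_trans u0); rewrite ltxx.
have G1 (u : R) : 0 <= u -> fine (\d_(0 : R) [set x | x <= u]) = 1.
  by move=> u0; rewrite diracE mem_set.
have e2 : 0 < (e ^+ 2)^-1 by rewrite invr_gt0 exprn_gt0.
have far (w : R) : e <= `|w| -> 1 <= (e ^+ 2)^-1 * w ^+ 2.
  move=> ew; rewrite mulrC ler_pdivlMr ?exprn_gt0// mul1r.
  by rewrite -[w ^+ 2]real_normK ?num_real// ler_sqr ?nnegrE ?(ltW e0).
apply/andP; split.
- have [te|te] := ltP (t - e) 0; first by rewrite G0//; lra.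
  rewrite G1// (@le_trans _ _ (1 - v n / e ^+ 2)) ?lerD2l ?lerN2//.
  rewrite -EW -[X in X - _](boot_expectation_cst kn) -boot_expectationB.
  apply: boot_prob_ge => J; first by rewrite gerBl mulr_ge0 ?sqr_ge0// ltW.
  move=> /negP; rewrite -ltNge subr_le0 => h; apply: far.
  by apply: le_trans (ler_norm _); lra.
- have [te|te] := leP 0 (t + e); first by rewrite G1//; lra.
  rewrite G0// add0r (le_trans _ ve2)// -EW.
  apply: boot_prob_le => J; first by rewrite mulr_ge0 ?sqr_ge0// ltW.
  move=> /= h; apply: far; rewrite -normrN.
  by apply: le_trans (ler_norm _); lra.
Unshelve. all: by end_near. Qed.

End clt.

(** * The bootstrap sample as a resampling of block sums *)

Section block_sums.
Context {R : realType}.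
Implicit Types (x y : nat -> R) (p k n : nat).

(** Blocks are counted from 0, the entries of [x] from 1. *)
Definition block_sum x p i : R := \sum_(r < p) x (i * p + r).+1.

Lemma sum_blocks (f : nat -> R) p k :
  \sum_(i < k * p) f i = \sum_(j < k) \sum_(r < p) f (j * p + r)%N.
Proof.
elim: k => [|k IH]; first by rewrite mul0n !big_ord0.
rewrite big_ord_recr/= -IH mulSn addnC big_split_ord/=.
by congr (_ + _); apply: eq_bigr => i _.
Qed.

Lemma mean_blocks x p k :
  mean x (k * p) = (k * p)%:R^-1 * \sum_(j < k) block_sum x p j.
Proof.
rewrite /mean; congr *%R.
rewrite big_add1/= big_mkord (sum_blocks (fun i => x i.+1)).
by [].
Qed.

Lemma boot_mean_blocks x p k (J : draws k) : (0 < p)%N ->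
  boot_mean x p J = (k * p)%:R^-1 * \sum_(j < k) block_sum x p (J j).
Proof.
move=> p0; rewrite /boot_mean mean_blocks; congr *%R.
apply: eq_bigr => j _; apply: eq_bigr => r _.
rewrite /boot_sample/= divnMDl// divn_small// addn0 modnMDl modn_small//.
by rewrite insubT//= => jk; rewrite addnS; congr (x (J _ * p + r).+1); exact: val_inj.
Qed.

(** The value that a draw of block [a] contributes to
    [sqrt (k p) * (boot_mean - mean)]. *)
Definition std_block x p k (a : 'I_k) : R :=
  (block_sum x p a - k%:R^-1 * \sum_(j < k) block_sum x p j) / Num.sqrt (k * p)%:R.

Section fixed.
Variables (x y : nat -> R) (mu : R) (p k : nat).
Hypothesis p0 : (0 < p)%N.
Hypothesis k0 : (0 < k)%N.
Hypothesis xy : forall i, (1 <= i)%N -> x i = y i + mu.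

Let kp0 : 0 < (k * p)%:R :> R. Proof. by rewrite ltr0n muln_gt0 k0. Qed.
Let kR0 : 0 < k%:R :> R. Proof. by rewrite ltr0n. Qed.
Let pR0 : 0 < p%:R :> R. Proof. by rewrite ltr0n. Qed.
Let sk0 : 0 < Num.sqrt (k * p)%:R :> R. Proof. by rewrite sqrtr_gt0. Qed.

Lemma std_block_sum0 : \sum_(a < k) std_block x p a = 0 :> R.
Proof.
rewrite /std_block -mulr_suml sumrB sumr_const card_ord.
by rewrite -[_ *+ k]mulr_natl mulrA mulfV ?gt_eqF// mul1r subrr mul0r.
Qed.

Lemma boot_mean_std (J : draws k) :
  Num.sqrt (k * p)%:R * (boot_mean x p J - mean x (k * p)) =
  boot_sum (std_block x p (k := k)) J.
Proof.
rewrite boot_mean_blocks// mean_blocks -mulrBr mulrA.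
have -> : Num.sqrt (k * p)%:R * (k * p)%:R^-1 = (Num.sqrt (k * p)%:R)^-1 :> R.
  rewrite -{2}(sqr_sqrtr (ltW kp0)); field; exact: lt0r_neq0.
rewrite /boot_sum /std_block -mulr_suml sumrB sumr_const card_ord mulrC.
by rewrite -[_ *+ k]mulr_natl mulrA mulfV ?gt_eqF// mul1r.
Qed.

Lemma block_sum_shift i : block_sum x p i = block_sum y p i + p%:R * mu.
Proof.
rewrite /block_sum; under eq_bigr do rewrite xy//.
by rewrite big_split/= sumr_const card_ord mulr_natl.
Qed.

(** Centering removes the mean, so that block sums of the centered sequence may
    be used. *)
Lemma std_block_shift a : std_block x p (k := k) a = std_block y p a.
Proof.
rewrite /std_block; congr (_ / _).
under eq_bigr do rewrite block_sum_shift.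
rewrite block_sum_shift big_split/= sumr_const card_ord -[_ *+ k]mulr_natl.
by field; exact: lt0r_neq0.
Qed.

Lemma std_block_sqr :
  \sum_a std_block y p (k := k) a ^+ 2 =
  (\sum_(i < k) block_sum y p i ^+ 2) / (k * p)%:R -
  (\sum_(i < k) block_sum y p i) ^+ 2 / (k%:R ^+ 2 * p%:R).
Proof.
rewrite /std_block; set m := k%:R^-1 * _.
under eq_bigr do rewrite expr_div_n (sqr_sqrtr (ltW kp0)) sqrrB.
rewrite -mulr_suml big_split/= sumrB sumr_const card_ord.
under [X in _ - X + _]eq_bigr do rewrite mulrC -mulrnAl.
rewrite -mulr_sumr -[m ^+ 2 *+ k]mulr_natl natrM /m.
set L := \sum_(j < k) _; field.
by rewrite !lt0r_neq0.
Qed.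

Lemma std_block_bound B : (forall i, (1 <= i)%N -> `|y i| <= B) ->
  forall a, `|std_block y p (k := k) a| <= 2 * B * p%:R / Num.sqrt (k * p)%:R.
Proof.
move=> yB a; rewrite /std_block normrM (gtr0_norm (_ : 0 < (Num.sqrt _)^-1)) ?invr_gt0//.
rewrite ler_pM2r ?invr_gt0//.
have bB i : `|block_sum y p i| <= B * p%:R.
  apply: (le_trans (ler_norm_sum _ _ _)).
  rewrite mulr_natr -[X in _ *+ X](card_ord p) -sumr_const.
  by apply: ler_sum => r _; exact: yB.
rewrite (le_trans (ler_normB _ _))// -mulrA [leRHS]mulrDl mul1r lerD//.
rewrite normrM gtr0_norm ?invr_gt0// ler_pdivrMl//.
apply: (le_trans (ler_norm_sum _ _ _)).
rewrite mulr_natl -[X in _ *+ X](card_ord k) -sumr_const.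
by apply: ler_sum.
Qed.

Lemma boot_scaled_varianceE n : nblocks p n = k ->
  boot_scaled_variance x p n = \sum_a std_block x p (k := k) a ^+ 2.
Proof.
move=> nk; rewrite /boot_scaled_variance nk /boot_variance.
have W0 : boot_expectation (boot_sum (std_block x p (k := k))) = 0.
  have b0 a : `|std_block x p (k := k) a| <= \sum_(b < k) `|std_block x p b|.
    by rewrite (bigD1 a)//= lerDl sumr_ge0.
  have := stein_bound k0 std_block_sum0 b0 (g := fun=> 1) (g1 := fun=> 0) (L := 0).
  rewrite boot_expectation_cst// !mulr0 !mul0r subr0.
  under eq_fun do rewrite mulr1.
  move=> h; apply/eqP; rewrite -normr_le0 -[X in `|X|]subr0; apply: h => u v.
    by rewrite subrr mulr0 subrr normr0 mul0r.
  by rewrite normr0 mul0r.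
have e (J : draws k) : Num.sqrt (k * p)%:R * boot_mean x p J =
    boot_sum (std_block x p (k := k)) J + Num.sqrt (k * p)%:R * mean x (k * p).
  by rewrite -boot_mean_std mulrBr subrK.
have -> : boot_expectation (fun J : draws k => Num.sqrt (k * p)%:R * boot_mean x p J) =
    Num.sqrt (k * p)%:R * mean x (k * p).
  by under eq_fun do rewrite e; rewrite boot_expectationD W0 boot_expectation_cst// add0r.
under eq_fun do rewrite e addrK.
apply: (@boot_sum_variance _ _ _ (\sum_(b < k) `|std_block x p b|) k0 std_block_sum0).
by move=> a; rewrite (bigD1 a)//= lerDl sumr_ge0.
Qed.

End fixed.

(** Along a fixed path, both conclusions follow from the convergence of the
    average of the squared block sums and from the smallness of the squared
    average of the block sums. *)
Lemma boot_pathwise x y (mu B sigma2 : R) (p : nat -> nat) :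
  (forall i, (1 <= i)%N -> x i = y i + mu) ->
  (forall i, (1 <= i)%N -> `|y i| <= B) ->
  (forall n, (1 <= n)%N -> (0 < p n)%N) ->
  ((p n)%:R ^+ 2 / n%:R : R) @[n --> \oo] --> (0 : R) ->
  (\sum_(i < nblocks (p n) n) block_sum y (p n) i ^+ 2) / (nblocks (p n) n * p n)%:R
    @[n --> \oo] --> sigma2 ->
  (\sum_(i < nblocks (p n) n) block_sum y (p n) i) ^+ 2 /
    ((nblocks (p n) n)%:R ^+ 2 * (p n)%:R) @[n --> \oo] --> 0 ->
  boot_scaled_variance x (p n) n @[n --> \oo] --> sigma2 /\
  cvg_in_distribution (fun n => boot_cdf x (p n) n) (gaussian sigma2).
Proof.
move=> xy yB p0 psmall Qs L0.
pose k n := nblocks (p n) n.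
(* The complete blocks cover at least half of the sample. *)
have half : \forall n \near \oo, (n%:R / 2 <= (k n * p n)%:R :> R) /\ (0 < n)%N.
  have h20 : 0 < 2^-1 :> R by rewrite invr_gt0 ltr0n.
  have h := cvgr_le _ psmall _ h20.
  near=> n.
  have n0 : (0 < n)%N by near: n; exact: nbhs_infty_gt.
  split=> //; have : (p n)%:R ^+ 2 / n%:R <= 2^-1 :> R by near: n; exact: h.
  rewrite ler_pdivrMr ?ltr0n// => h1.
  have : (n <= k n * p n + p n)%N.
    by rewrite {1}(divn_eq n (p n)) leq_add2l ltnW// ltn_mod p0.
  rewrite -(ler_nat R) natrD => h2.
  have : 1 <= (p n)%:R :> R by rewrite ler1n p0.
  move=> p1; have : (p n)%:R <= (p n)%:R ^+ 2 :> R by rewrite expr2 ler_peMl.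
  lra.
have kpos : \forall n \near \oo, (0 < k n)%N /\ (0 < p n)%N.
  apply: filterS half => n [h n0]; split; last exact: p0.
  case: (k n) h => //; rewrite mul0n ler_pdivrMr// mul0r lern0.
  by case: (n) n0.
have vs : \sum_a std_block x (p n) (k := k n) a ^+ 2 @[n --> \oo] --> sigma2.
  rewrite -[sigma2]subr0.
  apply: cvg_trans (cvgB Qs L0); apply: near_eq_cvg.
  apply: filterS kpos => n [kn pn].
  rewrite fctE -(std_block_sqr y pn kn); apply: eq_bigr => a _.
  by rewrite (std_block_shift _ kn xy).
have d0 : 2 * B * (p n)%:R / Num.sqrt (k n * p n)%:R @[n --> \oo] --> (0:R).
  rewrite -(mulr0 (2 * B)); under eq_fun do rewrite -mulrA.
  apply: cvgM; first exact: cvg_cst.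
  apply/cvgr0Pnorm_lt => e e0.
  have e2 : 0 < e ^+ 2 / 2 by rewrite divr_gt0 ?exprn_gt0.
  have small := cvgr_lt _ psmall _ e2.
  near=> n.
  have [h n0] : (n%:R / 2 <= (k n * p n)%:R :> R) /\ (0 < n)%N by near: n.
  have [kn pn] : (0 < k n)%N /\ (0 < p n)%N by near: n.
  have kp0 : 0 < (k n * p n)%:R :> R by rewrite ltr0n muln_gt0 kn.
  have pn2 : (p n)%:R ^+ 2 / n%:R < e ^+ 2 / 2 :> R by near: n; exact: small.
  rewrite ger0_norm ?divr_ge0 ?sqrtr_ge0//.
  rewrite -ltr_sqr ?nnegrE ?divr_ge0 ?sqrtr_ge0 ?(ltW e0)//.
  rewrite expr_div_n sqr_sqrtr ?(ltW kp0)// ltr_pdivrMr//.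
  move: pn2; rewrite ltr_pdivrMr ?ltr0n// => /lt_le_trans; apply.
  by rewrite -mulrA ler_pM2l ?exprn_gt0//; lra.
split.
  apply: cvg_trans vs; apply: near_eq_cvg; apply: filterS kpos => n [kn pn].
  by rewrite (boot_scaled_varianceE x pn kn erefl).
have s0 : 0 <= sigma2.
  rewrite leNgt; apply/negP => s0; have h := cvgr_lt _ vs _ s0.
  near \oo => n.
  have : \sum_a std_block x (p n) (k := k n) a ^+ 2 < 0 by near: n; exact: h.
  by rewrite ltNge sumr_ge0// => a _; exact: sqr_ge0.
have kpos1 : \forall n \near \oo, (0 < k n)%N by apply: filterS kpos => n [].
have sum0 : \forall n \near \oo, \sum_a std_block x (p n) (k := k n) a = 0.
  by apply: filterS kpos => n [kn pn]; exact: std_block_sum0.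
have bnd : \forall n \near \oo, forall a, `|std_block x (p n) (k := k n) a| <=
    2 * B * (p n)%:R / Num.sqrt (k n * p n)%:R.
  apply: filterS kpos => n [kn pn] a.
  by rewrite (std_block_shift _ kn xy); exact: std_block_bound.
move=> t Gt; have := boot_clt kpos1 sum0 bnd d0 s0 vs Gt.
apply: cvg_trans; apply: near_eq_cvg; apply: filterS kpos => n [kn pn].
rewrite /boot_cdf -/(k n); congr boot_prob; apply/seteqP; split=> J /=;
by rewrite (boot_mean_std x pn kn).
Unshelve. all: by end_near. Qed.

End block_sums.

(** * Expectations of bounded measurable functions *)

Section bounded_expectation.
Context {d : measure_display} {T : measurableType d} {R : realType}
        (P : probability T R).
Implicit Types (f g : T -> R).

(** All variables can be truncated; bounded measurable functions form an algebra
    on which the expectation is real valued and linear. *)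
Definition bfun f := measurable_fun setT f /\ exists C, forall w, `|f w| <= C.

Definition Ex f : R := (\int[P]_w f w)%R.

Lemma bfun_cst c : bfun (fun=> c).
Proof. by split; [exact: measurable_cst|exists `|c|]. Qed.

Lemma bfunD f g : bfun f -> bfun g -> bfun (fun w => f w + g w).
Proof.
move=> [mf [C fC]] [mg [D gD]]; split; first exact: measurable_funD.
by exists (C + D) => w; rewrite (le_trans (ler_normD _ _))// lerD.
Qed.

Lemma bfunM f g : bfun f -> bfun g -> bfun (fun w => f w * g w).
Proof.
move=> [mf [C fC]] [mg [D gD]]; split; first exact: measurable_funM.
by exists (C * D) => w; rewrite normrM ler_pM.
Qed.

Lemma bfunN f : bfun f -> bfun (fun w => - f w).
Proof.
move=> [mf [C fC]]; split; first exact: measurable_funN.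
by exists C => w; rewrite normrN.
Qed.

Lemma bfunB f g : bfun f -> bfun g -> bfun (fun w => f w - g w).
Proof. by move=> bf bg; exact: bfunD bf (bfunN bg). Qed.

Lemma bfun_abs f : bfun f -> bfun (fun w => `|f w|).
Proof.
move=> [mf [C fC]]; split; first exact: measurableT_comp.
by exists C => w; rewrite normr_id.
Qed.

Lemma bfunX f n : bfun f -> bfun (fun w => f w ^+ n).
Proof.
move=> bf; elim: n => [|n IH]; first exact: bfun_cst.
by under eq_fun do rewrite exprS; exact: bfunM.
Qed.

Lemma bfun_sum (I : Type) (r : seq I) (Q : pred I) (F : I -> T -> R) :
  (forall i, Q i -> bfun (F i)) -> bfun (fun w => \sum_(i <- r | Q i) F i w).
Proof.
move=> bF; elim: r => [|i r IH].
  by under eq_fun do rewrite big_nil; exact: bfun_cst.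
case Qi: (Q i); under eq_fun do rewrite big_cons Qi; last by [].
by apply: bfunD => //; exact: bF.
Qed.

Lemma bfun_prod (I : Type) (r : seq I) (Q : pred I) (F : I -> T -> R) :
  (forall i, Q i -> bfun (F i)) -> bfun (fun w => \prod_(i <- r | Q i) F i w).
Proof.
move=> bF; elim: r => [|i r IH].
  by under eq_fun do rewrite big_nil; exact: bfun_cst.
case Qi: (Q i); under eq_fun do rewrite big_cons Qi; last by [].
by apply: bfunM => //; exact: bF.
Qed.

Lemma bfun_indic (A : set T) : measurable A -> bfun (\1_A).
Proof.
move=> mA; split; first exact: measurable_indic.
by exists 1 => w; rewrite indicE; case: (_ \in _); rewrite ?normr1 ?normr0.
Qed.

Lemma bfun_integrable f : bfun f -> P.-integrable setT (EFin \o f).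
Proof.
move=> [mf [C fC]]; apply: measurable_bounded_integrable => //.
  by rewrite (le_lt_trans (probability_le1 P measurableT))// ltry.
exists C; split; first exact: num_real.
by move=> M CM w _; apply: (le_trans (fC w)); exact: ltW.
Qed.

Lemma Ex_cst c : Ex (fun=> c) = c.
Proof.
rewrite /Ex Rintegral_cst// -[RHS]mulr1; congr *%R.
exact: (congr1 fine (probability_setT P)).
Qed.

Lemma ExD f g : bfun f -> bfun g -> Ex (fun w => f w + g w) = Ex f + Ex g.
Proof. by move=> bf bg; rewrite /Ex RintegralD//; exact: bfun_integrable. Qed.

Lemma ExB f g : bfun f -> bfun g -> Ex (fun w => f w - g w) = Ex f - Ex g.
Proof. by move=> bf bg; rewrite /Ex RintegralB//; exact: bfun_integrable. Qed.

Lemma ExZ c f : bfun f -> Ex (fun w => c * f w) = c * Ex f.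
Proof. by move=> bf; rewrite /Ex RintegralZl//; exact: bfun_integrable. Qed.

Lemma ExZr c f : bfun f -> Ex (fun w => f w * c) = Ex f * c.
Proof. by move=> bf; rewrite /Ex RintegralZr//; exact: bfun_integrable. Qed.

Lemma Ex_ge0 f : (forall w, 0 <= f w) -> 0 <= Ex f.
Proof. by move=> f0; exact: Rintegral_ge0. Qed.

Lemma Ex_le f g : bfun f -> bfun g -> (forall w, f w <= g w) -> Ex f <= Ex g.
Proof. by move=> bf bg fg; apply: le_Rintegral => //; exact: bfun_integrable. Qed.

Lemma Ex_abs f : bfun f -> `|Ex f| <= Ex (fun w => `|f w|).
Proof. by move=> bf; apply: le_normr_Rintegral => //; exact: bfun_integrable. Qed.

Lemma Ex_sum (I : Type) (r : seq I) (Q : pred I) (F : I -> T -> R) :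
  (forall i, Q i -> bfun (F i)) ->
  Ex (fun w => \sum_(i <- r | Q i) F i w) = \sum_(i <- r | Q i) Ex (F i).
Proof.
move=> bF; elim: r => [|i r IH].
  by under eq_fun do rewrite big_nil; rewrite big_nil Ex_cst.
rewrite big_cons; case Qi: (Q i); under eq_fun do rewrite big_cons Qi; last by [].
by rewrite ExD ?IH//; [exact: bF|exact: bfun_sum].
Qed.

Lemma Ex_bound f C : bfun f -> (forall w, `|f w| <= C) -> `|Ex f| <= C.
Proof.
move=> bf fC; rewrite (le_trans (Ex_abs bf))// -[leRHS]Ex_cst.
by apply: Ex_le => //; [exact: bfun_abs|exact: bfun_cst].
Qed.

Lemma EFin_Ex f : bfun f -> (Ex f)%:E = (\int[P]_w (f w)%:E)%E.
Proof. by move=> bf; rewrite /Ex /Rintegral fineK// integrable_fin_num//; exact: bfun_integrable. Qed.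

Lemma Ex_indic (A : set T) : measurable A -> Ex \1_A = fine (P A).
Proof. by move=> mA; rewrite /Ex /Rintegral integral_indic// setIT. Qed.

End bounded_expectation.

Section summable.
Context {R : realType}.
Implicit Types (b : nat -> R).

(** For nonnegative terms; partial sums need only be bounded, and no limit has
    to be named. *)
Definition summable b := exists C, forall n, \sum_(l < n) b l <= C.

Lemma summableZ c b : 0 <= c -> summable b -> summable (fun l => c * b l).
Proof.
move=> c0 [C bC]; exists (c * C) => n.
by rewrite -mulr_sumr ler_wpM2l.
Qed.

Lemma summableD b1 b2 : summable b1 -> summable b2 -> summable (fun l => b1 l + b2 l).
Proof. by move=> [C1 h1] [C2 h2]; exists (C1 + C2) => n; rewrite big_split lerD. Qed.

Lemma summable_le b1 b2 : (forall l, b1 l <= b2 l) -> summable b2 -> summable b1.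
Proof.
by move=> b12 [C bC]; exists C => n; apply: le_trans (bC n); exact: ler_sum.
Qed.

Lemma summable_geometric (z : R) : 0 <= z < 1 -> summable (fun l => z ^+ l).
Proof.
move=> /andP[z0 z1]; exists (1 - z)^-1 => n.
have z10 : 0 < 1 - z by rewrite subr_gt0.
rewrite -[leRHS]mul1r ler_pdivlMr// mulrC.
have -> : (1 - z) * \sum_(l < n) z ^+ l = 1 - z ^+ n.
  elim: n => [|n IH]; first by rewrite big_ord0 mulr0 expr0 subrr.
  by rewrite big_ord_recr/= mulrDr IH exprS; ring.
by rewrite gerBl exprn_ge0.
Qed.

Lemma summable_cvg b : (forall l, 0 <= b l) -> summable b -> cvgn (series b).
Proof.
move=> b0 [C bC]; apply: nondecreasing_is_cvgn.
  by apply/nondecreasing_seqP => n; rewrite /series/= big_nat_recr//= lerDl.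
by exists C => _ [n _ <-]; rewrite /series/= big_mkord.
Qed.

End summable.

(** * Almost sure convergence from summable expectations *)

(** The series of the [D l] has a finite expectation, hence is almost surely
    finite, and its terms tend to 0. *)
Lemma ae_cvg0_summable (d : measure_display) (T : measurableType d) (R : realType)
    (P : probability T R) (D : nat -> T -> R) (b : nat -> R) :
  (forall l, bfun (D l)) -> (forall l w, 0 <= D l w) ->
  (forall l, Ex P (D l) <= b l) -> summable b ->
  {ae P, forall w, D l w @[l --> \oo] --> (0 : R)}.
Proof.
move=> bD D0 Db [C bC].
pose S w := (\sum_(0 <= l <oo) (D l w)%:E)%E.
have mD l : measurable_fun setT (fun w => (D l w)%:E).
  by apply/measurable_EFinP; case: (bD l).
have S0 w : (0 <= S w)%E by apply: nneseries_ge0 => l _ _; rewrite lee_fin.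
have mS : measurable_fun setT S.
  by apply: ge0_emeasurable_sum => // l w _ _; rewrite lee_fin.
have iS : (\int[P]_w S w <= C%:E)%E.
  rewrite /S integral_nneseries//; last by move=> l w _; rewrite lee_fin.
  apply: lime_le.
    by apply: is_cvg_nneseries => l _ _; apply: integral_ge0 => w _; rewrite lee_fin.
  near=> n; rewrite (_ : (\sum_(0 <= i < n) _)%E = (\sum_(l < n) Ex P (D l))%:E).
    rewrite lee_fin; apply: le_trans (bC n); exact: ler_sum.
  by rewrite big_mkord -sumEFin; apply: eq_bigr => l _; rewrite EFin_Ex.
have intS : P.-integrable setT S.
  apply/integrableP; split => //; under eq_integral do rewrite gee0_abs//.
  by rewrite (le_lt_trans iS)// ltry.
have := integrable_ae measurableT intS; apply: filterS => w /(_ I) fS.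
apply: cvg_series_cvg_0; apply: summable_cvg => //.
exists (fine (S w)) => n; rewrite -lee_fin fineK// -sumEFin -(big_mkord xpredT (fun l => (D l w)%:E)).
by apply: nneseries_lim_ge => l _; rewrite lee_fin.
Unshelve. all: by end_near. Qed.

(** * Interpolation along a grid *)

Section interpolation.
Context {R : realType}.
Implicit Types (s : nat -> R) (e : R).

(** Cauchy-Schwarz, by summing [(s i - c) ^ 2 >= 0] for [c] the mean of [s]. *)
Lemma sqr_sum_le (n : nat) (s : nat -> R) m :
  (\sum_(m <= i < m + n) s i) ^+ 2 <= n%:R * \sum_(m <= i < m + n) s i ^+ 2.
Proof.
set S := \sum_(_ <= _ < _) _; set Q := \sum_(_ <= _ < _) _ ^+ 2.
case: n @S @Q => [|n] S Q.
  by rewrite /S addn0 big_geq// expr0n mul0r.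
have n0 : 0 < n.+1%:R :> R by rewrite ltr0n.
have key c : 2 * c * S <= Q + c ^+ 2 * n.+1%:R.
  have <- : \sum_(m <= i < m + n.+1) c ^+ 2 = c ^+ 2 * n.+1%:R.
    by rewrite sumr_const_nat addKn mulr_natr.
  rewrite /S /Q mulr_sumr -big_split/=; apply: ler_sum => i _.
  by have := sqr_ge0 (s i - c); nra.
have := key (S / n.+1%:R).
have -> : 2 * (S / n.+1%:R) * S = 2 * (S ^+ 2 / n.+1%:R) by ring.
have -> : (S / n.+1%:R) ^+ 2 * n.+1%:R = S ^+ 2 / n.+1%:R.
  by field; exact: lt0r_neq0.
move=> h; have {h}: S ^+ 2 / n.+1%:R <= Q.
  by move: h; set z := S ^+ 2 / _; rewrite mulr_natl mulr2n lerD2r.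
by rewrite ler_pdivrMr// mulrC.
Qed.

(** Sums of squares increase with their length, so that a deviation between two
    points of a grid is controlled by those at the two points and by the drift
    [e] accumulated between them. *)
Lemma interpolate_squares s e (k1 k k2 : nat) : 0 <= e ->
  (k1 <= k <= k2)%N ->
  `|\sum_(i < k) (s i ^+ 2 - e)| <=
    `|\sum_(i < k1) (s i ^+ 2 - e)| + `|\sum_(i < k2) (s i ^+ 2 - e)| +
    (k2%:R - k1%:R) * e.
Proof.
move=> e0 /andP[k1k kk2]; pose T m := \sum_(i < m) (s i ^+ 2 - e).
rewrite -/(T k) -/(T k1) -/(T k2).
have TE m : T m = \sum_(i < m) s i ^+ 2 - m%:R * e.
  by rewrite /T sumrB sumr_const card_ord mulr_natl.
have mono m m' : (m <= m')%N -> \sum_(i < m) s i ^+ 2 <= \sum_(i < m') s i ^+ 2.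
  move=> mm; rewrite -(subnK mm) addnC big_split_ord/= lerDl.
  by apply: sumr_ge0 => i _; exact: sqr_ge0.
have := mono _ _ k1k; have := mono _ _ kk2.
have : k1%:R <= k%:R :> R by rewrite ler_nat.
have : k%:R <= k2%:R :> R by rewrite ler_nat.
rewrite ler_norml !TE.
have := ler_norm (T k2); have := ler_norm (- T k1); rewrite normrN !TE.
set a := \sum_(i < k1) _; set b := \sum_(i < k) _; set c := \sum_(i < k2) _.
have := normr_ge0 (a - k1%:R * e); have := normr_ge0 (c - k2%:R * e).
set u := `| _ |; set v := `| _ |.
move=> *; apply/andP; split; nra.
Qed.

(** The part of the sum after [k1] has at most [k2 - k1] terms. *)
Lemma interpolate_sums s (k1 k k2 : nat) : (k1 <= k <= k2)%N ->
  (\sum_(i < k) s i) ^+ 2 <= 2 * (\sum_(i < k1) s i) ^+ 2 +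
    2 * (k2%:R - k1%:R) * \sum_(i < k) s i ^+ 2.
Proof.
move=> /andP[k1k kk2].
have split (f : nat -> R) : \sum_(i < k) f i = \sum_(i < k1) f i + \sum_(k1 <= i < k1 + (k - k1)) f i.
  by rewrite subnKC// -!(big_mkord xpredT) -big_cat_nat.
have := sqr_sum_le (k - k1) s k1.
rewrite (split s) (split (fun i => s i ^+ 2)).
set a := \sum_(i < k1) s i; set b := \sum_(_ <= _ < _) s _.
set A := \sum_(i < k1) _ ^+ 2; set B := \sum_(_ <= _ < _) _ ^+ 2.
have A0 : 0 <= A by apply: sumr_ge0 => i _; exact: sqr_ge0.
have B0 : 0 <= B by apply: sumr_ge0 => i _; exact: sqr_ge0.
rewrite natrB//.
have h1 : k1%:R <= k%:R :> R by rewrite ler_nat.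
have h2 : k%:R <= k2%:R :> R by rewrite ler_nat.
have := sqr_ge0 (a - b).
have h3 : (k%:R - k1%:R) * B <= (k2%:R - k1%:R) * (A + B).
  by apply: ler_pM => //; rewrite ?subr_ge0// ?lerD2r// lerDr.
nra.
Qed.

End interpolation.

(** The points [2 ^ l + j 2 ^ (l - r)], cut off at [2 ^ (l + 1)]: for each [r],
    finitely many points divide the dyadic interval number [l] with a mesh
    proportional to its length. *)
Definition grid (r l j : nat) : nat := minn (2 ^ l + j * 2 ^ (l - r)) (2 ^ l.+1).

Lemma grid_exists r l n : (r <= l)%N -> (2 ^ l <= n < 2 ^ l.+1)%N ->
  exists2 j, (j < 2 ^ r)%N & (grid r l j <= n <= grid r l j.+1)%N.
Proof.
move=> rl /andP[n1 n2]; exists ((n - 2 ^ l) %/ 2 ^ (l - r))%N.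
  rewrite ltn_divLR ?expn_gt0// -expnD subnKC//.
  by rewrite expnS in n2; lia.
have h1 := leq_trunc_div (n - 2 ^ l) (2 ^ (l - r)).
have h2 := ltn_ceil (n - 2 ^ l) (_ : 0 < 2 ^ (l - r))%N.
rewrite expn_gt0/= in h2; have {}h2 := h2 isT.
rewrite /grid leq_min geq_min; apply/andP; split; first by apply/orP; left; lia.
by rewrite (ltnW n2) andbT; lia.
Qed.

Lemma grid_step r l j : (grid r l j.+1 <= grid r l j + 2 ^ (l - r))%N.
Proof. rewrite /grid mulSn; lia. Qed.

Lemma grid_ge r l j : (2 ^ l <= grid r l j <= 2 ^ l.+1)%N.
Proof. rewrite /grid expnS; lia. Qed.

(** * Interpolation between the grid points along a path *)

(** For a single [n] in the dyadic interval number [l], [delta] bounds the mesh,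
    the block length and the deviations at the grid points, relative to
    [N = 2 ^ l]. Up to a multiple of [delta], the two terms of the population
    variance are then [e / q] and 0. *)
Section one_step.
Context {R : realType}.
Variables (y : nat -> R) (e C delta : R) (q r l n : nat).
Let S i := block_sum y q i.
Let k := (n %/ q)%N.
Let N : R := (2 ^ l)%:R.
Hypotheses (q0 : (0 < q)%N) (rl : (r <= l)%N) (nl : (2 ^ l <= n < 2 ^ l.+1)%N).
Hypotheses (d0 : 0 < delta) (d1 : delta <= 1).
Hypotheses (e0 : 0 <= e) (eC : e <= C * q%:R).
Hypothesis rd : (2 ^ (l - r))%:R <= delta * N.
Hypothesis qd : q%:R <= delta * N.
Hypothesis qN : 2 * q%:R <= N.
Hypothesis dev : forall j, (j <= 2 ^ r)%N ->
  (\sum_(i < grid r l j %/ q) (S i ^+ 2 - e)) ^+ 2 <= (delta * N) ^+ 2.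
Hypothesis sums : forall j, (j <= 2 ^ r)%N ->
  (\sum_(i < grid r l j %/ q) S i) ^+ 2 * q%:R <= delta * N ^+ 2.

Let N0 : 0 < N. Proof. by rewrite ltr0n expn_gt0. Qed.
Let qR0 : 0 < q%:R :> R. Proof. by rewrite ltr0n. Qed.
Let C0 : 0 <= C. Proof. by rewrite -(pmulr_lge0 _ qR0); exact: le_trans eC. Qed.

Let kq_ge : N / 2 <= k%:R * q%:R.
Proof.
have : (2 ^ l <= k * q + q)%N.
  have /andP[h _] := nl; apply: (leq_trans h).
  by rewrite {1}(divn_eq n q) leq_add2l ltnW// ltn_mod.
rewrite -(ler_nat R) natrD natrM -/N => h; have := qN; lra.
Qed.

Let kq_le : k%:R * q%:R <= 2 * N.
Proof.
rewrite -natrM -natrM ler_nat -expnS.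
by have /andP[_ h] := nl; apply: leq_trans (ltnW h); exact: leq_trunc_div.
Qed.

Let kq0 : 0 < k%:R * q%:R :> R.
Proof. by apply: lt_le_trans kq_ge; rewrite divr_gt0. Qed.

(* Consecutive grid points around [n], expressed in numbers of blocks. *)
Let bracket : exists k1 k2, [/\ (k1 <= k <= k2)%N,
  (k2%:R - k1%:R) * q%:R <= 2 * delta * N,
  (exists2 j, (j <= 2 ^ r)%N & k1 = (grid r l j %/ q)%N) &
  (exists2 j, (j <= 2 ^ r)%N & k2 = (grid r l j %/ q)%N)].
Proof.
have [j j2 /andP[g1 g2]] := grid_exists rl nl.
exists (grid r l j %/ q)%N, (grid r l j.+1 %/ q)%N; split.
- by rewrite !leq_div2r.
- have h1 := leq_trunc_div (grid r l j.+1) q.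
  have h2 : (grid r l j <= grid r l j %/ q * q + q)%N.
    by rewrite addnC -mulSn ltnW// ltn_ceil.
  have h3 := grid_step r l j.
  move: h1 h2 h3; rewrite -!(ler_nat R) !natrD !natrM.
  set a := (grid r l j)%:R; set b := (grid r l j.+1)%:R.
  set u := (_ %/ _)%:R; set v := (_ %/ _)%:R => *.
  have := rd; have := qd; nra.
- by exists j => //; exact: ltnW.
- by exists j.+1.
Qed.

Lemma one_step_squares :
  `|(\sum_(i < k) S i ^+ 2) / (k * q)%:R - e / q%:R| <= 4 * (1 + C) * delta.
Proof.
have [k1 [k2 [kk kd [j1 j1r k1E] [j2 j2r k2E]]]] := bracket.
have := interpolate_squares S e0 kk.
have dN0 : 0 <= delta * N by rewrite mulr_ge0 ?ltW.
have absd j : (j <= 2 ^ r)%N -> `|\sum_(i < grid r l j %/ q) (S i ^+ 2 - e)| <= delta * N.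
  move=> /dev; rewrite -[_ ^+ 2 in X in X -> _]real_normK ?num_real//.
  by rewrite ler_sqr// nnegrE.
have t1 := absd _ j1r; have t2 := absd _ j2r; rewrite -k1E in t1; rewrite -k2E in t2.
have t3 : (k2%:R - k1%:R) * e <= 2 * delta * N * C.
  have h : 0 <= k2%:R - k1%:R :> R.
    by rewrite subr_ge0 ler_nat; have /andP[h1 h2] := kk; exact: leq_trans h2.
  apply: (le_trans (ler_wpM2l h eC)).
  by rewrite (mulrC C) mulrA ler_wpM2r.
rewrite sumrB sumr_const card_ord -[_ *+ k]mulr_natl => t4.
have -> : (\sum_(i < k) S i ^+ 2) / (k * q)%:R - e / q%:R =
    (\sum_(i < k) S i ^+ 2 - k%:R * e) / (k%:R * q%:R).
  rewrite natrM; field; rewrite lt0r_neq0//=.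
  by apply/eqP => h; move: kq0; rewrite h mul0r ltxx.
rewrite normrM normfV (gtr0_norm kq0) ler_pdivrMr//.
apply: (le_trans t4); apply: le_trans (ler_wpM2l _ kq_ge); last first.
  by rewrite !mulr_ge0 ?addr_ge0// ltW.
have := N0; have := d0; have := C0; nra.
Qed.

Lemma one_step_sums :
  (\sum_(i < k) S i) ^+ 2 / (k%:R ^+ 2 * q%:R) <= (8 + 32 * (5 * C + 4)) * delta.
Proof.
have [k1 [k2 [kk kd [j1 j1r k1E] _]]] := bracket.
have t1 := interpolate_sums S kk.
have t2 := sums j1r; rewrite -k1E in t2.
have kR0 : 0 < k%:R :> R.
  by rewrite lt_neqAle ler0n andbT; apply/eqP => h; move: kq0; rewrite -h mul0r ltxx.
have Q0 : 0 <= \sum_(i < k) S i ^+ 2 by apply: sumr_ge0 => i _; exact: sqr_ge0.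
have Qb : \sum_(i < k) S i ^+ 2 <= (5 * C + 4) * (2 * N).
  have := one_step_squares; rewrite ler_distl => /andP[_].
  have h1 : e / q%:R <= C by rewrite ler_pdivrMr.
  have h2 : 4 * (1 + C) * delta <= 4 * (1 + C).
    by rewrite ler_piMr// mulr_ge0// addr_ge0.
  rewrite natrM => h3.
  have h4 : (\sum_(i < k) S i ^+ 2) / (k%:R * q%:R) <= 5 * C + 4 by lra.
  rewrite ler_pdivrMr// in h4; apply: (le_trans h4).
  by rewrite ler_wpM2l// addr_ge0// mulr_ge0.
have -> : (\sum_(i < k) S i) ^+ 2 / (k%:R ^+ 2 * q%:R) =
    ((\sum_(i < k) S i) ^+ 2 * q%:R) / (k%:R * q%:R) ^+ 2.
  by field; rewrite !lt0r_neq0.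
rewrite ler_pdivrMr ?exprn_gt0//.
have t3 : (\sum_(i < k) S i) ^+ 2 * q%:R <=
    2 * (delta * N ^+ 2) + 4 * delta * N * ((5 * C + 4) * (2 * N)).
  apply: (le_trans (ler_wpM2r (ltW qR0) t1)).
  rewrite mulrDl; apply: lerD; first by rewrite -mulrA ler_wpM2l.
  have -> : 2 * (k2%:R - k1%:R) * (\sum_(i < k) S i ^+ 2) * q%:R =
    2 * ((k2%:R - k1%:R) * q%:R) * (\sum_(i < k) S i ^+ 2) by ring.
  apply: ler_pM => //; last by lra.
  have /andP[h1 h2] := kk.
  by rewrite !mulr_ge0// subr_ge0 ler_nat (leq_trans h1).
apply: (le_trans t3).
have -> : 2 * (delta * N ^+ 2) + 4 * delta * N * ((5 * C + 4) * (2 * N)) =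
  (8 + 32 * (5 * C + 4)) * delta * (N / 2) ^+ 2 by field.
apply: ler_wpM2l.
  by rewrite mulr_ge0 ?(ltW d0)// addr_ge0// mulr_ge0// addr_ge0// mulr_ge0.
by rewrite ler_sqr ?nnegrE ?(ltW kq0)// divr_ge0// ltW.
Qed.

End one_step.

Section path_limits.
Context {R : realType}.
Variables (y e : nat -> R) (C sigma2 : R) (p : nat -> nat).
Hypothesis p0 : forall n, (1 <= n)%N -> (0 < p n)%N.
Hypothesis p_cvg : p n @[n --> \oo] --> \oo.
Hypothesis p_dyadic : forall l n, (1 <= l)%N -> (2 ^ l <= n < 2 ^ l.+1)%N ->
  p n = p (2 ^ l)%N.
Hypothesis p_small : ((p n)%:R ^+ 2 / n%:R : R) @[n --> \oo] --> (0 : R).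
Hypothesis e0 : forall n, 0 <= e n.
Hypothesis eC : forall n, e n <= C * n%:R.
Hypothesis e_cvg : e n / n%:R @[n --> \oo] --> sigma2.

(** Sums over the grid points, rather than maxima, have expectations that can be
    computed term by term. *)
Definition grid_dev r l : R := \sum_(j < (2 ^ r).+1)
  (\sum_(i < grid r l j %/ p (2 ^ l)) (block_sum y (p (2 ^ l)) i ^+ 2 - e (p (2 ^ l)))) ^+ 2
  / (2 ^ l)%:R ^+ 2.

Definition grid_sums r l : R := \sum_(j < (2 ^ r).+1)
  (\sum_(i < grid r l j %/ p (2 ^ l)) block_sum y (p (2 ^ l)) i) ^+ 2 * (p (2 ^ l))%:R
  / (2 ^ l)%:R ^+ 2.

Hypothesis dev0 : forall r, grid_dev r l @[l --> \oo] --> (0:R).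
Hypothesis sums0 : forall r, grid_sums r l @[l --> \oo] --> (0:R).

Lemma pow2_cvg : (2 ^ l)%N @[l --> \oo] --> \oo.
Proof.
apply/cvgnyPge => A; near=> l; apply: leq_trans (ltnW (ltn_expl l _)) => //.
by near: l; exact: nbhs_infty_ge.
Unshelve. all: by end_near. Qed.

Lemma trunc_log_cvg : trunc_log 2 n @[n --> \oo] --> \oo.
Proof.
apply/cvgnyPge => A; near=> n; apply: trunc_log_max => //.
by near: n; exact: nbhs_infty_ge.
Unshelve. all: by end_near. Qed.

Lemma p_ratio_cvg : (p (2 ^ l))%:R / (2 ^ l)%:R @[l --> \oo] --> (0 : R).
Proof.
apply: (@squeeze_cvgr _ _ _ _ (fun=> 0) (fun l => (p (2 ^ l))%:R ^+ 2 / (2 ^ l)%:R)).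
- near=> l; rewrite divr_ge0//= ler_wpM2r ?invr_ge0// expr2 ler_peMl//.
  by rewrite ler1n p0// expn_gt0.
- exact: cvg_cst.
- exact: (cvg_comp _ _ pow2_cvg p_small).
Unshelve. all: by end_near. Qed.

(** For a given precision [delta], fix the mesh [2 ^ - r] first and let the
    dyadic level tend to infinity with [r] fixed. *)
Lemma eventually_close delta : 0 < delta -> delta <= 1 -> \forall n \near \oo,
  let k := nblocks (p n) n in
  `|(\sum_(i < k) block_sum y (p n) i ^+ 2) / (k * p n)%:R - e (p n) / (p n)%:R|
     <= 4 * (1 + C) * delta /\
  (\sum_(i < k) block_sum y (p n) i) ^+ 2 / (k%:R ^+ 2 * (p n)%:R)
     <= (8 + 32 * (5 * C + 4)) * delta.
Proof.
move=> d0 d1.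
have [r rd] : exists r, ((2 ^ r)%:R)^-1 <= delta.
  exists (Num.truncn delta^-1).+1.
  rewrite invf_ple ?posrE ?ltr0n ?expn_gt0// (le_trans (ltW (truncnS_gt _)))//.
  by rewrite ler_nat ltnW// ltn_expl.
have d2 : 0 < delta ^+ 2 by rewrite exprn_gt0.
have d3 : 0 < Num.min delta 2^-1 by rewrite lt_min d0/= invr_gt0 ltr0n.
have A1 := trunc_log_cvg (nbhs_infty_ge (maxn r 1)).
have A2 := trunc_log_cvg (cvgr_le _ (dev0 r) _ d2).
have A3 := trunc_log_cvg (cvgr_le _ (sums0 r) _ d0).
have A4 := trunc_log_cvg (cvgr_le _ p_ratio_cvg _ d3).
near=> n.
have n0 : (0 < n)%N by near: n; exact: nbhs_infty_gt.
have B1 : (maxn r 1 <= trunc_log 2 n)%N by near: n; exact: A1.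
have B2 : grid_dev r (trunc_log 2 n) <= delta ^+ 2 by near: n; exact: A2.
have B3 : grid_sums r (trunc_log 2 n) <= delta by near: n; exact: A3.
have B4 : (p (2 ^ trunc_log 2 n))%:R / (2 ^ trunc_log 2 n)%:R <= Num.min delta 2^-1.
  by near: n; exact: A4.
have nl : (2 ^ trunc_log 2 n <= n < 2 ^ (trunc_log 2 n).+1)%N.
  by rewrite trunc_logP// trunc_log_ltn.
move: (trunc_log 2 n) B1 B2 B3 B4 nl => l; rewrite geq_max => /andP[rl l1] a2 a3 + nl.
have N0 : 0 < (2 ^ l)%:R :> R by rewrite ltr0n expn_gt0.
rewrite le_min 2?(ler_pdivrMr _ _ N0) => /andP[a4 a5].
rewrite (p_dyadic l1 nl) /nblocks; set q := p (2 ^ l).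
have q0 : (0 < q)%N by rewrite p0// expn_gt0.
have a6 : (2 ^ (l - r))%:R <= delta * (2 ^ l)%:R.
  have r1 : 1 <= delta * (2 ^ r)%:R.
    by rewrite -ler_pdivrMr ?ltr0n ?expn_gt0// div1r.
  rewrite -[in leRHS](subnK rl) expnD natrM (mulrC (2 ^ (l - r))%:R) mulrA.
  by rewrite ler_peMl.
have a7 : 2 * q%:R <= (2 ^ l)%:R :> R by rewrite -/q in a5; lra.
have a8 j : (j <= 2 ^ r)%N ->
  (\sum_(i < grid r l j %/ q) (block_sum y q i ^+ 2 - e q)) ^+ 2 <= (delta * (2 ^ l)%:R) ^+ 2.
  rewrite -ltnS => j2; rewrite exprMn -ler_pdivrMr ?exprn_gt0//.
  apply: le_trans a2; rewrite /grid_dev (bigD1 (Ordinal j2))//= lerDl.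
  by apply: sumr_ge0 => i _; rewrite divr_ge0 ?sqr_ge0.
have a9 j : (j <= 2 ^ r)%N ->
  (\sum_(i < grid r l j %/ q) block_sum y q i) ^+ 2 * q%:R <= delta * (2 ^ l)%:R ^+ 2.
  rewrite -ltnS => j2; rewrite -ler_pdivrMr ?exprn_gt0//.
  apply: le_trans a3; rewrite /grid_sums (bigD1 (Ordinal j2))//= lerDl.
  by apply: sumr_ge0 => i _; rewrite divr_ge0 ?sqr_ge0// mulr_ge0 ?sqr_ge0.
split.
  exact: (one_step_squares q0 rl nl d0 (e0 q) (eC q) a6 a4 a7 a8).
exact: (one_step_sums q0 rl nl d0 d1 (e0 q) (eC q) a6 a4 a7 a8 a9).
Unshelve. all: by end_near. Qed.

Let C0 : 0 <= C.
Proof. by have := le_trans (e0 1) (eC 1); rewrite mulr1. Qed.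

Let scale (K eps : R) : 0 <= K -> 0 < eps -> 
  exists delta, [/\ 0 < delta, delta <= 1 & K * delta <= eps].
Proof.
move=> K0 eps0; exists (Num.min 1 (eps / (K + 1))); have K1 : 0 < K + 1 by lra.
split; first by rewrite lt_min ltr01 divr_gt0.
  by rewrite ge_min lexx.
apply: (@le_trans _ _ (K * (eps / (K + 1)))).
  by rewrite ler_wpM2l// ge_min lexx orbT.
by rewrite mulrA ler_pdivrMr// mulrC ler_pM2l// lerDl.
Qed.

Lemma block_squares_cvg :
  (\sum_(i < nblocks (p n) n) block_sum y (p n) i ^+ 2) / (nblocks (p n) n * p n)%:R
    @[n --> \oo] --> sigma2.
Proof.
pose Q n := (\sum_(i < nblocks (p n) n) block_sum y (p n) i ^+ 2) /
  (nblocks (p n) n * p n)%:R.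
suff : (Q n - e (p n) / (p n)%:R) + e (p n) / (p n)%:R @[n --> \oo] --> 0 + sigma2.
  by rewrite add0r; under eq_fun do rewrite subrK.
apply: cvgD; last exact: (cvg_comp _ _ p_cvg e_cvg).
apply/cvgr0Pnorm_le => eps eps0.
have K0 : 0 <= 4 * (1 + C) by rewrite mulr_ge0// addr_ge0.
have [delta [d0 d1 dK]] := scale K0 eps0.
by apply: filterS (eventually_close d0 d1) => n [h _]; exact: le_trans dK.
Qed.

Lemma block_sums_cvg :
  (\sum_(i < nblocks (p n) n) block_sum y (p n) i) ^+ 2 /
    ((nblocks (p n) n)%:R ^+ 2 * (p n)%:R) @[n --> \oo] --> 0.
Proof.
apply/cvgr0Pnorm_le => eps eps0.
have K0 : 0 <= 8 + 32 * (5 * C + 4) by rewrite addr_ge0// mulr_ge0// addr_ge0// mulr_ge0.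
have [delta [d0 d1 dK]] := scale K0 eps0.
apply: filterS (eventually_close d0 d1) => n [_ h].
rewrite ger0_norm ?divr_ge0 ?sqr_ge0 ?mulr_ge0 ?sqr_ge0//.
exact: le_trans dK.
Qed.

End path_limits.

(** * Almost sure behaviour of the blocks, and reduction to second moments *)

Section reduction.
Context {d : measure_display} {T : measurableType d} {R : realType}
        (P : probability T R).
Variables (Y : nat -> T -> R) (B : R) (e b : nat -> R) (sigma2 : R) (p : nat -> nat).
Hypothesis mY : forall i, measurable_fun setT (Y i).
Hypothesis YB : forall i w, `|Y i w| <= B.
Hypothesis p0 : forall n, (1 <= n)%N -> (0 < p n)%N.
Hypothesis p_cvg : p n @[n --> \oo] --> \oo.
Hypothesis p_dyadic : forall l n, (1 <= l)%N -> (2 ^ l <= n < 2 ^ l.+1)%N ->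
  p n = p (2 ^ l)%N.
Hypothesis p_small : ((p n)%:R ^+ 2 / n%:R : R) @[n --> \oo] --> (0 : R).
Hypothesis eE : forall q i, Ex P (fun w => block_sum (Y ^~ w) q i ^+ 2) = e q.
Hypothesis e_cvg : e n / n%:R @[n --> \oo] --> sigma2.
Hypothesis b_summable : summable b.
Hypothesis dev : forall l m, (m * p (2 ^ l) <= 2 ^ l.+1)%N ->
  Ex P (fun w => (\sum_(i < m) (block_sum (Y ^~ w) (p (2 ^ l)) i ^+ 2 - e (p (2 ^ l)))) ^+ 2)
    <= b l * (2 ^ l)%:R ^+ 2.

Lemma bfun_Y i : bfun (Y i). Proof. by split => //; exists B. Qed.

Lemma bfun_block q i : bfun (fun w => block_sum (Y ^~ w) q i).
Proof. by apply: bfun_sum => r _; exact: bfun_Y. Qed.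

Lemma e_ge0 n : 0 <= e n.
Proof. by rewrite -(eE n 0); apply: Ex_ge0 => w; exact: sqr_ge0. Qed.

Lemma block_second_moment_linear : exists C, forall n, e n <= C * n%:R.
Proof.
have [C [_ bC]] := cvg_seq_bounded (cvgP _ e_cvg).
have {}bC := bC (`|C| + 1).
exists (`|C| + 1) => -[|n].
  rewrite -(eE 0 0) mulr0.
  under [X in Ex P X]eq_fun do rewrite /block_sum big_ord0 expr0n.
  by rewrite Ex_cst.
rewrite -ler_pdivrMr ?ltr0n//; apply: le_trans (ler_norm _) _.
apply: bC => //; rewrite (le_lt_trans (ler_norm C))// ltrDl//.
Qed.

(** As [p ^ 2 / n] is bounded, [p(2 ^ l) / 2 ^ l] is at most a multiple of
    [2 ^ (- l / 2)], hence of [(3 / 4) ^ l]. *)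
Lemma block_ratio_summable : summable (fun l => (p (2 ^ l))%:R / (2 ^ l)%:R : R).
Proof.
have [C [_ bC]] := cvg_seq_bounded (cvgP _ p_small).
have {}bC n : (p n)%:R ^+ 2 / n%:R <= `|C| + 1 :> R.
  apply: le_trans (ler_norm _) _.
  by apply: bC => //; rewrite (le_lt_trans (ler_norm C))// ltrDl.
have s34 : summable (fun l => (3 / 4) ^+ l : R) by apply: summable_geometric; lra.
apply: summable_le (summableZ (_ : 0 <= `|C| + 1) s34); last by rewrite addr_ge0.
move=> l; have c0 : 0 <= `|C| by [].
have N0 : 0 < (2 ^ l)%:R :> R by rewrite ltr0n expn_gt0.
have h34 : 0 <= 3 / 4 :> R by lra.
rewrite -ler_sqr ?nnegrE; [|by rewrite divr_ge0|by rewrite mulr_ge0 ?exprn_ge0// addr_ge0].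
have h := bC (2 ^ l)%N.
have -> : ((p (2 ^ l))%:R / (2 ^ l)%:R) ^+ 2 =
   ((p (2 ^ l))%:R ^+ 2 / (2 ^ l)%:R) / (2 ^ l)%:R :> R.
  by field; exact: lt0r_neq0.
rewrite ler_pdivrMr//; apply: (le_trans h).
have h1 : 1 <= ((3 / 4) ^+ l) ^+ 2 * (2 ^ l)%:R :> R.
  rewrite natrX -exprM mulnC exprM -exprMn exprn_ege1//; lra.
rewrite exprMn -mulrA (le_trans _ (ler_wpM2l (sqr_ge0 _) h1))// mulr1.
by rewrite expr2 ler_peMl// ?addr_ge0// lerDr.
Qed.

Lemma grid_dev_ae r : {ae P, forall w, grid_dev (Y ^~ w) e p r l @[l --> \oo] --> (0:R)}.
Proof.
apply: (@ae_cvg0_summable _ _ _ _ _ (fun l => (2 ^ r).+1%:R * b l)).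
- move=> l; apply: bfun_sum => j _; apply: bfunM; last exact: bfun_cst.
  apply: bfunX; apply: bfun_sum => i _; apply: bfunB; last exact: bfun_cst.
  by apply: bfunX; exact: bfun_block.
- by move=> l w; apply: sumr_ge0 => j _; rewrite divr_ge0 ?sqr_ge0.
- move=> l; have bj (j : 'I_(2 ^ r).+1) : bfun (fun w => (\sum_(i < grid r l j %/ p (2 ^ l))
      (block_sum (Y ^~ w) (p (2 ^ l)) i ^+ 2 - e (p (2 ^ l)))) ^+ 2).
    apply: bfunX; apply: bfun_sum => i _; apply: bfunB; last exact: bfun_cst.
    by apply: bfunX; exact: bfun_block.
  rewrite /grid_dev Ex_sum; last by move=> j _; apply: bfunM => //; exact: bfun_cst.
  rewrite [leRHS]mulr_natl -[X in _ <= _ *+ X](card_ord (2 ^ r).+1) -sumr_const.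
  apply: ler_sum => j _; rewrite ExZr// ler_pdivrMr ?exprn_gt0 ?ltr0n ?expn_gt0//.
  apply: dev; apply: leq_trans (leq_trunc_div _ _) _.
  by have /andP[] := grid_ge r l j.
- exact: summableZ.
Qed.

(** The sum of the first [m] block sums is a single block sum of length [m q],
    with a second moment at most linear in [m q]. *)
Lemma grid_sums_ae r : {ae P, forall w, grid_sums (Y ^~ w) p r l @[l --> \oo] --> (0:R)}.
Proof.
have [C eC] := block_second_moment_linear.
have C0 : 0 <= C by have := le_trans (e_ge0 1) (eC 1%N); rewrite mulr1.
apply: (@ae_cvg0_summable _ _ _ _ _
  (fun l => (2 ^ r).+1%:R * ((2 * C) * ((p (2 ^ l))%:R / (2 ^ l)%:R)))).
- move=> l; apply: bfun_sum => j _; apply: bfunM; last exact: bfun_cst.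
  apply: bfunM; last exact: bfun_cst.
  by apply: bfunX; apply: bfun_sum => i _; exact: bfun_block.
- move=> l w; apply: sumr_ge0 => j _; apply: divr_ge0; last exact: sqr_ge0.
  by apply: mulr_ge0 => //; exact: sqr_ge0.
- move=> l; have bj (j : 'I_(2 ^ r).+1) : bfun (fun w => (\sum_(i < grid r l j %/ p (2 ^ l))
      block_sum (Y ^~ w) (p (2 ^ l)) i) ^+ 2).
    by apply: bfunX; apply: bfun_sum => i _; exact: bfun_block.
  rewrite /grid_sums Ex_sum; last first.
    by move=> j _; apply: bfunM; last exact: bfun_cst; apply: bfunM => //; exact: bfun_cst.
  rewrite [leRHS]mulr_natl -[X in _ <= _ *+ X](card_ord (2 ^ r).+1) -sumr_const.
  apply: ler_sum => j _; rewrite ExZr; last by apply: bfunM => //; exact: bfun_cst.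
  rewrite ExZr// ler_pdivrMr ?exprn_gt0 ?ltr0n ?expn_gt0//.
  set m := (_ %/ _)%N; set q := p (2 ^ l).
  have N0 : 0 < (2 ^ l)%:R :> R by rewrite ltr0n expn_gt0.
  have -> : 2 * C * (q%:R / (2 ^ l)%:R) * (2 ^ l)%:R ^+ 2 = C * (2 * (2 ^ l)%:R) * q%:R.
    by field; exact: lt0r_neq0.
  rewrite ler_wpM2r//.
  under [X in Ex P X]eq_fun => w.
    rewrite (_ : \sum_(i < m) _ = block_sum (Y ^~ w) (m * q) 0); last first.
      rewrite /block_sum; under [RHS]eq_bigr do rewrite mul0n add0n.
      by rewrite (sum_blocks (fun i => Y i.+1 w)).
    over.
  rewrite eE (le_trans (eC _))// ler_wpM2l// -natrM ler_nat -expnS.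
  by apply: leq_trans (leq_trunc_div _ _) _; have /andP[] := grid_ge r l j.
- apply: summableZ => //; apply: summableZ; first by rewrite mulr_ge0.
  exact: block_ratio_summable.
Qed.

(** The dependence structure enters only through two second moments: that of a
    block sum, which determines [sigma2], and that of the deviations of sums of
    squared block sums, whose normalized bound [b l] has to be summable. *)
Theorem bootstrap_reduction (X : nat -> T -> R) (mu : R) :
  {ae P, forall w, forall i, (1 <= i)%N -> X i w = Y i w + mu} ->
  {ae P, forall w,
     boot_scaled_variance (X ^~ w) (p n) n @[n --> \oo] --> sigma2} /\
  {ae P, forall w,
     cvg_in_distribution (fun n => boot_cdf (X ^~ w) (p n) n)
       (gaussian sigma2)}.
Proof.
move=> XY; have [C eC] := block_second_moment_linear.
suff H : {ae P, forall w,
     boot_scaled_variance (X ^~ w) (p n) n @[n --> \oo] --> sigma2 /\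
     cvg_in_distribution (fun n => boot_cdf (X ^~ w) (p n) n) (gaussian sigma2)}.
  split; first by apply: filterS H => w [h1 h2]; exact: h1.
  by apply: filterS H => w [h1 h2]; exact: h2.
have h1 := ae_foralln grid_dev_ae; have h2 := ae_foralln grid_sums_ae.
apply: (filterS3 _ _ XY h1 h2) => w xy dw sw.
apply: (@boot_pathwise _ _ (Y ^~ w) mu B) => //.
- by apply: (@block_squares_cvg _ (Y ^~ w) e C) => // n; exact: e_ge0.
- by apply: (@block_sums_cvg _ (Y ^~ w) e C) => // n; exact: e_ge0.
Qed.

End reduction.

(** * A covariance inequality *)

Section discretization.
Context {R : realType}.
Implicit Types (B u : R) (N : nat).

(** The layer-cake formula with [N] levels: a number of [-B, B] is replaced by a
    combination of the indicators of [t <= u], for [N] values of [t]. It turns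
    statements on probabilities of events into statements on expectations. *)
Definition disc N B u : R :=
  \sum_(i < N) (2 * B / N%:R) * ((i.+1)%:R * (2 * B / N%:R) <= u + B)%R%:R - B.

Let layers N (h v : R) : 0 <= h -> 0 <= v ->
  let S := \sum_(i < N) h * ((i.+1)%:R * h <= v)%R%:R in
  S <= v /\ (v <= N.+1%:R * h -> v - S <= h).
Proof.
move=> h0 v0; elim: N => [|N [IH1 IH2]] /=.
  by rewrite big_ord0 subr0 mul1r.
have [Nv|vN] := leP (N.+1%:R * h) v.
  have -> : \sum_(i < N.+1) h * ((i.+1)%:R * h <= v)%R%:R = N.+1%:R * h.
    rewrite (eq_bigr (fun=> h)) => [|i _].
      by rewrite sumr_const card_ord mulr_natl.
    rewrite (_ : (_ <= v) = true) ?mulr1//.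
    by apply: le_trans Nv; rewrite ler_wpM2r// ler_nat.
  split=> // h1; rewrite -natr1 mulrDl mul1r in h1; lra.
rewrite big_ord_recr/= (lt_geF vN) mulr0 addr0; split => // _.
exact/IH2/ltW.
Qed.

Lemma disc_err N B u : (0 < N)%N -> `|u| <= B -> `|disc N B u - u| <= 2 * B / N%:R.
Proof.
move=> N0; rewrite ler_norml => /andP[u1 u2].
have B0 : 0 <= B by lra.
have NR : 0 < N%:R :> R by rewrite ltr0n.
have h0 : 0 <= 2 * B / N%:R by rewrite divr_ge0// mulr_ge0.
have uB : 0 <= u + B by lra.
have [l1 l2] := layers N h0 uB.
have l3 : u + B <= N.+1%:R * (2 * B / N%:R).
  rewrite -natr1 mulrDl mulrC divfK ?gt_eqF// mul1r; lra.
have {}l2 := l2 l3; rewrite /disc ler_norml; apply/andP; split; lra.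
Qed.

Lemma disc_bound N B u : (0 < N)%N -> `|u| <= B -> `|disc N B u| <= B.
Proof.
move=> N0; rewrite ler_norml => /andP[u1 u2].
have B0 : 0 <= B by lra.
have h0 : 0 <= 2 * B / N%:R by rewrite divr_ge0// mulr_ge0.
have uB : 0 <= u + B by lra.
have [l1 _] := layers N h0 uB.
have l4 : 0 <= \sum_(i < N) (2 * B / N%:R) * ((i.+1)%:R * (2 * B / N%:R) <= u + B)%R%:R.
  by apply: sumr_ge0 => i _; rewrite mulr_ge0.
rewrite /disc ler_norml; apply/andP; split; lra.
Qed.

Lemma ler_addP_harmonic (x c C : R) : (forall N, (0 < N)%N -> x <= c + C / N%:R) -> x <= c.
Proof.
move=> H; apply/ler_addgt0Pr => e e0.
pose N := (Num.truncn (`|C| / e)).+1.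
have NR : 0 < N%:R :> R by rewrite ltr0n.
apply: (le_trans (H N isT)); rewrite lerD2l ler_pdivrMr//.
apply: (le_trans (ler_norm C)).
by rewrite mulrC -ler_pdivrMr// ltW// truncnS_gt.
Qed.

End discretization.

Section covariance_inequality.
Context {d : measure_display} {T : measurableType d} {R : realType}
        (P : probability T R).

Definition cov (U V : T -> R) : R := Ex P (fun w => U w * V w) - Ex P U * Ex P V.

Lemma disc_indic N B (U : T -> R) w : disc N B (U w) =
  \sum_(i < N) (2 * B / N%:R) * \1_[set w | (i.+1)%:R * (2 * B / N%:R) - B <= U w] w - B.
Proof.
rewrite /disc; congr (_ - _); apply: eq_bigr => i _; congr *%R.
rewrite indicE -lerBlDr; congr ((nat_of_bool _)%:R).
by apply/idP/idP => [h|/set_mem//]; exact: mem_set.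
Qed.

Lemma measurable_level (U : T -> R) t : measurable_fun setT U ->
  measurable [set w | t <= U w].
Proof.
move=> mU; rewrite (_ : [set w | _] = setT `&` U @^-1` `[t, +oo[%classic).
  by apply: mU.
by rewrite setTI; apply/seteqP; split => w /=; rewrite in_itv/= andbT.
Qed.

Lemma bfun_disc N B (U : T -> R) : measurable_fun setT U ->
  bfun (fun w => disc N B (U w)).
Proof.
move=> mU; under eq_fun do rewrite disc_indic.
apply: bfunB; last exact: bfun_cst.
apply: bfun_sum => i _; apply: bfunM; first exact: bfun_cst.
exact/bfun_indic/measurable_level.
Qed.

Lemma cov_cstr (U V : T -> R) c : bfun U -> bfun V ->
  cov U (fun w => V w - c) = cov U V.
Proof.
move=> bU bV; rewrite /cov.
rewrite ExB//; last exact: bfun_cst.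
rewrite Ex_cst; under [X in Ex P X]eq_fun do rewrite mulrBr.
rewrite ExB ?ExZr//; first by ring.
  exact: bfunM.
by apply: bfunM => //; exact: bfun_cst.
Qed.

Lemma covC U V : cov U V = cov V U.
Proof. by rewrite /cov [Ex P U * _]mulrC; congr (Ex P _ - _); apply/funext => w; rewrite mulrC. Qed.

Lemma cov_sumZl (I : finType) (c : R) (U : I -> T -> R) V : (forall i, bfun (U i)) -> bfun V ->
  cov (fun w => \sum_i c * U i w) V = \sum_i c * cov (U i) V.
Proof.
move=> bU bV; have bcU i : bfun (fun w => c * U i w) by apply: bfunM => //; exact: bfun_cst.
rewrite /cov Ex_sum//; under [X in Ex P X]eq_fun do rewrite mulr_suml.
rewrite Ex_sum; last by move=> i _; exact: bfunM.
rewrite mulr_suml -sumrB; apply: eq_bigr => i _.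
rewrite ExZ//; under [X in Ex P X]eq_fun do rewrite -mulrA.
by rewrite ExZ; [ring|exact: bfunM].
Qed.

(** Discretize [U] and [V]: the covariance becomes a double sum over the levels,
    with [N ^ 2] terms of weight [4 B D / N ^ 2]. *)
Lemma covariance_inequality (U V : T -> R) (B D a : R) :
  measurable_fun setT U -> measurable_fun setT V ->
  (forall w, `|U w| <= B) -> (forall w, `|V w| <= D) ->
  (forall s t, `|fine (P ([set w | s <= U w] `&` [set w | t <= V w])) -
      fine (P [set w | s <= U w]) * fine (P [set w | t <= V w])| <= a) ->
  `|cov U V| <= 4 * B * D * a.
Proof.
move=> mU mV UB VD Pa.
have bU : bfun U by split => //; exists B.
have bV : bfun V by split => //; exists D.
have B0 : 0 <= B := le_trans (normr_ge0 _) (UB point).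
have D0 : 0 <= D := le_trans (normr_ge0 _) (VD point).
apply: (@ler_addP_harmonic _ _ _ (8 * B * D)) => N N0.
have NR : 0 < N%:R :> R by rewrite ltr0n.
pose U' w := disc N B (U w); pose V' w := disc N D (V w).
have bU' : bfun U' by exact: bfun_disc.
have bV' : bfun V' by exact: bfun_disc.
have U'B w : `|U' w| <= B by exact: disc_bound.
have V'D w : `|V' w| <= D by exact: disc_bound.
have UU' w : `|U' w - U w| <= 2 * B / N%:R by exact: disc_err.
have VV' w : `|V' w - V w| <= 2 * D / N%:R by exact: disc_err.
have main : `|cov U' V'| <= 4 * B * D * a.
  pose A (i : 'I_N) : T -> R := \1_[set w | (i.+1)%:R * (2 * B / N%:R) - B <= U w].
  pose A' (i : 'I_N) : T -> R := \1_[set w | (i.+1)%:R * (2 * D / N%:R) - D <= V w].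
  have bA i : bfun (A i) by exact/bfun_indic/measurable_level.
  have bA' i : bfun (A' i) by exact/bfun_indic/measurable_level.
  have bh (c : R) F : (forall i : 'I_N, bfun (F i : T -> R)) ->
      bfun (fun w => \sum_(i < N) c * F i w).
    by move=> bF; apply: bfun_sum => i _; apply: bfunM => //; exact: bfun_cst.
  have -> : U' = (fun w => \sum_(i < N) (2 * B / N%:R) * A i w - B).
    by apply/funext => w; exact: disc_indic.
  have -> : V' = (fun w => \sum_(i < N) (2 * D / N%:R) * A' i w - D).
    by apply/funext => w; exact: disc_indic.
  rewrite cov_cstr; [|apply: bfunB; [exact: bh|exact: bfun_cst]|exact: bh].
  rewrite covC cov_cstr; [|exact: bh|exact: bh].
  rewrite covC cov_sumZl//; last exact: bh.
  apply: (le_trans (ler_norm_sum _ _ _)).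
  have -> : 4 * B * D * a = \sum_(i < N) \sum_(j < N) (2 * B / N%:R) * (2 * D / N%:R) * a.
    rewrite !sumr_const card_ord -[_ *+ N *+ N]mulr_natl -[_ *+ N]mulr_natl.
    by field; exact: lt0r_neq0.
  apply: ler_sum => i _.
  rewrite covC cov_sumZl// mulr_sumr; apply: (le_trans (ler_norm_sum _ _ _)).
  apply: ler_sum => j _.
  have hB : 0 <= 2 * B / N%:R by rewrite divr_ge0// mulr_ge0.
  have hD : 0 <= 2 * D / N%:R by rewrite divr_ge0// mulr_ge0.
  rewrite mulrA normrM ger0_norm ?mulr_ge0// ler_wpM2l ?mulr_ge0//.
  rewrite covC /cov /A /A' !Ex_indic; try exact: measurable_level.
  under [X in Ex P X]eq_fun => w do rewrite -[_ * _]/((\1__ \* \1__) w) -indicI.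
  by rewrite Ex_indic//; apply: measurableI; exact: measurable_level.
have e1 : `|Ex P (fun w => U w * V w) - Ex P (fun w => U' w * V' w)| <= 4 * B * D / N%:R.
  rewrite -ExB; try exact: bfunM.
  apply: Ex_bound; first by apply: bfunB; exact: bfunM.
  move=> w; have -> : U w * V w - U' w * V' w =
    - (U w * (V' w - V w) + (U' w - U w) * V' w) by ring.
  rewrite normrN (le_trans (ler_normD _ _))// !normrM.
  have -> : 4 * B * D / N%:R = B * (2 * D / N%:R) + (2 * B / N%:R) * D by ring.
  by apply: lerD; exact: ler_pM.
have e2 : `|Ex P U * Ex P V - Ex P U' * Ex P V'| <= 4 * B * D / N%:R.
  have -> : Ex P U * Ex P V - Ex P U' * Ex P V' =
    - (Ex P U * Ex P (fun w => V' w - V w) + Ex P (fun w => U' w - U w) * Ex P V').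
    by rewrite (ExB P bV' bV) (ExB P bU' bU); ring.
  rewrite normrN (le_trans (ler_normD _ _))// !normrM.
  have -> : 4 * B * D / N%:R = B * (2 * D / N%:R) + (2 * B / N%:R) * D by ring.
  apply: lerD; apply: ler_pM => //; apply: Ex_bound => //; exact: bfunB.
have -> : cov U V = cov U' V' + ((Ex P (fun w => U w * V w) - Ex P (fun w => U' w * V' w))
   - (Ex P U * Ex P V - Ex P U' * Ex P V')) by rewrite /cov; ring.
apply: (le_trans (ler_normD _ _)); apply: lerD => //.
apply: (le_trans (ler_normB _ _)).
have -> : 8 * B * D / N%:R = 4 * B * D / N%:R + 4 * B * D / N%:R by ring.
exact: lerD.
Qed.

End covariance_inequality.

Section double_sum.
Context {R : realType}.

(** In each row, every distance occurs at most twice. *)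
Lemma double_sum_le (m : nat) (G : nat -> nat -> R) (g : nat -> R) :
  (forall s, 0 <= g s) ->
  (forall i j, (i <= j)%N -> G i j <= g (j - i)%N) ->
  (forall i j, G i j = G j i) ->
  \sum_(i < m) \sum_(j < m) G i j <= m%:R * (2 * \sum_(s < m) g s).
Proof.
move=> g0 Gg Gsym.
have mono a b : (a <= b)%N -> \sum_(0 <= s < a) g s <= \sum_(0 <= s < b) g s.
  by move=> ab; rewrite (big_cat_nat _ ab)//= lerDl sumr_ge0.
rewrite [leRHS]mulr_natl -[X in _ <= _ *+ X](card_ord m) -sumr_const.
apply: ler_sum => -[i im] _ /=.
rewrite -!(big_mkord xpredT) (big_cat_nat (n := i))//=; last exact: ltnW.
rewrite [leRHS]mulr_natl mulr2n; apply: lerD.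
  rewrite big_nat_rev/= add0n; apply: le_trans (mono i.+1 m im).
  rewrite big_nat_recl//= ler_wpDl//.
  rewrite !big_mkord; apply: ler_sum => j _.
  rewrite Gsym; apply: le_trans (Gg _ _ _) _; first by have := ltn_ord j; lia.
  by rewrite (_ : (i - (i - j.+1))%N = j.+1)//; have := ltn_ord j; lia.
rewrite -{1}(add0n i) big_addn.
apply: le_trans (mono (m - i)%N m (leq_subr _ _)).
rewrite !big_mkord; apply: ler_sum => j _.
by apply: le_trans (Gg _ _ (leq_addl _ _)) _; rewrite addnK.
Qed.

End double_sum.

(** * Stationarity *)

Section same_law.
Context {d d' : measure_display} {T : measurableType d} {S : measurableType d'}
        {R : realType} (P : probability T R).

(** Equality of laws is a statement on events; discretizing [h] extends it to
    expectations. *)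
Lemma same_law_Ex (f g : T -> S) (h : S -> R) (B : R) :
  same_law P f g -> measurable_fun setT h -> (forall s, `|h s| <= B) ->
  measurable_fun setT (h \o f) -> measurable_fun setT (h \o g) ->
  Ex P (h \o f) = Ex P (h \o g).
Proof.
move=> fg mh hB mf mg.
have disc_Ex N (k : T -> R) : measurable_fun setT k -> Ex P (fun w => disc N B (k w)) =
    \sum_(i < N) (2 * B / N%:R) * fine (P [set w | (i.+1)%:R * (2 * B / N%:R) - B <= k w]) - B.
  move=> mk; under [X in Ex P X]eq_fun do rewrite disc_indic.
  have bI (i : 'I_N) : bfun (fun w => 2 * B / N%:R *
      \1_[set w | (i.+1)%:R * (2 * B / N%:R) - B <= k w] w).
    by apply: bfunM; [exact: bfun_cst|exact/bfun_indic/measurable_level].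
  rewrite ExB ?Ex_cst; [|by apply: bfun_sum|exact: bfun_cst].
  congr (_ - _); rewrite Ex_sum//; apply: eq_bigr => i _.
  rewrite ExZ; last exact/bfun_indic/measurable_level.
  by rewrite Ex_indic//; exact: measurable_level.
have discE N : Ex P (fun w => disc N B (h (f w))) = Ex P (fun w => disc N B (h (g w))).
  rewrite (disc_Ex _ (h \o f))// (disc_Ex _ (h \o g))//; congr (_ - _).
  apply: eq_bigr => i _; congr (_ * fine _).
  exact: (fg [set s | (i.+1)%:R * (2 * B / N%:R) - B <= h s] (measurable_level _ mh)).
have bk (k : T -> S) : measurable_fun setT (h \o k) -> bfun (h \o k).
  by move=> mk; split => //; exists B => w; exact: hB.
have err (k : T -> S) N : measurable_fun setT (h \o k) -> (0 < N)%N ->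
    `|Ex P (fun w => disc N B (h (k w))) - Ex P (h \o k)| <= 2 * B / N%:R.
  move=> mk N0; have bd : bfun (fun w => disc N B ((h \o k) w)) by exact: bfun_disc.
  rewrite -(ExB P bd (bk _ mk)); apply: Ex_bound; first exact: bfunB bd (bk _ mk).
  by move=> w; exact: disc_err N0 (hB _).
apply/eqP; rewrite -subr_eq0 -normr_le0.
apply: (@ler_addP_harmonic _ _ _ (4 * B)) => N N0; rewrite add0r.
have e1 := err _ N mf N0; have e2 := err _ N mg N0; rewrite -discE in e2.
have -> : 4 * B / N%:R = 2 * B / N%:R + 2 * B / N%:R by ring.
set D := Ex P (fun w => disc N B (h (f w))) in e1 e2.
have -> : Ex P (h \o f) - Ex P (h \o g) = (D - Ex P (h \o g)) - (D - Ex P (h \o f)) by ring.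
by apply: (le_trans (ler_normB _ _)); apply: lerD.
Qed.

End same_law.

Lemma measurable_coord (I : Type) (d : measure_display) (E : measurableType d) (i : I) :
  measurable_fun setT (fun f : path_space I E => f i).
Proof.
move=> _ B mB; apply: sub_sigma_algebra.
by exists i => //; exists B.
Qed.

Section clamp.
Context {R : realType}.
Implicit Types M x : R.

(** Clamping at the almost sure bound changes a variable on a null set only, and
    makes it bounded everywhere. *)
Definition clamp M x : R := Num.max (- M) (Num.min x M).

Lemma clamp_bound M x : 0 <= M -> `|clamp M x| <= M.
Proof.
move=> M0; rewrite /clamp ler_norml le_max lexx/= ge_max ge_min lexx orbT andbT.
by rewrite (le_trans _ M0)// oppr_le0.
Qed.

Lemma clamp_id M x : `|x| <= M -> clamp M x = x.
Proof. by rewrite ler_norml => /andP[h1 h2]; rewrite /clamp min_l// max_r. Qed.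

Lemma measurable_clamp (d : measure_display) (T : measurableType d) M (f : T -> R) :
  measurable_fun setT f -> measurable_fun setT (fun w => clamp M (f w)).
Proof. by move=> mf; apply: measurable_maxr => //; apply: measurable_minr. Qed.

End clamp.

Section stationary_sequences.
Context {d : measure_display} {T : measurableType d} {R : realType}
        (P : probability T R).

(** The event [|X i| <= M] has the same probability for every [i]. *)
Lemma ae_bounded_of_law (X : nat -> T -> R) M : (forall i, measurable_fun setT (X i)) ->
  stationary P X -> {ae P, forall w, `|X 1%N w| <= M} ->
  {ae P, forall w, forall i, (1 <= i)%N -> `|X i w| <= M}.
Proof.
move=> mX sX X1.
have bad i : measurable [set w | ~ (`|X i w| <= M)].
  rewrite (_ : [set w | _] = ~` [set w | - M <= - `|X i w|]).
    apply: measurableC; apply: measurable_level; apply: measurable_funN.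
    exact: measurableT_comp.
  by apply/seteqP; split => w /=; rewrite lerN2.
have : {ae P, forall w, forall i, `|X i.+1 w| <= M}.
  apply: ae_foralln => i; exists [set w | ~ (`|X i.+1 w| <= M)]; split => //.
  have := sX i [set x | ~ (`|x 0%N| <= M)] _.
  have m0 : measurable ([set x | ~ (`|x 0%N| <= M)] : set (path_space nat R)).
    rewrite (_ : [set w | _] = ~` [set x | - M <= - `|x 0%N|]).
      apply: measurableC; apply: measurable_level; apply: measurable_funN.
      by apply: measurableT_comp => //; exact: measurable_coord.
    by apply/seteqP; split => w /=; rewrite lerN2.
  move=> /(_ m0); rewrite /preimage /path_from/= add1n addn0 => ->.
  by case: X1 => A [mA A0 sA]; exact: (subset_measure0 (bad 1%N) mA sA A0).
by apply: filterS => w h [|i].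
Qed.

Variables (X : nat -> T -> R) (M mu : R).
Hypothesis M0 : 0 <= M.
Hypothesis mX : forall i, measurable_fun setT (X i).
Hypothesis sX : stationary P X.
Let Y i w := clamp M (X i w) - mu.

Lemma measurable_truncated i : measurable_fun setT (Y i).
Proof. by apply: measurable_funB => //; exact: measurable_clamp. Qed.

Lemma truncated_bound i w : `|Y i w| <= M + `|mu|.
Proof. by rewrite (le_trans (ler_normB _ _))// lerD2r clamp_bound. Qed.

Lemma stationary_block_moment q i :
  Ex P (fun w => block_sum (Y ^~ w) q i ^+ 2) =
  Ex P (fun w => block_sum (Y ^~ w) q 0 ^+ 2).
Proof.
pose h (x : path_space nat R) := (\sum_(r < q) (clamp M (x r) - mu)) ^+ 2.
have mh : measurable_fun setT h.
  apply: measurable_funX; apply: measurable_sum => r.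
  apply: measurable_funB => //; apply: measurable_clamp; exact: measurable_coord.
have hB x : `|h x| <= ((M + `|mu|) * q%:R) ^+ 2.
  rewrite normrX ler_sqr ?nnegrE ?mulr_ge0 ?addr_ge0//.
  apply: (le_trans (ler_norm_sum _ _ _)).
  rewrite mulr_natr -[X in _ <= _ *+ X](card_ord q) -sumr_const; apply: ler_sum => r _.
  by rewrite (le_trans (ler_normB _ _))// lerD2r clamp_bound.
have hE m : h \o path_from m X = (fun w => (\sum_(r < q) Y (m + r).+1 w) ^+ 2).
  apply/funext => w; congr (_ ^+ 2); apply: eq_bigr => r _.
  by rewrite /path_from /Y addSn addnC.
have mhf m : measurable_fun setT (h \o path_from m X).
  rewrite hE; apply: measurable_funX; apply: measurable_sum => r; exact: measurable_truncated.
by have := same_law_Ex (sX (i * q)%N) mh hB (mhf _) (mhf _); rewrite !hE.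
Qed.

Lemma stationary_product i j :
  Ex P (fun w => Y i.+1 w * Y (i + j).+1 w) = Ex P (fun w => Y 1%N w * Y j.+1 w).
Proof.
pose h (x : path_space nat R) := (clamp M (x 0%N) - mu) * (clamp M (x j) - mu).
have mc k : measurable_fun setT (fun x : path_space nat R => clamp M (x k) - mu).
  by apply: measurable_funB => //; apply: measurable_clamp; exact: measurable_coord.
have mh : measurable_fun setT h by exact: measurable_funM.
have hB x : `|h x| <= (M + `|mu|) * (M + `|mu|).
  rewrite normrM; apply: ler_pM => //;
  by rewrite (le_trans (ler_normB _ _))// lerD2r clamp_bound.
have hE m : h \o path_from m X = (fun w => Y m.+1 w * Y (m + j).+1 w).
  by apply/funext => w; rewrite /= /h /path_from /Y add1n addSn addnC.
have mhf m : measurable_fun setT (h \o path_from m X).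
  by rewrite hE; apply: measurable_funM; exact: measurable_truncated.
by have := same_law_Ex (sX i) mh hB (mhf _) (mhf _); rewrite !hE.
Qed.

Lemma stationary_mean i : Ex P (Y i.+1) = Ex P (Y 1%N).
Proof.
pose h (x : path_space nat R) := clamp M (x 0%N) - mu.
have mh : measurable_fun setT h.
  by apply: measurable_funB => //; apply: measurable_clamp; exact: measurable_coord.
have hB x : `|h x| <= M + `|mu|.
  by rewrite (le_trans (ler_normB _ _))// lerD2r clamp_bound.
have hE m : h \o path_from m X = Y m.+1.
  by apply/funext => w; rewrite /= /h /path_from /Y add1n.
have mhf m : measurable_fun setT (h \o path_from m X).
  by rewrite hE; exact: measurable_truncated.
by have := same_law_Ex (sX i) mh hB (mhf _) (mhf _); rewrite !hE.
Qed.

End stationary_sequences.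

(** * Covariances of almost surely bounded variables *)

Section ae_covariance.
Context {d : measure_display} {T : measurableType d} {R : realType}
        (P : probability T R).

Lemma expectation_ae (f g : T -> R) : measurable_fun setT f -> bfun g ->
  {ae P, forall w, f w = g w} -> ('E_P[f] = (Ex P g)%:E)%E.
Proof.
move=> mf bg fg; rewrite unlock EFin_Ex//; apply: ae_eq_integral => //.
- exact/measurable_EFinP.
- by apply/measurable_EFinP; case: bg.
- by apply: filterS fg => w -> _.
Qed.

Lemma covariance_ae (f f' g g' : T -> R) :
  measurable_fun setT f -> measurable_fun setT f' -> bfun g -> bfun g' ->
  {ae P, forall w, f w = g w} -> {ae P, forall w, f' w = g' w} ->
  covariance P f f' = (cov P g g')%:E.
Proof.
move=> mf mf' bg bg' fg fg'; rewrite unlock (expectation_ae mf bg fg) (expectation_ae mf' bg' fg').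
have bc c (k : T -> R) : bfun k -> bfun (fun w => k w - c).
  by move=> bk; apply: bfunB => //; exact: bfun_cst.
rewrite (@expectation_ae _ (fun w => (g w - Ex P g) * (g' w - Ex P g'))).
- congr EFin; rewrite /cov.
  have -> : (fun w => (g w - Ex P g) * (g' w - Ex P g')) =
    (fun w => (g w * g' w - Ex P g' * g w) - (Ex P g * g' w - Ex P g * Ex P g')).
    by apply/funext => w; ring.
  have bM c (k : T -> R) : bfun k -> bfun (fun w => c * k w).
    by move=> bk; apply: bfunM => //; exact: bfun_cst.
  rewrite ExB; [|by apply: bfunB; [exact: bfunM|exact: bM]|by apply/bc/bM].
  rewrite ExB; [|exact: bfunM|exact: bM].
  rewrite ExB; [|exact: bM|exact: bfun_cst].
  by rewrite Ex_cst !ExZ//; ring.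
- by apply: measurable_funM; apply: measurable_funB.
- by apply: bfunM; exact: bc.
- by apply: filterS2 fg fg' => w h1 h2; rewrite -h1 -h2.
Qed.

End ae_covariance.

(** * Second moments of the deviations of squared block sums *)

Section deviations.
Context {d : measure_display} {T : measurableType d} {R : realType}
        (P : probability T R).

Lemma second_moment_sum (Z : nat -> T -> R) (g : nat -> R) m :
  (forall i, bfun (Z i)) -> (forall s, 0 <= g s) ->
  (forall i j, (i <= j)%N -> Ex P (fun w => Z i w * Z j w) <= g (j - i)%N) ->
  Ex P (fun w => (\sum_(i < m) Z i w) ^+ 2) <= m%:R * (2 * \sum_(s < m) g s).
Proof.
move=> bZ g0 Zg.
have -> : Ex P (fun w => (\sum_(i < m) Z i w) ^+ 2) =
    \sum_(i < m) \sum_(j < m) Ex P (fun w => Z i w * Z j w).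
  under [X in Ex P X]eq_fun do rewrite expr2 mulr_suml.
  rewrite Ex_sum; last first.
    by move=> i _; apply: bfunM => //; exact: bfun_sum.
  apply: eq_bigr => i _; under [X in Ex P X]eq_fun do rewrite mulr_sumr.
  by rewrite Ex_sum// => j _; exact: bfunM.
apply: (@double_sum_le _ m (fun i j => Ex P (fun w => Z i w * Z j w))) => // i j.
by congr (Ex P _); apply/funext => w; rewrite mulrC.
Qed.

Lemma Ex_centered (U V : T -> R) e : bfun U -> bfun V -> Ex P U = e -> Ex P V = e ->
  Ex P (fun w => (U w - e) * (V w - e)) = cov P U V.
Proof.
move=> bU bV UE VE; have bc c (k : T -> R) : bfun k -> bfun (fun w => k w - c).
  by move=> bk; apply: bfunB => //; exact: bfun_cst.
rewrite -(cov_cstr P e bU bV) covC -(cov_cstr P e (bc e _ bV) bU) covC /cov.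
by rewrite (ExB P bU (bfun_cst _)) Ex_cst UE subrr mul0r subr0.
Qed.

End deviations.

Section condensation.
Context {R : realType}.

(** On the dyadic interval number [l] the terms [f n] are at least
    [c l / 2 ^ l], and there are [2 ^ l] of them. *)
Lemma cauchy_condensation (f c : nat -> R) : (forall n, 0 <= f n) ->
  (forall l n, (2 ^ l <= n < 2 ^ l.+1)%N -> c l / (2 ^ l)%:R <= f n) ->
  (\sum_(1 <= n <oo) (f n)%:E < +oo)%E -> summable c.
Proof.
move=> f0 cf fy; exists (fine (\sum_(1 <= n <oo) (f n)%:E)%E) => L.
have step : \sum_(l < L) c l <= \sum_(1 <= n < 2 ^ L) f n.
  elim: L => [|L IH]; first by rewrite big_ord0 expn0 big_geq.
  rewrite big_ord_recr/= (big_cat_nat (n := (2 ^ L)%N)) ?expn_gt0 ?leq_exp2l//=.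
  apply: lerD => //.
  have -> : c L = \sum_(2 ^ L <= n < 2 ^ L.+1) c L / (2 ^ L)%:R.
    by rewrite sumr_const_nat expnS mul2n -addnn addnK -[RHS]mulr_natr divfK//.
  by apply: ler_sum_nat => n nL; exact: cf.
apply: (le_trans step); rewrite -lee_fin fineK; last first.
  by rewrite ge0_fin_numE// nneseries_ge0// => n _ _; rewrite lee_fin.
rewrite -sumEFin; apply: nneseries_lim_ge => n _ _; by rewrite lee_fin.
Qed.

End condensation.

(** * Strongly mixing sequences *)

Section alpha.
Context {d : measure_display} {T : measurableType d} {R : realType}
        (P : probability T R).

Let in01 (A : set T) : measurable A -> 0 <= fine (P A) <= 1.
Proof.
move=> mA; rewrite fine_ge0//= -lee_fin fineK ?fin_num_measure//.
exact: probability_le1.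
Qed.

Lemma sigma_field_measurable (I : Type) (D : set I) (d' : measure_display)
    (E : measurableType d') (Z : I -> T -> E) A :
  (forall i, measurable_fun setT (Z i)) -> sigma_field D Z A -> measurable A.
Proof.
move=> mZ; apply: smallest_sub; first exact: sigma_algebra_measurable.
by move=> _ [i Di [B mB <-]]; exact: mZ.
Qed.

Variable X : nat -> T -> R.
Hypothesis mX : forall i, measurable_fun setT (X i).

Let alpha_set_ub k : has_ubound [set x : R | exists n A B,
    [/\ (1 <= n)%N,
        sigma_field [set i | (1 <= i <= n)%N] X A,
        sigma_field [set i | (n + k <= i)%N] X B &
        x = `|fine (P (A `&` B)) - fine (P A) * fine (P B)| ] ].
Proof.
exists 1 => _ [n [A [B [_ sA sB ->]]]].
have mA : measurable A by exact: sigma_field_measurable sA.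
have mB : measurable B by exact: sigma_field_measurable sB.
have /andP[a0 a1] := in01 (measurableI _ _ mA mB).
have /andP[b0 b1] := in01 mA; have /andP[c0 c1] := in01 mB.
rewrite ler_norml; apply/andP; split; nra.
Qed.

Lemma alpha_mixing_ge n k A B : (1 <= n)%N ->
  sigma_field [set i | (1 <= i <= n)%N] X A ->
  sigma_field [set i | (n + k <= i)%N] X B ->
  `|fine (P (A `&` B)) - fine (P A) * fine (P B)| <= alpha_mixing P X k.
Proof. by move=> n1 sA sB; apply: (ub_le_sup (alpha_set_ub k)); exists n, A, B. Qed.

Lemma alpha_mixing_ge0 k : 0 <= alpha_mixing P X k.
Proof.
have := @alpha_mixing_ge 1 k set0 set0 isT; rewrite setI0 measure0/= mul0r subrr normr0.
by apply; exact: sigma_algebra0.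
Qed.

End alpha.

(** [U] is a function of the [Z i] with [i] in [D]. Changing the sigma-algebra of
    the domain makes the closure properties of measurable functions available. *)
Definition depends_on {I : Type} {d d' : measure_display} {T : measurableType d}
    {E : measurableType d'} {R : realType} (D : set I) (Z : I -> T -> E) (U : T -> R) :=
  @measurable_fun _ _
    (g_sigma_algebraType (\bigcup_(i in D) preimage_set_system setT (Z i) measurable))
    R setT U.

Section depends_on.
Context {I : Type} {d d' : measure_display} {T : measurableType d}
    {E : measurableType d'} {R : realType} (D : set I) (Z : I -> T -> E).

Lemma depends_on_level (U : T -> R) t : depends_on D Z U ->
  sigma_field D Z [set w | t <= U w].
Proof. exact: measurable_level. Qed.

Lemma depends_on_comp i (f : E -> R) : D i -> measurable_fun setT f ->
  depends_on D Z (f \o Z i).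
Proof.
move=> Di mf; apply: measurableT_comp => // _ B mB.
by apply: sub_sigma_algebra; exists i => //; exists B.
Qed.

End depends_on.

Section strongly_mixing.
Context {d : measure_display} {T : measurableType d} {R : realType}
        (P : probability T R).
Variables (X : nat -> T -> R) (M mu : R) (e : nat -> R).
Hypothesis M0 : 0 <= M.
Hypothesis mX : forall i, measurable_fun setT (X i).
Let Y i w := clamp M (X i w) - mu.
Let B := M + `|mu|.
Hypothesis eE : forall q i, Ex P (fun w => block_sum (Y ^~ w) q i ^+ 2) = e q.

Let B0 : 0 <= B. Proof. by rewrite addr_ge0. Qed.

(** Blocks at distance at least 2 are separated by a gap of one block length
    [q], which is where [alpha_mixing] is evaluated; equal and adjacent blocks
    are bounded trivially. *)
Lemma mixing_deviation_bound q m : (0 < q)%N ->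
  Ex P (fun w => (\sum_(i < m) (block_sum (Y ^~ w) q i ^+ 2 - e q)) ^+ 2) <=
  m%:R * (2 * (8 * (B * q%:R) ^+ 4 + m%:R * (4 * (B * q%:R) ^+ 4 * alpha_mixing P X q))).
Proof.
move=> q0; pose U i w := block_sum (Y ^~ w) q i ^+ 2.
have Bq0 : 0 <= B * q%:R by rewrite mulr_ge0.
have UB i w : `|U i w| <= (B * q%:R) ^+ 2.
  rewrite normrX ler_sqr ?nnegrE//.
  apply: (le_trans (ler_norm_sum _ _ _)).
  rewrite mulr_natr -[X in _ <= _ *+ X](card_ord q) -sumr_const.
  by apply: ler_sum => r _; exact: truncated_bound.
have dU (D : set nat) i : (forall r, (r < q)%N -> D (i * q + r).+1) -> depends_on D X (U i).
  move=> HD; apply: measurable_funX; apply: measurable_sum => r.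
  apply: (@depends_on_comp _ _ _ _ _ _ D X _ (fun x : R => clamp M x - mu)).
    by apply: HD; exact: ltn_ord.
  by apply: measurable_funB => //; exact: measurable_clamp.
have mU i : measurable_fun setT (U i).
  apply: measurable_funX; apply: measurable_sum => r.
  by apply: measurable_funB => //; exact: measurable_clamp.
have bU i : bfun (U i) by split => //; exists ((B * q%:R) ^+ 2).
have a0 := alpha_mixing_ge0 P mX q.
pose K := (B * q%:R) ^+ 4.
have K0 : 0 <= K by rewrite exprn_ge0.
pose far := 4 * K * alpha_mixing P X q.
have far0 : 0 <= far by rewrite !mulr_ge0.
pose g s := (s < 2)%N%:R * (4 * K) + far.
have g0 s : 0 <= g s by rewrite addr_ge0// !mulr_ge0.
have eB : `|e q| <= (B * q%:R) ^+ 2 by rewrite -(eE q 0); apply: Ex_bound; [exact: bU|exact: UB].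
have bc i : bfun (fun w => U i w - e q) by apply: bfunB => //; exact: bfun_cst.
have cross i j : (i <= j)%N -> Ex P (fun w => (U i w - e q) * (U j w - e q)) <= g (j - i)%N.
  move=> ij; rewrite /g; have [near|ge2] := ltnP (j - i) 2.
    rewrite mul1r; apply: ler_wpDr => //.
    apply: le_trans (ler_norm _) _; apply: Ex_bound; first exact: bfunM.
    move=> w; rewrite normrM (_ : 4 * K = (2 * (B * q%:R) ^+ 2) * (2 * (B * q%:R) ^+ 2)); last first.
      by rewrite /K; ring.
    by apply: ler_pM => //; rewrite (le_trans (ler_normB _ _))// mulrDl mul1r lerD.
  rewrite mul0r add0r (Ex_centered (bU i) (bU j) (eE q i) (eE q j)).
  apply: le_trans (ler_norm _) _.
  rewrite /far (_ : 4 * K = 4 * (B * q%:R) ^+ 2 * (B * q%:R) ^+ 2); last by rewrite /K; ring.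
  apply: covariance_inequality => // s t.
  apply: (@alpha_mixing_ge _ _ _ P X mX (i.+1 * q)).
  - by rewrite muln_gt0.
  - by apply: depends_on_level; apply: dU => r rq /=; lia.
  - apply: depends_on_level; apply: dU => r rq /=.
    by rewrite -mulSnr; apply: leqW; apply: leq_trans (leq_addr _ _); rewrite leq_mul2r; lia.
apply: (le_trans (second_moment_sum m bc g0 cross)).
rewrite ler_wpM2l// ler_wpM2l//.
rewrite big_split/= sumr_const card_ord -[far *+ m]mulr_natl lerD2r -mulr_suml.
have -> : 8 * K = 2 * (4 * K) by ring.
rewrite ler_wpM2r ?mulr_ge0//.
have : \sum_(s < m) (s < 2)%N%:R <= (minn m 2)%:R :> R.
  elim: (m) => [|m' IH]; first by rewrite big_ord0.
  rewrite big_ord_recr/=; apply: (le_trans (lerD IH (lexx _))).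
  by rewrite -natrD ler_nat; case: (ltnP m' 2) => h; lia.
by move=> /le_trans; apply; rewrite ler_nat geq_minr.
Qed.

Variable p : nat -> nat.
Hypothesis p0 : forall n, (1 <= n)%N -> (0 < p n)%N.
Hypothesis p_dyadic : forall l n, (1 <= l)%N -> (2 ^ l <= n < 2 ^ l.+1)%N ->
  p n = p (2 ^ l)%N.
Hypothesis sum1 : (\sum_(1 <= n <oo)
  ((p n)%:R ^+ 2 * alpha_mixing P X (p n) / n%:R)%R%:E < +oo)%E.
Hypothesis sum2 : (\sum_(1 <= n <oo) ((p n)%:R ^+ 3 / n%:R ^+ 2 : R)%R%:E < +oo)%E.

(** The bound of [mixing_deviation_bound], divided by [4 ^ l], when the blocks
    fill at most [2 ^ (l + 1)] entries. *)
Definition mixing_rate l : R := 32 * B ^+ 4 *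
  ((p (2 ^ l))%:R ^+ 3 / (2 ^ l)%:R +
   (p (2 ^ l))%:R ^+ 2 * alpha_mixing P X (p (2 ^ l))).

Let p_dyadic0 l n : (2 ^ l <= n < 2 ^ l.+1)%N -> p n = p (2 ^ l)%N.
Proof.
case: l => [|l]; last exact: p_dyadic.
by rewrite expn0 expn1 => h; rewrite (_ : n = 1%N)//; lia.
Qed.

Lemma mixing_rate_summable : summable mixing_rate.
Proof.
have a0 k : 0 <= alpha_mixing P X k := alpha_mixing_ge0 P mX k.
apply: summableZ; first by rewrite mulr_ge0// exprn_ge0.
apply: summableD.
- have s : summable (fun l => (p (2 ^ l))%:R ^+ 3 / (2 ^ l)%:R / 4 : R).
    apply: cauchy_condensation sum2 => [n|l n nl].
      by rewrite divr_ge0// exprn_ge0.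
    rewrite (p_dyadic0 nl).
    have /andP[n1 n2] := nl.
    have n0 : 0 < n%:R :> R by rewrite ltr0n; apply: leq_trans n1; rewrite expn_gt0.
    have N0 : 0 < (2 ^ l)%:R :> R by rewrite ltr0n expn_gt0.
    have -> : (p (2 ^ l))%:R ^+ 3 / (2 ^ l)%:R / 4 / (2 ^ l)%:R =
        (p (2 ^ l))%:R ^+ 3 * ((2 * (2 ^ l)%:R) ^+ 2)^-1 :> R.
      by field; exact: lt0r_neq0.
    rewrite ler_wpM2l ?exprn_ge0// lef_pV2 ?posrE ?exprn_gt0 ?mulr_gt0//.
    rewrite ler_sqr ?nnegrE ?mulr_ge0//.
    by rewrite -natrM ler_nat -expnS ltnW.
  apply: summable_le (summableZ (_ : 0 <= 4) s) => // l.
  by rewrite [leRHS]mulrC divfK.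
- have s : summable (fun l => (p (2 ^ l))%:R ^+ 2 * alpha_mixing P X (p (2 ^ l)) / 2 : R).
    apply: cauchy_condensation sum1 => [n|l n nl].
      by rewrite divr_ge0// mulr_ge0// exprn_ge0.
    rewrite (p_dyadic0 nl).
    have /andP[n1 n2] := nl.
    have n0 : 0 < n%:R :> R by rewrite ltr0n; apply: leq_trans n1; rewrite expn_gt0.
    have N0 : 0 < (2 ^ l)%:R :> R by rewrite ltr0n expn_gt0.
    rewrite -mulrA -invfM ler_wpM2l ?mulr_ge0 ?exprn_ge0// lef_pV2 ?posrE ?mulr_gt0//.
    by rewrite -natrM ler_nat -expnS ltnW.
  apply: summable_le (summableZ (_ : 0 <= 2) s) => // l.
  by rewrite [leRHS]mulrC divfK.
Qed.

Lemma mixing_rate_bound l m : (m * p (2 ^ l) <= 2 ^ l.+1)%N ->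
  Ex P (fun w => (\sum_(i < m) (block_sum (Y ^~ w) (p (2 ^ l)) i ^+ 2 - e (p (2 ^ l)))) ^+ 2)
    <= mixing_rate l * (2 ^ l)%:R ^+ 2.
Proof.
set q := p (2 ^ l) => mq.
have q0 : (0 < q)%N by rewrite p0// expn_gt0.
have N0 : 0 < (2 ^ l)%:R :> R by rewrite ltr0n expn_gt0.
have mqR : m%:R * q%:R <= 2 * (2 ^ l)%:R :> R by rewrite -!natrM ler_nat -expnS.
apply: (le_trans (mixing_deviation_bound m q0)).
have a0 := alpha_mixing_ge0 P mX q.
rewrite /mixing_rate -/q; set a := alpha_mixing P X q in a0 *.
have -> : m%:R * (2 * (8 * (B * q%:R) ^+ 4 + m%:R * (4 * (B * q%:R) ^+ 4 * a))) =
  16 * B ^+ 4 * q%:R ^+ 3 * (m%:R * q%:R) + 8 * B ^+ 4 * q%:R ^+ 2 * a * (m%:R * q%:R) ^+ 2.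
  by ring.
have -> : 32 * B ^+ 4 * (q%:R ^+ 3 / (2 ^ l)%:R + q%:R ^+ 2 * a) * (2 ^ l)%:R ^+ 2 =
  16 * B ^+ 4 * q%:R ^+ 3 * (2 * (2 ^ l)%:R) + 8 * B ^+ 4 * q%:R ^+ 2 * a * (2 * (2 ^ l)%:R) ^+ 2.
  by field; exact: lt0r_neq0.
apply: lerD; apply: ler_wpM2l => //; rewrite ?mulr_ge0 ?exprn_ge0//.
by rewrite ler_sqr ?nnegrE ?mulr_ge0// ltW.
Qed.

End strongly_mixing.

(** * The bootstrap of strongly mixing sequences *)

Section truncation.
Context {d : measure_display} {T : measurableType d} {R : realType}
        (P : probability T R).
Variables (X : nat -> T -> R) (M mu : R).
Hypothesis M0 : 0 <= M.
Hypothesis mX : forall i, measurable_fun setT (X i).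
Hypothesis sX : stationary P X.
Hypothesis XM : {ae P, forall w, `|X 1%N w| <= M}.
Hypothesis EX : ('E_P[X 1%N] = mu%:E)%E.
Let Y i w := clamp M (X i w) - mu.

Lemma truncated_ae : {ae P, forall w, forall i, (1 <= i)%N -> X i w = Y i w + mu}.
Proof.
apply: filterS (ae_bounded_of_law mX sX XM) => w h i i1.
by rewrite /Y subrK clamp_id// h.
Qed.

Lemma bfun_truncated i : bfun (Y i).
Proof.
split; first exact: measurable_truncated.
by exists (M + `|mu|) => w; exact: truncated_bound.
Qed.

Lemma truncated_mean0 i : (1 <= i)%N -> Ex P (Y i) = 0.
Proof.
case: i => // i _; rewrite (stationary_mean mu M0 mX sX i).
have b1 : bfun (fun w => Y 1%N w + mu) by apply: bfunD; [exact: bfun_truncated|exact: bfun_cst].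
have h : {ae P, forall w, X 1%N w = Y 1%N w + mu} by apply: filterS truncated_ae => w; exact.
have := expectation_ae (mX 1%N) b1 h; rewrite EX => -[].
rewrite (ExD P (bfun_truncated 1) (bfun_cst mu)) Ex_cst => e.
by apply: (addIr mu); rewrite -e add0r.
Qed.

End truncation.

Section mixing_case.
Context {d : measure_display} {T : measurableType d} {R : realType}
        (P : probability T R).

(** The variance of [sqrt n * (mean X n - mu)] is the second moment of a block
    sum of length [n] divided by [n], so that its limit is the one that
    [bootstrap_reduction] asks for. *)
Theorem bootstrap_mixing (X : nat -> T -> R) (p : nat -> nat) (M mu sigma2 : R)
    (mX : forall i, measurable_fun setT (X i))
    (sX : stationary P X)
    (M0 : 0 <= M)
    (XM : {ae P, forall w, `|X 1%N w| <= M})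
    (EX : ('E_P[X 1%N] = mu%:E)%E)
    (p0 : forall n, (1 <= n)%N -> (0 < p n)%N)
    (p_cvg : p n @[n --> \oo] --> \oo)
    (p_dyadic : forall l n, (1 <= l)%N -> (2 ^ l <= n < 2 ^ l.+1)%N ->
       p n = p (2 ^ l)%N)
    (p_small : ((p n)%:R ^+ 2 / n%:R : R) @[n --> \oo] --> (0 : R)) :
  mixing_condition P X p mu sigma2 ->
  {ae P, forall w,
     boot_scaled_variance (X ^~ w) (p n) n @[n --> \oo] --> sigma2} /\
  {ae P, forall w,
     cvg_in_distribution (fun n => boot_cdf (X ^~ w) (p n) n)
       (gaussian sigma2)}.
Proof.
move=> [_ _ var_cvg sum1 sum2].
pose Y i w := clamp M (X i w) - mu.
pose e q := Ex P (fun w => block_sum (Y ^~ w) q 0 ^+ 2).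
have eE q i : Ex P (fun w => block_sum (Y ^~ w) q i ^+ 2) = e q.
  exact: stationary_block_moment.
have bY i : bfun (Y i) by exact: bfun_truncated.
have bS n : bfun (fun w => block_sum (Y ^~ w) n 0) by apply: bfun_sum.
have XY := truncated_ae mu mX sX XM.
have e_cvg : e n / n%:R @[n --> \oo] --> sigma2.
  have e_eq n : (0 < n)%N ->
      'V_P[(fun w => Num.sqrt n%:R * (mean (X ^~ w) n - mu))%R] = (e n / n%:R)%:E.
    move=> n0; have nR : 0 < n%:R :> R by rewrite ltr0n.
    pose g w := (Num.sqrt n%:R / n%:R) * block_sum (Y ^~ w) n 0.
    have bg : bfun g by apply: bfunM => //; exact: bfun_cst.
    have mf : measurable_fun setT (fun w => Num.sqrt n%:R * (mean (X ^~ w) n - mu)).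
      apply: measurable_funM => //; apply: measurable_funB => //.
      by apply: measurable_funM => //; apply: measurable_sum => i; exact: mX.
    have fg : {ae P, forall w, Num.sqrt n%:R * (mean (X ^~ w) n - mu) = g w}.
      apply: filterS XY => w xy; rewrite /g -mulrA; congr (_ * _).
      rewrite /mean /block_sum big_add1/= big_mkord.
      rewrite (eq_bigr (fun i : 'I_n => Y i.+1 w + mu)); last by move=> i _; exact: xy.
      rewrite big_split/= sumr_const card_ord -[mu *+ n]mulr_natl mulrDr mulrA mulVf ?gt_eqF//.
      by rewrite mul1r addrK.
    rewrite /variance (covariance_ae mf mf bg bg fg fg); congr EFin.
    have g0 : Ex P g = 0.
      rewrite ExZ// Ex_sum// big1 ?mulr0// => i _.
      exact: (@truncated_mean0 _ _ _ P X M mu M0 mX sX XM EX).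
    rewrite /cov g0 mul0r subr0 /e.
    have -> : (fun w => g w * g w) = (fun w => n%:R^-1 * block_sum (Y ^~ w) n 0 ^+ 2).
      apply/funext => w; rewrite /g.
      transitivity ((Num.sqrt n%:R / n%:R) ^+ 2 * block_sum (Y ^~ w) n 0 ^+ 2); first by ring.
      by congr (_ * _); rewrite expr_div_n sqr_sqrtr ?ltW//; field; exact: lt0r_neq0.
    by rewrite ExZ 1?mulrC//; exact: bfunX.
  move/fine_cvgP : var_cvg => [_ var_cvg].
  apply: cvg_trans var_cvg; apply: near_eq_cvg; near=> n.
  by rewrite /= e_eq//; near: n; exact: nbhs_infty_gt.
apply: (@bootstrap_reduction _ _ _ P Y (M + `|mu|) e
  (mixing_rate P X M mu p) sigma2 p _ _ p0 p_cvg p_dyadic p_small eE e_cvg _ _ X mu XY).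
- by move=> i; case: (bY i).
- by move=> i w; exact: truncated_bound.
- exact: mixing_rate_summable.
- by move=> l m; exact: mixing_rate_bound.
Unshelve. all: by end_near. Qed.

End mixing_case.

(** * Conditional expectations of events *)

Section condexp.
Context {d : measure_display} {T : measurableType d} {R : realType}
        (P : probability T R) (G : set (set T)) (B : set T).
Hypothesis Gm : G `<=` measurable.
Hypothesis mB : measurable B.

Let TG := g_sigma_algebraType G.

Let sub : <<s G >> `<=` measurable.
Proof. by apply: smallest_sub => //; exact: sigma_algebra_measurable. Qed.

Let mu' (A : set TG) : \bar R := P A.
Let nu' (A : set TG) : \bar R := P (A `&` B).

Let mu'0 : mu' set0 = 0%E. Proof. exact: measure0. Qed.
Let mu'_ge0 A : (0 <= mu' A)%E. Proof. exact: measure_ge0. Qed.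
Let mu'_additive : semi_sigma_additive mu'.
Proof.
move=> F mF tF mUF; apply: (@measure_semi_sigma_additive _ _ _ P) => [i||].
- exact: sub (mF i).
- exact: tF.
- exact: sub mUF.
Qed.
HB.instance Definition _ := isMeasure.Build _ TG R mu' mu'0 mu'_ge0 mu'_additive.
Let mu'T : mu' setT = 1%E. Proof. exact: probability_setT. Qed.
HB.instance Definition _ := @Measure_isProbability.Build _ TG R mu' mu'T.

Let nu'0 : nu' set0 = 0%E. Proof. by rewrite /nu' set0I measure0. Qed.
Let nu'_ge0 A : (0 <= nu' A)%E. Proof. exact: measure_ge0. Qed.
Let nu'_additive : semi_sigma_additive nu'.
Proof.
move=> F mF tF mUF; rewrite /nu'.
apply: (@measure_semi_sigma_additive _ _ _ (mrestr P mB)) => [i||].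
- exact: sub (mF i).
- exact: tF.
- exact: sub mUF.
Qed.
HB.instance Definition _ := isMeasure.Build _ TG R nu' nu'0 nu'_ge0 nu'_additive.
Let nu'_fin : fin_num_fun nu'.
Proof.
move=> A mA; rewrite /nu'; apply: (@fin_num_measure _ _ _ P).
by apply: measurableI => //; exact: sub mA.
Qed.
HB.instance Definition _ := @Measure_isFinite.Build _ TG R nu' nu'_fin.

Let nu'_mu' : nu' `<< mu'.
Proof.
apply/null_content_dominatesP => A mA muA0.
have mA' : measurable (A : set T) := sub mA.
exact: (subset_measure0 (measurableI _ _ mA' mB) mA' (@subIsetl _ _ _) muA0).
Qed.

(** The density of [A |-> P (A & B)] with respect to [P], both restricted to the
    sigma-algebra generated by [G], which exists by the Radon-Nikodym theorem. *)
Lemma condexp_indic_exists : exists c : T -> R, is_condexp P <<s G >> \1_B c.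
Proof.
have [f [f0 ffin intf fE]] := radon_nikodym_sigma_finite nu'_mu'.
have mf : measurable_fun setT f by case/integrableP: intf.
pose c (w : TG) : R := fine (f w).
have cE w : (c w)%:E = f w by rewrite fineK.
have mc : measurable_fun setT c.
  by apply/measurable_EFinP; apply: (eq_measurable_fun f) => // w _; rewrite /= cE.
have mfT : measurable_fun (setT : set T) (f : T -> \bar R).
  by move=> _ A mA; apply: sub; exact: mf.
pose phi : T -> TG := idfun.
have mphi : measurable_fun setT phi by move=> _ A mA; rewrite setTI; exact: sub.
have transfer (A : set TG) : measurable A ->
    (\int[P]_(w in (A : set T)) f w = \int[mu']_(w in A) f w)%E.
  move=> mA; have mfA : measurable_fun A f by exact: measurable_funTS.
  have fA0 : {in A, forall y, (0 <= f y)%E} by move=> y _; exact: f0.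
  rewrite -[LHS](@ge0_integral_pushforward _ _ T TG R phi mphi P A f mA mfA fA0).
  by apply: eq_measure_integral => S mS _.
exists c; split.
- by move=> S mS; have := mc measurableT S mS; rewrite setTI.
- apply/integrableP; split.
    by apply: (eq_measurable_fun (f : T -> \bar R)) => // w _; exact: esym (cE w).
  rewrite (eq_integral (f : T -> \bar R)); last first.
    by move=> w _; rewrite -[RHS](gee0_abs (f0 w)); congr (`| _ |)%E; exact: cE.
  rewrite (transfer setT measurableT) -fE ?inE//.
  by rewrite ltey_eq nu'_fin.
- move=> A GA; rewrite (eq_integral (f : T -> \bar R)); last by move=> w _; rewrite cE.
  rewrite (transfer A GA) -fE//.
  rewrite (eq_integral (EFin \o \1_B))//.
  have mA' : measurable (A : set T) := sub GA.
  rewrite (integral_indic P mA' mB); exact: (congr1 P (setIC A B)).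
Qed.

End condexp.

(** * Absolute regularity bounds the dependence of past and future *)

Section absolute_regularity.
Context {d d' : measure_display} {T : measurableType d} {E : measurableType d'}
        {R : realType} (P : probability T R).
Variables (Z : int -> T -> E) (beta : nat -> R).
Hypothesis mZ : forall i, measurable_fun setT (Z i).
Hypothesis betaP : absolute_regularity_coefficients P Z beta.

(** [g] dominates [h] almost everywhere; it is replaced by a function that
    dominates [h] everywhere and is nonnegative. *)
Lemma integral_ess_supremum_ge (H : set (T -> R)) (g h : T -> R) :
  is_ess_supremum P H g -> H h -> measurable_fun setT h -> (forall w, 0 <= h w) ->
  (\int[P]_w (h w)%:E <= 'E_P[g])%E.
Proof.
move=> [mg Hg _] /Hg hg mh h0; rewrite unlock.
pose k w := Num.max (h w) (Num.max (g w) 0).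
have mk : measurable_fun setT k.
  by apply: measurable_maxr => //; apply: measurable_maxr.
have -> : (\int[P]_w (g w)%:E = \int[P]_w (k w)%:E)%E.
  apply: ae_eq_integral => //; [exact/measurable_EFinP|exact/measurable_EFinP|].
  apply: filterS hg => w hgw _; congr EFin; rewrite /k.
  by rewrite (max_l (le_trans (h0 w) hgw)) max_r.
apply: ge0_le_integral => //; try exact/measurable_EFinP.
- by move=> w _; rewrite lee_fin.
- by move=> w _; rewrite lee_fin /k le_max lexx.
Qed.

(** The left side is the integral over [A] of [P(B | past) - P B], which is at
    most the expectation of the supremum over all [B]. *)
Lemma absolute_regularity_ge n k A B :
  sigma_field [set i | i <= n] Z A ->
  sigma_field [set i | n + k%:Z <= i] Z B ->
  `|fine (P (A `&` B)) - fine (P A) * fine (P B)| <= beta k.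
Proof.
move=> sA sB.
have mA : measurable A by exact: sigma_field_measurable sA.
have mB : measurable B by exact: sigma_field_measurable sB.
have Gm : \bigcup_(i in [set i | i <= n]) preimage_set_system setT (Z i) measurable `<=` measurable.
  by move=> _ [i Di [S mS <-]]; exact: mZ.
have [c cP] := condexp_indic_exists P Gm mB.
have [c1 ic cE] := cP.
have mc : measurable_fun setT c.
  by case/integrableP: ic => /measurable_EFinP.
pose b := fine (P B).
pose h w := `|c w - b|.
have mh : measurable_fun setT h.
  by apply: measurableT_comp => //; apply: measurable_funB.
have [S [Sess betaE]] := betaP k.
have hS : conditional_deviations P Z n k h by exists B, c.
have h_le : (\int[P]_w (h w)%:E <= (beta k)%:E)%E.
  apply: le_trans (integral_ess_supremum_ge (Sess n) hS mh _) _.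
    by move=> w; exact: normr_ge0.
  by rewrite betaE; apply: ereal_sup_ubound; exists n.
have icA : P.-integrable A (EFin \o c) by exact: integrableS ic.
have ibA : P.-integrable A (EFin \o (fun=> b)).
  by apply: (integrableS measurableT) => //; exact: bfun_integrable (bfun_cst b).
have diff : (\int[P]_(w in A) (c w - b)%:E =
    (fine (P (A `&` B)) - fine (P A) * fine (P B))%:E)%E.
  rewrite integralB_EFin// (cE A sA) integral_cst// integral_indic//.
  rewrite EFinB EFinM !fineK ?fin_num_measure//; last exact: measurableI.
  by rewrite setIC [in RHS]muleC.
rewrite -lee_fin -[leLHS]/(`|(_ - _)%:E|)%E -diff.
apply: le_trans (le_abse_integral P mA _) _.
  by apply/measurable_EFinP; apply: measurable_funTS; apply: measurable_funB.
apply: le_trans _ h_le.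
by apply: ge0_subset_integral => //; apply/measurable_EFinP.
Qed.

End absolute_regularity.

(** * Approximation of near epoch dependent variables *)

Section windows.
Context {d d' : measure_display} {T : measurableType d} {E : measurableType d'}.
Variable Z : int -> T -> E.

Let coord (i : int) (f : path_space int E) : E := f i.

(** An event of the shifted process is the pullback of an event of the path
    space, which does not depend on the shift: the same function of the path
    can be evaluated along the whole process. *)
Lemma sigma_field_path (D : set int) m :
  sigma_field D (fun i w => Z (i + m%:Z) w) =
  preimage_set_system setT (path_fromZ m Z) (sigma_field D coord).
Proof.
rewrite /sigma_field -g_sigma_preimageE; congr (<<s _ >>).
apply/seteqP; split => [A [i Di [B mB <-]]|A [C [i Di [B mB <-]] <-]].
  exists (setT `&` coord i @^-1` B); first by exists i => //; exists B.
  by rewrite !setTI.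
by exists i => //; exists B; rewrite // !setTI.
Qed.

Lemma sigma_field_shift (D : set int) m :
  sigma_field D (fun i w => Z (i + m%:Z) w) `<=`
  sigma_field [set i | D (i - m%:Z)] Z.
Proof.
apply: smallest_sub; first exact: smallest_sigma_algebra.
move=> _ [i Di [B mB <-]]; apply: sub_sigma_algebra.
by exists (i + m%:Z); rewrite /= ?addrK//; exists B.
Qed.

Lemma sigma_field_coord (D : set int) B : sigma_field D coord B ->
  measurable (B : set (path_space int E)).
Proof.
apply: smallest_sub; first exact: smallest_sigma_algebra.
by move=> _ [i Di [S mS <-]]; apply: sub_sigma_algebra; exists i => //; exists S.
Qed.

End windows.

Section approximation.
Context {d d' : measure_display} {T : measurableType d} {E : measurableType d'}
        {R : realType} (P : probability T R).
Variables (X : nat -> T -> R) (Z : int -> T -> E) (a : nat -> R) (M mu : R).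
Hypothesis mX : forall i, measurable_fun setT (X i).
Hypothesis mZ : forall i, measurable_fun setT (Z i).
Hypothesis M0 : 0 <= M.
Hypothesis XZ : near_epoch_dependent P X Z a.
Let Y i w := clamp M (X i w) - mu.

Lemma clamp_lipschitz (x y : R) : `|clamp M x - clamp M y| <= `|x - y|.
Proof.
have := ler_norm (x - y); have := ler_norm (- (x - y)); rewrite normrN => h1 h2.
rewrite ler_norml /clamp.
have [x1|x1] := leP x M; have [y1|y1] := leP y M; rewrite /=;
  [have [x2|x2] := leP (- M) x; have [y2|y2] := leP (- M) y
  |have [x2|x2] := leP (- M) x; have [y2|y2] := leP (- M) M
  |have [x2|x2] := leP (- M) M; have [y2|y2] := leP (- M) y
  |have [x2|x2] := leP (- M) M]; have := M0; lra.
Qed.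

(** The conditional expectation of [X 1] given the window [-l, l] of [Z], clamped
    and discretized with [N] levels, is a simple function of the path of [Z].
    Evaluated along the shifted paths, it approximates every [X m.+1] equally
    well, by joint stationarity. The discretization, at the price of
    [2 M / N], makes the factorization through the path space explicit. *)
Lemma window_approximation l N : (0 < N)%N -> exists V : nat -> T -> R, forall m,
  [/\ depends_on [set i | - l%:Z <= i - m%:Z <= l%:Z] Z (V m),
      measurable_fun setT (V m),
      forall w, `|V m w| <= M + `|mu| &
      Ex P (fun w => `|Y m.+1 w - V m w|) <= a l + 2 * M / N%:R].
Proof.
move=> N0; have [jst /(_ l)[Yl [cY iY _] EY] _] := XZ.
pose D := [set i : int | - l%:Z <= i <= l%:Z].
pose coord (i : int) (f : path_space int E) := f i.
have mYl : measurable_fun setT Yl by case/integrableP: iY => /measurable_EFinP.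
pose t j : R := (j.+1)%:R * (2 * M / N%:R) - M.
have lev j : exists B : set (path_space int E), sigma_field D coord B /\
    path_fromZ 0 Z @^-1` B = [set w | t j <= clamp M (Yl w)].
  have : sigma_field D Z [set w | t j <= clamp M (Yl w)].
    have mS : measurable [set x : R | t j <= clamp M x].
      by apply: measurable_level; exact: measurable_clamp.
    exact: (cY _ mS).
  have Z0 : (fun i w => Z (i + 0%:Z) w) = Z by apply/funext => i; rewrite addr0.
  rewrite -[in X in X -> _]Z0 sigma_field_path => -[B sB <-]; exists B; split => //.
  by rewrite setTI.
have [Bs HB] := choice lev.
have mBs j : measurable (Bs j) by have [/sigma_field_coord] := HB j.
pose h (z : path_space int E) : R := \sum_(j < N) (2 * M / N%:R) * \1_(Bs j) z - M.
have mh : measurable_fun setT h.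
  apply: measurable_funB => //; apply: measurable_sum => j.
  by apply: measurable_funM => //; exact: measurable_indic.
have NR : 0 < N%:R :> R by rewrite ltr0n.
have c0 : 0 <= 2 * M / N%:R by rewrite divr_ge0// mulr_ge0.
have hM z : `|h z| <= M.
  have s0 : 0 <= \sum_(j < N) (2 * M / N%:R) * \1_(Bs j) z :> R.
    by apply: sumr_ge0 => j _; rewrite mulr_ge0.
  have s1 : \sum_(j < N) (2 * M / N%:R) * \1_(Bs j) z <= 2 * M :> R.
    apply: (@le_trans _ _ (\sum_(j < N) (2 * M / N%:R))); last first.
      by rewrite sumr_const card_ord -[leLHS]mulr_natr divfK// gt_eqF.
    by apply: ler_sum => j _; rewrite ler_piMr// indicE; case: (_ \in _).
  by rewrite /h ler_norml; apply/andP; split; lra.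
have h0 w : h (path_fromZ 0 Z w) = disc N M (clamp M (Yl w)).
  rewrite (disc_indic N M (fun w => clamp M (Yl w))); congr (_ - _).
  apply: eq_bigr => j _; congr (_ * _); have [_ <-] := HB j.
  by rewrite !indicE.
pose V m w := h (path_fromZ m Z w) - mu.
have mV m : depends_on [set i | - l%:Z <= i - m%:Z <= l%:Z] Z (V m).
  apply: measurable_funB => //; apply: measurable_funB => //; apply: measurable_sum => j.
  apply: measurable_funM => //.
  have -> : (fun w => \1_(Bs j) (path_fromZ m Z w) : R) = \1_(path_fromZ m Z @^-1` Bs j).
    by apply/funext => w; rewrite !indicE.
  apply: measurable_indic; apply: (@sigma_field_shift _ _ _ _ Z D m).
  rewrite sigma_field_path; exists (Bs j); first by have [] := HB j.
  by rewrite setTI.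
have mVT m : measurable_fun setT (V m).
  move=> _ S mS; rewrite setTI; apply: (@sigma_field_measurable _ _ _ _ _ _ Z) => //.
    by have := mV m measurableT S mS; rewrite setTI; exact.
pose H (q : path_space nat R * path_space int E) := `|clamp M (q.1 0%N) - h q.2|.
have mH : measurable_fun setT H.
  apply: measurableT_comp => //; apply: measurable_funB.
    apply: measurable_clamp.
    exact: (measurableT_comp (measurable_coord (I := nat) (E := R) 0%N) measurable_fst).
  exact: (measurableT_comp mh measurable_snd).
have HM q : `|H q| <= 2 * M.
  rewrite /H normr_id (le_trans (ler_normB _ _))// mulrDl mul1r lerD//.
  exact: clamp_bound.
have HE m : (H \o (fun w => (path_from m X w, path_fromZ m Z w))) =
    (fun w => `|Y m.+1 w - V m w|).
  apply/funext => w; rewrite /H /= /Y /V /path_from add1n.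
  by congr (`| _ |); ring.
have mHm m : measurable_fun setT (H \o (fun w => (path_from m X w, path_fromZ m Z w))).
  rewrite HE; apply: measurableT_comp => //; apply: measurable_funB => //.
  by apply: measurable_funB => //; exact: measurable_clamp.
exists V => m; split => //.
  by move=> w; rewrite (le_trans (ler_normB _ _))// lerD2r.
have := same_law_Ex (jst m) mH HM (mHm m) (mHm 0%N); rewrite !HE => ->.
have b1 : bfun (fun w => `|clamp M (X 1%N w) - clamp M (Yl w)|).
  split; first by apply: measurableT_comp => //; apply: measurable_funB; exact: measurable_clamp.
  exists (2 * M) => w; rewrite normr_id (le_trans (ler_normB _ _))// mulrDl mul1r.
  by apply: lerD; exact: clamp_bound.
apply: (@le_trans _ _ (Ex P (fun w => `|clamp M (X 1%N w) - clamp M (Yl w)| + 2 * M / N%:R))).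
  apply: Ex_le.
  - by rewrite -HE; split => //; exists (2 * M) => w; exact: HM.
  - by apply: bfunD => //; exact: bfun_cst.
  - move=> w; have e := disc_err N0 (clamp_bound (Yl w) M0).
    have -> : Y 1%N w - V 0%N w = (clamp M (X 1%N w) - clamp M (Yl w)) -
       (disc N M (clamp M (Yl w)) - clamp M (Yl w)) by rewrite /Y /V h0; ring.
    by rewrite (le_trans (ler_normB _ _))// lerD2l.
rewrite (ExD P b1 (bfun_cst _)) Ex_cst lerD2r -lee_fin EFin_Ex//.
apply: le_trans EY; rewrite unlock; apply: ge0_le_integral => //.
- apply/measurable_EFinP; case: b1 => //.
- apply/measurable_EFinP; apply: measurableT_comp => //; exact: measurable_funB.
- by move=> w _; rewrite lee_fin clamp_lipschitz.
Qed.

End approximation.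

(** * Decoupling of products *)

Lemma depends_on_sub (I : Type) (d d' : measure_display) (T : measurableType d)
    (E : measurableType d') (R : realType) (D D' : set I) (Z : I -> T -> E) (U : T -> R) :
  D `<=` D' -> depends_on D Z U -> depends_on D' Z U.
Proof.
move=> DD' mU _ S mS; have := mU measurableT S mS.
apply: smallest_sub; first exact: smallest_sigma_algebra.
by move=> _ [i Di [A mA <-]]; apply: sub_sigma_algebra; exists i; [exact: DD'|exists A].
Qed.

Section decoupling.
Context {d d' : measure_display} {T : measurableType d} {E : measurableType d'}
        {R : realType} (P : probability T R).
Variables (Y : nat -> T -> R) (Z : int -> T -> E) (a beta : nat -> R) (B K : R).
Hypothesis B1 : 1 <= B.
Hypothesis mY : forall i, measurable_fun setT (Y i).
Hypothesis YB : forall i w, `|Y i w| <= B.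
Hypothesis approx : forall l N, (0 < N)%N -> exists V : nat -> T -> R, forall m,
  [/\ depends_on [set i | - l%:Z <= i - m%:Z <= l%:Z] Z (V m),
      measurable_fun setT (V m),
      forall w, `|V m w| <= B &
      Ex P (fun w => `|Y m.+1 w - V m w|) <= a l + K / N%:R].
Hypothesis areg : forall n k A C,
  sigma_field [set i | i <= n] Z A -> sigma_field [set i | n + k%:Z <= i] Z C ->
  `|fine (P (A `&` C)) - fine (P A) * fine (P C)| <= beta k.

Let B0 : 0 <= B. Proof. exact: le_trans B1. Qed.

Lemma beta_ge0 k : 0 <= beta k.
Proof.
have := @areg 0 k set0 set0; rewrite setI0 measure0/= mul0r subrr normr0.
by apply; exact: sigma_algebra0.
Qed.

Lemma approx_ge0 l : 0 <= a l.
Proof.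
apply: (@ler_addP_harmonic _ _ _ K) => N N0.
have [V /(_ 0%N)[_ _ _]] := approx l N0; apply: le_trans.
by apply: Ex_ge0 => w.
Qed.

Lemma prod_bound (V : nat -> R) (s : seq nat) : (forall i, `|V i| <= B) ->
  `|\prod_(i <- s) V i| <= B ^+ size s.
Proof.
move=> VB; elim: s => [|i s IH]; first by rewrite big_nil normr1.
by rewrite big_cons normrM exprS ler_pM.
Qed.

(** Exchange the factors one at a time. *)
Lemma prod_diff (U V : nat -> R) (s : seq nat) :
  (forall i, `|U i| <= B) -> (forall i, `|V i| <= B) ->
  `|\prod_(i <- s) U i - \prod_(i <- s) V i| <=
  B ^+ size s * \sum_(i <- s) `|U i - V i|.
Proof.
move=> UB VB; elim: s => [|i s IH]; first by rewrite !big_nil subrr normr0 mulr0.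
rewrite !big_cons /= exprS.
have -> : U i * \prod_(j <- s) U j - V i * \prod_(j <- s) V j =
  (U i - V i) * \prod_(j <- s) U j + V i * (\prod_(j <- s) U j - \prod_(j <- s) V j) by ring.
apply: (le_trans (ler_normD _ _)); rewrite !normrM mulrDr; apply: lerD.
  rewrite mulrC; apply: ler_wpM2r => //.
  apply: (le_trans (prod_bound s UB)).
  by rewrite ler_peMl ?exprn_ge0.
by rewrite -mulrA ler_pM.
Qed.

(** Replace each factor by its approximation, a function of a window of [Z] of
    radius [l] around its index. The two products then depend on the past and
    on the future of [Z], separated by a gap of at least [k], and absolute
    regularity bounds their covariance. *)
Lemma decoupling (s t : seq nat) (l k n g : nat) :
  (size s + size t <= 4)%N ->
  (forall i, i \in s -> (1 <= i <= n)%N) -> (forall j, j \in t -> (n + g <= j)%N) ->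
  (2 * l + k <= g)%N -> (1 <= n)%N ->
  `|cov P (fun w => \prod_(i <- s) Y i w) (fun w => \prod_(j <- t) Y j w)| <=
  8 * B ^+ 4 * (a l + beta k).
Proof.
move=> st4 sn tn lkg n1.
have b0 := beta_ge0 k.
have BX m m' : (m <= m')%N -> B ^+ m <= B ^+ m' by move=> mm; exact: ler_weXn2l.
have tj j : j \in t -> (1 <= j)%N by move=> /tn; lia.
apply: (@ler_addP_harmonic _ _ _ (8 * B ^+ 4 * K)) => N N0.
have [V0 HV0] := approx l N0.
pose V i := V0 i.-1.
have VB i w : `|V i w| <= B by have [_ _ h _] := HV0 i.-1; exact: h.
have mV i : measurable_fun setT (V i) by have [_ h _ _] := HV0 i.-1; exact: h.
have VY i : (1 <= i)%N -> Ex P (fun w => `|Y i w - V i w|) <= a l + K / N%:R.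
  by case: i => // i _; have [_ _ _ h] := HV0 i; exact: h.
pose eta := a l + K / N%:R.
have eta0 : 0 <= eta.
  by apply: le_trans (VY 1%N isT); apply: Ex_ge0 => w.
have bY i : bfun (Y i) by split => //; exists B.
have bV i : bfun (V i) by split => //; exists B.
pose U u (w : T) := \prod_(i <- u) Y i w : R.
pose W u (w : T) := \prod_(i <- u) V i w : R.
have bU u : bfun (U u) by apply: bfun_prod.
have bW u : bfun (W u) by apply: bfun_prod.
have UB u w : `|U u w| <= B ^+ size u by apply: prod_bound => i; exact: YB.
have WB u w : `|W u w| <= B ^+ size u by apply: prod_bound => i; exact: VB.
have diff u : (forall i, i \in u -> (1 <= i)%N) ->
    Ex P (fun w => `|U u w - W u w|) <= B ^+ size u * (size u)%:R * eta.
  move=> u1; have bd i : bfun (fun w => `|Y i w - V i w|) by apply/bfun_abs/bfunB.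
  apply: (@le_trans _ _ (Ex P (fun w => B ^+ size u * \sum_(i <- u) `|Y i w - V i w|))).
    apply: Ex_le.
    - exact/bfun_abs/bfunB.
    - by apply: bfunM; [exact: bfun_cst|exact: bfun_sum].
    - by move=> w; apply: prod_diff => i; [exact: YB|exact: VB].
  rewrite ExZ; last exact: bfun_sum.
  rewrite -mulrA ler_wpM2l ?exprn_ge0// Ex_sum//.
  elim: u u1 {bU bW UB WB} => [|i u IH] u1; first by rewrite big_nil mul0r.
  rewrite big_cons /= -natr1 mulrDl mul1r addrC; apply: lerD.
    by apply: IH => j ju; apply: u1; rewrite inE ju orbT.
  by apply: VY; apply: u1; exact: mem_head.
have e1 : `|Ex P (fun w => U s w * U t w) - Ex P (fun w => W s w * W t w)| <=
    B ^+ (size s + size t) * (size s + size t)%:R * eta.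
  have catE u v (F : nat -> T -> R) w : (\prod_(i <- u) F i w) * (\prod_(i <- v) F i w) =
      \prod_(i <- u ++ v) F i w by rewrite big_cat.
  under [X in Ex P X - _]eq_fun do rewrite /U catE.
  under [X in _ - Ex P X]eq_fun do rewrite /W catE.
  rewrite -(ExB P (bU (s ++ t)) (bW (s ++ t))) -size_cat.
  apply: le_trans (Ex_abs P (bfunB (bU (s ++ t)) (bW (s ++ t)))) _.
  apply: diff => i; rewrite mem_cat => /orP[/sn/andP[]//|]; exact: tj.
have e2 : `|Ex P (U s) * Ex P (U t) - Ex P (W s) * Ex P (W t)| <=
    B ^+ (size s + size t) * (size s + size t)%:R * eta.
  have -> : Ex P (U s) * Ex P (U t) - Ex P (W s) * Ex P (W t) =
    Ex P (fun w => U s w - W s w) * Ex P (U t) + Ex P (W s) * Ex P (fun w => U t w - W t w).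
    by rewrite (ExB P (bU s) (bW s)) (ExB P (bU t) (bW t)); ring.
  apply: (le_trans (ler_normD _ _)); rewrite !normrM natrD exprD.
  have -> : B ^+ size s * B ^+ size t * ((size s)%:R + (size t)%:R) * eta =
    (B ^+ size s * (size s)%:R * eta) * B ^+ size t +
    B ^+ size s * (B ^+ size t * (size t)%:R * eta) by ring.
  apply: lerD; apply: ler_pM => //.
  - apply: le_trans (Ex_abs P (bfunB (bU s) (bW s))) _.
    by apply: diff => i /sn/andP[].
  - exact: Ex_bound.
  - exact: Ex_bound.
  - apply: le_trans (Ex_abs P (bfunB (bU t) (bW t))) _.
    by apply: diff => i; exact: tj.
have dW u (D : set int) : (forall i, i \in u -> [set x : int | - l%:Z <= x - (i.-1)%:Z <= l%:Z] `<=` D) ->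
    depends_on D Z (W u).
  elim: u => [|i u IH] HD.
    rewrite /W; under eq_fun do rewrite big_nil; exact: measurable_cst.
  rewrite /W; under eq_fun do rewrite big_cons.
  apply: measurable_funM.
    apply: depends_on_sub (HD i (mem_head _ _)) _; by have [h _ _ _] := HV0 i.-1; exact: h.
  by apply: IH => j ju; apply: HD; rewrite inE ju orbT.
have e3 : `|cov P (W s) (W t)| <= 4 * B ^+ size s * B ^+ size t * beta k.
  apply: covariance_inequality => //; try by [case: (bW s)|case: (bW t)].
  move=> x y; apply: (@areg (n%:Z + l%:Z - 1)).
  - apply: depends_on_level; apply: dW => i /sn i1 z /=; lia.
  - apply: depends_on_level; apply: dW => i /tn i1 z /=; lia.
have -> : cov P (U s) (U t) = cov P (W s) (W t) +
  ((Ex P (fun w => U s w * U t w) - Ex P (fun w => W s w * W t w))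
   - (Ex P (U s) * Ex P (U t) - Ex P (W s) * Ex P (W t))) by rewrite /cov; ring.
apply: (le_trans (ler_normD _ _)).
have h4 : B ^+ (size s + size t) <= B ^+ 4 by exact: BX.
have h5 : (size s + size t)%:R <= 4 :> R by rewrite (ler_nat R _ 4).
have h6 : B ^+ (size s + size t) * (size s + size t)%:R * eta <= B ^+ 4 * 4 * eta.
  by rewrite ler_wpM2r// ler_pM// exprn_ge0.
have h7 : 4 * B ^+ size s * B ^+ size t * beta k <= 4 * B ^+ 4 * beta k.
  by rewrite -(mulrA 4) -exprD ler_wpM2r// ler_wpM2l.
have h8 := ler_normB (Ex P (fun w => U s w * U t w) - Ex P (fun w => W s w * W t w))
   (Ex P (U s) * Ex P (U t) - Ex P (W s) * Ex P (W t)).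
have h9 : 0 <= B ^+ 4 * beta k by rewrite mulr_ge0// exprn_ge0.
have -> : 8 * B ^+ 4 * (a l + beta k) + 8 * B ^+ 4 * K / N%:R =
  8 * (B ^+ 4 * eta) + 8 * (B ^+ 4 * beta k) by rewrite /eta; ring.
rewrite -mulrA in h7; rewrite (mulrC _ 4) -mulrA in h6; lra.
Qed.

End decoupling.

(** * Sums over gaps *)

Section gap_sums.
Context {R : realType}.

(** Substituting the distance [c - b] for [b] turns part of the sum over [b] into
    part of the sum over the distances. *)
Lemma gap_sum_le (H : nat -> R) N c : (forall y, 0 <= H y) -> (c < N)%N ->
  \sum_(b < N) (b <= c)%N%:R * H (c - b)%N <= \sum_(y < N) H y.
Proof.
move=> H0 cN.
rewrite -!(big_mkord xpredT (fun b => (b <= c)%N%:R * H (c - b)%N)).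
rewrite -(big_mkord xpredT H) (big_cat_nat (n := c.+1))//=.
have -> : \sum_(c.+1 <= b < N) (b <= c)%N%:R * H (c - b)%N = 0.
  by rewrite big_nat big1// => b /andP[cb _]; rewrite leqNgt cb mul0r.
rewrite addr0 [leRHS](big_cat_nat (n := c.+1))//= ler_wpDr ?sumr_ge0//.
rewrite big_nat_rev/= add0n le_eqVlt; apply/orP; left; apply/eqP.
apply: eq_big_nat => b /andP[_ bc].
by rewrite subSS leq_subr mul1r; congr H; lia.
Qed.

Lemma count_le_sum N x : \sum_(y < N) (y <= x)%N%:R <= x.+1%:R :> R.
Proof.
elim: N => [|N IH]; first by rewrite big_ord0.
rewrite big_ord_recr/=; have [Nx|xN] := leqP N x; last by rewrite addr0.
apply: (@le_trans _ _ (\sum_(y < N) 1 + 1)).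
  by rewrite lerD2r; apply: ler_sum => y _; case: (_ <= _)%N.
by rewrite sumr_const card_ord natr1 ler_nat.
Qed.

(** Each ordering of three indices contributes the same amount. *)
Lemma symmetric_sum_le (F : nat -> nat -> nat -> R) N :
  (forall a b c, 0 <= F a b c) ->
  (forall a b c, F a b c = F b a c) -> (forall a b c, F a b c = F a c b) ->
  \sum_(c < N) \sum_(b < N) \sum_(a < N) F a b c <=
  6 * \sum_(c < N) \sum_(b < N) \sum_(a < N) (a <= b <= c)%N%:R * F a b c.
Proof.
move=> F0 S1 S2.
pose I a b c := ((a <= b) && (b <= c))%N%:R * F a b c.
have I0 a b c : 0 <= I a b c by rewrite mulr_ge0.
pose O := \sum_(c < N) \sum_(b < N) \sum_(a < N) I a b c.
have swap12 (G : nat -> nat -> nat -> R) :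
    \sum_(c < N) \sum_(b < N) \sum_(a < N) G b a c =
    \sum_(c < N) \sum_(b < N) \sum_(a < N) G a b c.
  by apply: eq_bigr => c _; rewrite exchange_big.
have swap23 (G : nat -> nat -> nat -> R) :
    \sum_(c < N) \sum_(b < N) \sum_(a < N) G a c b =
    \sum_(c < N) \sum_(b < N) \sum_(a < N) G a b c.
  by rewrite exchange_big.
have pt a b c : F a b c <= I a b c + I b a c + I a c b + I b c a + I c a b + I c b a.
  have ind x y z : (x <= y)%N -> (y <= z)%N -> I x y z = F x y z.
    by move=> h1 h2; rewrite /I h1 h2 mul1r.
  have f1 : F b a c = F a b c by rewrite S1.
  have f2 : F a c b = F a b c by rewrite S2.
  have f3 : F b c a = F a b c by rewrite S2.
  have f4 : F c a b = F a b c by rewrite S1.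
  have f5 : F c b a = F a b c by rewrite S1.
  have i1 := I0 a b c; have i2 := I0 b a c; have i3 := I0 a c b.
  have i4 := I0 b c a; have i5 := I0 c a b; have i6 := I0 c b a.
  have [ab|/ltnW ba] := leqP a b; have [bc|/ltnW cb] := leqP b c.
  - have := ind _ _ _ ab bc; lra.
  - have [ac|/ltnW ca] := leqP a c; first by have := ind _ _ _ ac cb; lra.
    have := ind _ _ _ ca ab; lra.
  - have [ac|/ltnW ca] := leqP a c; first by have := ind _ _ _ ba ac; lra.
    have := ind _ _ _ bc ca; lra.
  - have := ind _ _ _ cb ba; lra.
rewrite -/O.
apply: (@le_trans _ _ (\sum_(c < N) \sum_(b < N) \sum_(a < N)
  (I a b c + I b a c + I a c b + I b c a + I c a b + I c b a))).
  by apply: ler_sum => c _; apply: ler_sum => b _; apply: ler_sum => a _; exact: pt.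
have splitS (G1 G2 : nat -> nat -> nat -> R) :
    \sum_(c < N) \sum_(b < N) \sum_(a < N) (G1 a b c + G2 a b c) =
    \sum_(c < N) \sum_(b < N) \sum_(a < N) G1 a b c +
    \sum_(c < N) \sum_(b < N) \sum_(a < N) G2 a b c.
  rewrite -big_split; apply: eq_bigr => c _; rewrite -big_split; apply: eq_bigr => b _.
  by rewrite big_split.
rewrite (splitS (fun a b c => I a b c + I b a c + I a c b + I b c a + I c a b) (fun a b c => I c b a))
  (splitS (fun a b c => I a b c + I b a c + I a c b + I b c a) (fun a b c => I c a b))
  (splitS (fun a b c => I a b c + I b a c + I a c b) (fun a b c => I b c a))
  (splitS (fun a b c => I a b c + I b a c) (fun a b c => I a c b))
  (splitS (fun a b c => I a b c) (fun a b c => I b a c)).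
have e1 : \sum_(c < N) \sum_(b < N) \sum_(a < N) I b a c = O by exact: swap12.
have e2 : \sum_(c < N) \sum_(b < N) \sum_(a < N) I a c b = O by exact: swap23.
have e3 : \sum_(c < N) \sum_(b < N) \sum_(a < N) I b c a = O.
  by rewrite -(swap12 (fun a b c => I b c a)) (swap23 (fun a b c => I a b c)).
have e4 : \sum_(c < N) \sum_(b < N) \sum_(a < N) I c a b = O.
  by rewrite -(swap23 (fun a b c => I c a b)) (swap12 (fun a b c => I a b c)).
have e5 : \sum_(c < N) \sum_(b < N) \sum_(a < N) I c b a = O.
  by rewrite -(swap12 (fun a b c => I c b a)); exact: e4.
rewrite e1 e2 e3 e4 e5 -/O le_eqVlt; apply/orP; left; apply/eqP; ring.
Qed.

End gap_sums.

(** * Moments of sums of weakly dependent variables *)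

(** Products of at most four entries, over two sets of indices at distance at
    least [g], have covariance at most [rho g]. *)
Section weak_dependence.
Context {d : measure_display} {T : measurableType d} {R : realType}
        (P : probability T R).
Variables (Y : nat -> T -> R) (B : R) (rho : nat -> R) (C : R).
Hypothesis mY : forall i, measurable_fun setT (Y i).
Hypothesis YB : forall i w, `|Y i w| <= B.
Hypothesis Y0 : forall i, (1 <= i)%N -> Ex P (Y i) = 0.
Hypothesis rho0 : forall g, 0 <= rho g.
Hypothesis rho_noninc : forall g h, (g <= h)%N -> rho h <= rho g.
Hypothesis rho_sum : forall n, \sum_(g < n) (g.+1)%:R ^+ 2 * rho g <= C.
Hypothesis dec : forall (s t : seq nat) n g, (size s + size t <= 4)%N ->
  (forall i, i \in s -> (1 <= i <= n)%N) -> (forall j, j \in t -> (n + g <= j)%N) ->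
  (1 <= n)%N ->
  `|cov P (fun w => \prod_(i <- s) Y i w) (fun w => \prod_(j <- t) Y j w)| <= rho g.

Let C0 : 0 <= C. Proof. by have := rho_sum 0; rewrite big_ord0. Qed.

Let bY i : bfun (Y i). Proof. by split => //; exists B. Qed.

Lemma rho_sum1 n : \sum_(g < n) rho g <= C.
Proof.
apply: le_trans (rho_sum n); apply: ler_sum => g _.
by rewrite ler_peMl// expr_ge1// ler1n.
Qed.

(** By monotonicity, [rho u * \sum_(g < u) (g + 1) ^ 2 <= C], and the sum of
    squares is at least [u ^ 3 / 3]. *)
Lemma rho_decay u : (0 < u)%N -> rho u <= 3 * C / u%:R ^+ 3.
Proof.
move=> u0; have uR : 0 < u%:R ^+ 3 :> R by rewrite exprn_gt0// ltr0n.
rewrite ler_pdivlMr// mulrC.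
have cube n : n%:R ^+ 3 <= 3 * \sum_(g < n) (g.+1)%:R ^+ 2 :> R.
  elim: n => [|n IH]; first by rewrite big_ord0 mulr0 expr0n.
  rewrite big_ord_recr/= mulrDr.
  have : n.+1%:R ^+ 3 <= n%:R ^+ 3 + 3 * n.+1%:R ^+ 2 :> R.
    have : 0 <= n%:R :> R by []. rewrite -natr1; nra.
  lra.
apply: (le_trans (ler_wpM2r (rho0 u) (cube u))).
rewrite -mulrA ler_wpM2l//; apply: le_trans (rho_sum u).
rewrite mulr_suml; apply: ler_sum => g _.
by rewrite ler_wpM2l ?exprn_ge0//; apply: rho_noninc; rewrite ltnW.
Qed.

Lemma two_point i j : (1 <= i <= j)%N -> `|Ex P (fun w => Y i w * Y j w)| <= rho (j - i).
Proof.
move=> /andP[i1 ij].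
have := @dec [:: i] [:: j] i (j - i) isT.
have e k : (fun w => \prod_(i <- [:: k]) Y i w) = Y k by apply/funext => w; rewrite big_seq1.
rewrite !e /cov Y0// mul0r subr0; apply => //.
  by move=> k; rewrite inE => /eqP ->; rewrite i1 leqnn.
by move=> k; rewrite inE => /eqP ->; rewrite subnKC.
Qed.

(** [x], [y] and [z] are the gaps between four ordered indices. The indicators
    select the largest gap; the last term is what remains of the product of the
    means when the middle gap is the largest. *)
Definition gap_bound x y z : R :=
  ((y <= x) && (z <= x))%N%:R * rho x + ((x <= y) && (z <= y))%N%:R * rho y +
  ((x <= z) && (y <= z))%N%:R * rho z + rho x * rho z.

Let gap_bound0 x y z : 0 <= gap_bound x y z.
Proof. by rewrite /gap_bound !addr_ge0 ?mulr_ge0. Qed.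

(** The product is split at the largest of its three gaps. An isolated factor has
    mean 0; two pairs have means bounded by [two_point]. *)
Lemma four_point a b c e : (1 <= a)%N -> (a <= b)%N -> (b <= c)%N -> (c <= e)%N ->
  `|Ex P (fun w => Y a w * Y b w * Y c w * Y e w)| <= gap_bound (b - a) (c - b) (e - c).
Proof.
move=> a1 ab bc ce.
pose x := (b - a)%N; pose y := (c - b)%N; pose z := (e - c)%N.
rewrite -/x -/y -/z.
have t0 u v : 0 <= (u && v)%N%:R :> R by [].
have r0 : 0 <= rho x * rho z by rewrite mulr_ge0.
have p1 : 0 <= ((y <= x) && (z <= x))%N%:R * rho x by rewrite mulr_ge0.
have p2 : 0 <= ((x <= y) && (z <= y))%N%:R * rho y by rewrite mulr_ge0.
have p3 : 0 <= ((x <= z) && (y <= z))%N%:R * rho z by rewrite mulr_ge0.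
have exE (s t : seq nat) : s ++ t = [:: a; b; c; e] ->
    Ex P (fun w => Y a w * Y b w * Y c w * Y e w) =
    cov P (fun w => \prod_(i <- s) Y i w) (fun w => \prod_(i <- t) Y i w) +
    Ex P (fun w => \prod_(i <- s) Y i w) * Ex P (fun w => \prod_(i <- t) Y i w).
  move=> st; rewrite /cov subrK; congr (Ex P _); apply/funext => w.
  by rewrite -big_cat st !big_cons big_nil/= mulr1 !mulrA.
have single k : (1 <= k)%N -> Ex P (fun w => \prod_(i <- [:: k]) Y i w) = 0.
  move=> k1; rewrite -(Y0 k1); congr (Ex P _).
  by apply/funext => w; rewrite big_seq1.
have casex : (y <= x)%N -> (z <= x)%N ->
    `|Ex P (fun w => Y a w * Y b w * Y c w * Y e w)| <= gap_bound x y z.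
  move=> yx zx; rewrite (exE [:: a] [:: b; c; e] erefl) single// mul0r addr0.
  apply: (@le_trans _ _ (rho x)).
    apply: (@dec _ _ a) => // [i|i]; rewrite !inE; first by move=> /eqP ->; rewrite a1 leqnn.
    by rewrite /x => h; case/or3P: h => /eqP ->; lia.
  by rewrite /gap_bound yx zx/= mul1r; lra.
have casez : (x <= z)%N -> (y <= z)%N ->
    `|Ex P (fun w => Y a w * Y b w * Y c w * Y e w)| <= gap_bound x y z.
  move=> xz yz; rewrite (exE [:: a; b; c] [:: e] erefl) (single e) ?mulr0 ?addr0; last lia.
  apply: (@le_trans _ _ (rho z)).
    apply: (@dec _ _ c) => // [i|i|]; rewrite ?inE; last lia.
      by move=> h; case/or3P: h => /eqP ->; lia.
    by move=> /eqP ->; rewrite /z; lia.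
  by rewrite /gap_bound xz yz/= mul1r; lra.
have casey : (x <= y)%N -> (z <= y)%N ->
    `|Ex P (fun w => Y a w * Y b w * Y c w * Y e w)| <= gap_bound x y z.
  move=> xy zy; rewrite (exE [:: a; b] [:: c; e] erefl).
  apply: (le_trans (ler_normD _ _)).
  have h1 : `|cov P (fun w => \prod_(i <- [:: a; b]) Y i w)
                    (fun w => \prod_(i <- [:: c; e]) Y i w)| <= rho y.
    apply: (@dec _ _ b) => // [i|i|]; rewrite ?inE; last lia.
      by move=> /orP[] /eqP ->; lia.
    by move=> /orP[] /eqP ->; rewrite /y; lia.
  have h2 : `|Ex P (fun w => \prod_(i <- [:: a; b]) Y i w)
            * Ex P (fun w => \prod_(i <- [:: c; e]) Y i w)| <= rho x * rho z.
    have pr k m : (fun w => \prod_(i <- [:: k; m]) Y i w) = (fun w => Y k w * Y m w).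
      by apply/funext => w; rewrite big_cons big_seq1.
    rewrite !pr normrM ler_pM//; first by apply: two_point; lia.
    by apply: two_point; lia.
  by rewrite /gap_bound xy zy/= mul1r; lra.
have [xy|yx] := leqP x y.
  have [zy|yz] := leqP z y; first exact: casey.
  by apply: casez; lia.
by have [zx|xz] := leqP z x; [apply: casex; lia|apply: casez; lia].
Qed.

(** If [x] is the largest gap, there are [(x + 1) ^ 2] choices for the other two,
    which is the weight in [rho_sum]. In the last term the middle gap is free. *)
Lemma gap_bound_sum N :
  \sum_(z < N) \sum_(y < N) \sum_(x < N) gap_bound x y z <= 3 * C + N%:R * C ^+ 2.
Proof.
have split4 : \sum_(z < N) \sum_(y < N) \sum_(x < N) gap_bound x y z =
  \sum_(z < N) \sum_(y < N) \sum_(x < N) (y <= x)%N%:R * (z <= x)%N%:R * rho x +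
  \sum_(z < N) \sum_(y < N) \sum_(x < N) (x <= y)%N%:R * (z <= y)%N%:R * rho y +
  \sum_(z < N) \sum_(y < N) \sum_(x < N) (x <= z)%N%:R * (y <= z)%N%:R * rho z +
  \sum_(z < N) \sum_(y < N) \sum_(x < N) rho x * rho z.
  rewrite -!big_split; apply: eq_bigr => z _; rewrite -!big_split; apply: eq_bigr => y _.
  by rewrite -!big_split; apply: eq_bigr => x _; rewrite /gap_bound/= -!mulnb !natrM.
have mx : \sum_(z < N) \sum_(y < N) \sum_(x < N) (x <= z)%N%:R * (y <= z)%N%:R * rho z <= C.
  apply: le_trans (rho_sum N); apply: ler_sum => z _.
  rewrite expr2; under eq_bigr do rewrite -!mulr_suml.
  rewrite -mulr_suml -mulr_sumr ler_wpM2r//.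
  by apply: ler_pM; rewrite ?sumr_ge0//; exact: count_le_sum.
have m1 : \sum_(z < N) \sum_(y < N) \sum_(x < N) (y <= x)%N%:R * (z <= x)%N%:R * rho x <= C.
  rewrite exchange_big/=; under eq_bigr do rewrite exchange_big/=.
  rewrite exchange_big/=; apply: le_trans mx; rewrite le_eqVlt; apply/orP; left; apply/eqP.
  apply: eq_bigr => x _; rewrite exchange_big/=; apply: eq_bigr => y _; apply: eq_bigr => z _.
  by rewrite [X in X * _]mulrC.
have m2 : \sum_(z < N) \sum_(y < N) \sum_(x < N) (x <= y)%N%:R * (z <= y)%N%:R * rho y <= C.
  by rewrite exchange_big/=.
have m3 : \sum_(z < N) \sum_(y < N) \sum_(x < N) rho x * rho z <= N%:R * C ^+ 2.
  under eq_bigr do under eq_bigr do rewrite -mulr_suml.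
  under eq_bigr do rewrite sumr_const card_ord -[_ *+ N]mulr_natl.
  rewrite -mulr_sumr ler_wpM2l// -mulr_sumr expr2.
  by apply: ler_pM; rewrite ?sumr_ge0//; exact: rho_sum1.
rewrite split4; lra.
Qed.

(** By convexity of the fourth power, adding [y n] to the sum [S n] increases the
    fourth moment by at most [4 E (S (n + 1) ^ 3 y n)]. This is a sum over three
    indices, which [symmetric_sum_le] orders, and [y n] carries the largest
    index; the three gaps are bounded with [gap_bound_sum]. *)
Lemma fourth_moment_bound i0 q :
  Ex P (fun w => (\sum_(r < q) Y (i0 + r).+1 w) ^+ 4) <= 24 * (3 * C + C ^+ 2) * q%:R ^+ 2.
Proof.
pose y r := Y (i0 + r).+1.
pose S n w := \sum_(r < n) y r w : R.
have by_ r : bfun (y r) by exact: bY.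
have bS n : bfun (S n) by apply: bfun_sum => r _; exact: by_.
have step n : Ex P (fun w => S n.+1 w ^+ 3 * y n w) <= 6 * (3 * C + n.+1%:R * C ^+ 2).
  pose F a b c := `|Ex P (fun w => y a w * y b w * y c w * y n w)|.
  have b3 a b c : bfun (fun w => y a w * y b w * y c w * y n w) by do 3 apply: bfunM => //.
  have -> : Ex P (fun w => S n.+1 w ^+ 3 * y n w) =
      \sum_(c < n.+1) \sum_(b < n.+1) \sum_(a < n.+1)
        Ex P (fun w => y a w * y b w * y c w * y n w).
    have -> : (fun w => S n.+1 w ^+ 3 * y n w) = (fun w =>
       \sum_(c < n.+1) \sum_(b < n.+1) \sum_(a < n.+1) y a w * y b w * y c w * y n w).
      apply/funext => w.
      have e1 b c : \sum_(a < n.+1) y a w * y b w * y c w * y n w =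
          S n.+1 w * y b w * y c w * y n w by rewrite -!mulr_suml.
      have e2 c : \sum_(b < n.+1) S n.+1 w * y b w * y c w * y n w =
          S n.+1 w * S n.+1 w * y c w * y n w by rewrite -!mulr_suml -mulr_sumr.
      have e3 : \sum_(c < n.+1) S n.+1 w * S n.+1 w * y c w * y n w =
          S n.+1 w ^+ 3 * y n w by rewrite -mulr_suml -mulr_sumr -/(S n.+1 w); ring.
      rewrite -e3; apply: eq_bigr => c _; rewrite -e2; apply: eq_bigr => b _.
      by rewrite e1.
    rewrite Ex_sum; last by move=> c _; do 2 apply: bfun_sum => ? _; exact: b3.
    apply: eq_bigr => c _; rewrite Ex_sum; last by move=> b _; apply: bfun_sum => a _; exact: b3.
    by apply: eq_bigr => b _; rewrite Ex_sum// => a _; exact: b3.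
  apply: (@le_trans _ _ (\sum_(c < n.+1) \sum_(b < n.+1) \sum_(a < n.+1) F a b c)).
    by apply: ler_sum => c _; apply: ler_sum => b _; apply: ler_sum => a _; exact: ler_norm.
  apply: le_trans (symmetric_sum_le _ _ _ _) _.
  - by move=> a b c; exact: normr_ge0.
  - by move=> a b c; rewrite /F; congr (`|Ex P _|); apply/funext => w; ring.
  - by move=> a b c; rewrite /F; congr (`|Ex P _|); apply/funext => w; ring.
  rewrite ler_wpM2l//; apply: le_trans (gap_bound_sum n.+1).
  apply: (@le_trans _ _ (\sum_(c < n.+1) (c <= n)%N%:R *
     \sum_(b < n.+1) (b <= c)%N%:R * \sum_(a < n.+1) (a <= b)%N%:R *
       gap_bound (b - a) (c - b) (n - c))).
    apply: ler_sum => c _; have cn : (c <= n)%N by rewrite -ltnS.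
    rewrite cn mul1r; apply: ler_sum => b _; rewrite mulr_sumr; apply: ler_sum => a _.
    have [ab|] := leqP a b; have [bc|] := leqP b c; rewrite ?mul0r ?mul1r ?mulr0//.
    have := @four_point (i0 + a).+1 (i0 + b).+1 (i0 + c).+1 (i0 + n).+1 isT.
    rewrite !ltnS !leq_add2l !subSS !subnDl => h.
    by apply: h.
  have H3 z : 0 <= \sum_(y0 < n.+1) \sum_(x < n.+1) gap_bound x y0 z.
    by apply: sumr_ge0 => ? _; apply: sumr_ge0.
  apply: le_trans (gap_sum_le H3 (ltnSn n)); apply: ler_sum => c _.
  rewrite ler_wpM2l//.
  have H2 y0 : 0 <= \sum_(x < n.+1) gap_bound x y0 (n - c) by apply: sumr_ge0.
  apply: le_trans (gap_sum_le H2 (ltn_ord c)); apply: ler_sum => b _.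
  rewrite ler_wpM2l//.
  exact: (gap_sum_le (H := fun x => gap_bound x (c - b) (n - c)) _ (ltn_ord b)).
have key q' : Ex P (fun w => S q' w ^+ 4) <= \sum_(n < q') 4 * (6 * (3 * C + n.+1%:R * C ^+ 2)).
  elim: q' => [|n IH].
    rewrite big_ord0 (_ : (fun w => _) = (fun=> 0)) ?Ex_cst//.
    by apply/funext => w; rewrite /S big_ord0 expr0n.
  rewrite big_ord_recr/=.
  apply: (@le_trans _ _ (Ex P (fun w => S n w ^+ 4 + 4 * (S n.+1 w ^+ 3 * y n w)))).
    apply: Ex_le.
    - exact: bfunX.
    - apply: bfunD; first exact: bfunX.
      by apply: bfunM; [exact: bfun_cst|apply: bfunM => //; exact: bfunX].
    - move=> w; rewrite /S big_ord_recr/=; set u := \sum_(r < n) _; set v := y n w.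
      (* The difference in the convexity inequality, as a sum of squares. *)
      have -> : u ^+ 4 + 4 * ((u + v) ^+ 3 * v) = (u + v) ^+ 4 +
        v ^+ 2 * (2 * (u + v) ^+ 2 + (2 * (u + v) - v) ^+ 2) by ring.
      by rewrite lerDl mulr_ge0 ?sqr_ge0// addr_ge0 ?sqr_ge0// mulr_ge0 ?sqr_ge0.
  have b1 : bfun (fun w => S n.+1 w ^+ 3 * y n w) by apply: bfunM => //; exact: bfunX.
  rewrite (ExD P (bfunX 4 (bS n)) (bfunM (bfun_cst 4) b1)) ExZ//.
  by apply: lerD => //; rewrite ler_wpM2l.
apply: (le_trans (key q)).
apply: (@le_trans _ _ (\sum_(n < q) 24 * (3 * C + C ^+ 2) * q%:R)).
  apply: ler_sum => n _.
  have nq : n.+1%:R <= q%:R :> R by rewrite ler_nat ltn_ord.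
  have q1 : 1 <= q%:R :> R by rewrite ler1n; apply: leq_ltn_trans (ltn_ord n).
  have C2 : 0 <= C ^+ 2 by rewrite sqr_ge0.
  have h1 : n.+1%:R * C ^+ 2 <= q%:R * C ^+ 2 by rewrite ler_wpM2r.
  have h2 : C <= C * q%:R by rewrite ler_peMr.
  have := C0; nra.
rewrite sumr_const card_ord -[_ *+ q]mulr_natl le_eqVlt; apply/orP; left; apply/eqP; ring.
Qed.

End weak_dependence.

(** * Squared block sums of weakly dependent variables *)

Section weak_dependence_blocks.
Context {d : measure_display} {T : measurableType d} {R : realType}
        (P : probability T R).
Variables (Y : nat -> T -> R) (B : R) (rho : nat -> R) (C : R).
Hypothesis mY : forall i, measurable_fun setT (Y i).
Hypothesis YB : forall i w, `|Y i w| <= B.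
Hypothesis Y0 : forall i, (1 <= i)%N -> Ex P (Y i) = 0.
Hypothesis rho0 : forall g, 0 <= rho g.
Hypothesis rho_noninc : forall g h, (g <= h)%N -> rho h <= rho g.
Hypothesis rho_sum : forall n, \sum_(g < n) (g.+1)%:R ^+ 2 * rho g <= C.
Hypothesis dec : forall (s t : seq nat) n g, (size s + size t <= 4)%N ->
  (forall i, i \in s -> (1 <= i <= n)%N) -> (forall j, j \in t -> (n + g <= j)%N) ->
  (1 <= n)%N ->
  `|cov P (fun w => \prod_(i <- s) Y i w) (fun w => \prod_(j <- t) Y j w)| <= rho g.
Variable e : nat -> R.
Hypothesis eE : forall q i, Ex P (fun w => block_sum (Y ^~ w) q i ^+ 2) = e q.

Let C0 : 0 <= C. Proof. by have := rho_sum 0; rewrite big_ord0. Qed.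
Let bY i : bfun (Y i). Proof. by split => //; exists B. Qed.
Let U q i w := block_sum (Y ^~ w) q i ^+ 2.
Let bU q i : bfun (U q i).
Proof. by apply: bfunX; apply: bfun_sum => r _; exact: bY. Qed.

Lemma distant_blocks q i s : (0 < q)%N ->
  `|cov P (U q i) (U q (i + s.+2))| <= q%:R ^+ 4 * rho (s.+1 * q).
Proof.
move=> q0.
pose f k (p : 'I_q * 'I_q) w := Y (k * q + p.1).+1 w * Y (k * q + p.2).+1 w.
have bf k p : bfun (f k p) by exact: bfunM.
have UE k : U q k = (fun w => \sum_p 1 * f k p w).
  apply/funext => w; rewrite /U /block_sum expr2 mulr_suml.
  rewrite -(pair_bigA _ (fun a b : 'I_q => 1 * f k (a, b) w))/=.
  apply: eq_bigr => a _; rewrite mulr_sumr; apply: eq_bigr => b _.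
  by rewrite mul1r.
have bs k : bfun (fun w => \sum_p 1 * f k p w) by rewrite -UE.
rewrite !UE cov_sumZl//.
apply: (le_trans (ler_norm_sum _ _ _)).
have -> : q%:R ^+ 4 * rho (s.+1 * q) =
    \sum_(p : 'I_q * 'I_q) \sum_(p' : 'I_q * 'I_q) rho (s.+1 * q).
  rewrite !sumr_const card_prod card_ord -mulrnA -[RHS]mulr_natl !natrM; ring.
apply: ler_sum => p _; rewrite mul1r covC cov_sumZl//.
apply: (le_trans (ler_norm_sum _ _ _)); apply: ler_sum => p' _.
rewrite mul1r covC.
have := @dec [:: (i * q + p.1).+1; (i * q + p.2).+1]
  [:: ((i + s.+2) * q + p'.1).+1; ((i + s.+2) * q + p'.2).+1] (i.+1 * q) (s.+1 * q) isT.
have pr a b : (fun w => \prod_(i <- [:: a; b]) Y i w) = (fun w => Y a w * Y b w).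
  by apply/funext => w; rewrite big_cons big_seq1.
rewrite !pr; apply.
- have := ltn_ord p.1; have := ltn_ord p.2.
  move=> h1 h2 k; rewrite !inE mulSn => /orP[] /eqP ->; rewrite /= addnC ltn_add2r //.
- have -> : (i.+1 * q + s.+1 * q = (i + s.+2) * q)%N by rewrite -mulnDl addSnnS.
  by move=> k; rewrite !inE => /orP[] /eqP ->; rewrite ltnW// ltnS leq_addr.
- by rewrite muln_gt0.
Qed.

Let C4 := 24 * (3 * C + C ^+ 2).
Let C40 : 0 <= C4. Proof. by rewrite mulr_ge0// addr_ge0 ?sqr_ge0// mulr_ge0. Qed.

(** Telescoping, as [1 / (s + 1) ^ 2 <= 1 / s - 1 / (s + 1)]. *)
Lemma inverse_squares_sum m : \sum_(s < m) (s.+1%:R ^+ 2)^-1 <= 2 :> R.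
Proof.
case: m => [|m]; first by rewrite big_ord0.
apply: (@le_trans _ _ (2 - m.+1%:R^-1)); last by rewrite gerBl invr_ge0.
elim: m => [|m IH].
  by rewrite big_ord_recr big_ord0/= expr1n invr1; lra.
rewrite big_ord_recr/=; apply: (le_trans (lerD IH (lexx _))).
have m0 : 0 < m.+1%:R :> R by rewrite ltr0n.
have m1 : 0 < m.+2%:R :> R by rewrite ltr0n.
have mm : m.+2%:R = m.+1%:R + 1 :> R by rewrite natr1.
have h : (m.+2%:R ^+ 2)^-1 <= m.+1%:R^-1 - m.+2%:R^-1 :> R.
  have -> : m.+1%:R^-1 - m.+2%:R^-1 = (m.+1%:R * m.+2%:R)^-1 :> R.
    rewrite mm in m1 *; set x := m.+1%:R in m0 m1 *.
    by field; rewrite !lt0r_neq0.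
  by rewrite lef_pV2 ?posrE ?mulr_gt0 ?exprn_gt0// expr2 ler_pM2r// ler_nat.
by rewrite -addrA lerD2l addrC -lerBrDr opprK addrC.
Qed.

(** Equal and adjacent blocks are controlled by the fourth moment, of order
    [q ^ 2]. Blocks at distance [s + 2] are [(s + 1) q] entries apart, and
    [q ^ 4 rho ((s + 1) q)] is of order [q / (s + 1) ^ 3]; the weaker bound
    [q ^ 2 / (s + 3) ^ 2] covers all cases and is summable. *)
Lemma weak_deviation_bound q m : (0 < q)%N ->
  Ex P (fun w => (\sum_(i < m) (block_sum (Y ^~ w) q i ^+ 2 - e q)) ^+ 2) <=
  4 * (4 * C4 + 27 * C) * m%:R * q%:R ^+ 2.
Proof.
move=> q0; have qR : 1 <= q%:R :> R by rewrite ler1n.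
pose K := 4 * C4 + 27 * C.
have K0 : 0 <= K by rewrite addr_ge0// mulr_ge0.
pose g s := K * q%:R ^+ 2 * (s.+1%:R ^+ 2)^-1.
have g0 s : 0 <= g s by rewrite mulr_ge0 ?invr_ge0 ?sqr_ge0// mulr_ge0 ?sqr_ge0.
have bZ i : bfun (fun w => U q i w - e q) by apply: bfunB; [exact: bU|exact: bfun_cst].
have Z2 i : Ex P (fun w => (U q i w - e q) ^+ 2) <= C4 * q%:R ^+ 2.
  apply: (@le_trans _ _ (Ex P (fun w => U q i w ^+ 2))).
    have -> : (fun w => (U q i w - e q) ^+ 2) =
      (fun w => U q i w ^+ 2 - (2 * e q * U q i w - e q ^+ 2)) by apply/funext => w; ring.
    have b1 : bfun (fun w => 2 * e q * U q i w) by apply: bfunM; [exact: bfun_cst|exact: bU].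
    rewrite ExB; [|exact/bfunX/bU|by apply: bfunB; [|exact: bfun_cst]].
    rewrite ExB; [|exact: b1|exact: bfun_cst].
    rewrite ExZ; last exact: bU.
    by rewrite Ex_cst /U eE; have := sqr_ge0 (e q); nra.
  have -> : (fun w => U q i w ^+ 2) = (fun w => (\sum_(r < q) Y (i * q + r).+1 w) ^+ 4).
    by apply/funext => w; rewrite /U /block_sum -exprM.
  exact: (fourth_moment_bound mY YB Y0 rho0 rho_sum dec).
have cross i j : (i <= j)%N ->
    Ex P (fun w => (U q i w - e q) * (U q j w - e q)) <= g (j - i)%N.
  move=> ij; have [near|far] := ltnP (j - i) 2.
    apply: (@le_trans _ _ (C4 * q%:R ^+ 2)).
      apply: (@le_trans _ _ (Ex P (fun w =>
          2^-1 * ((U q i w - e q) ^+ 2 + (U q j w - e q) ^+ 2)))).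
        apply: Ex_le.
        - by apply: bfunM; exact: bZ.
        - by apply: bfunM; [exact: bfun_cst|apply: bfunD; exact/bfunX/bZ].
        - by move=> w; set x := U q i w - e q; set y := U q j w - e q;
            have := sqr_ge0 (x - y); lra.
      rewrite ExZ; last by apply: bfunD; exact/bfunX/bZ.
      rewrite ExD; [|exact/bfunX/bZ|exact/bfunX/bZ].
      by have := Z2 i; have := Z2 j; lra.
    rewrite /g [leRHS]mulrAC; apply: ler_wpM2r; first exact: sqr_ge0.
    rewrite ler_pdivlMr ?exprn_gt0 ?ltr0n//.
    have : (j - i).+1%:R ^+ 2 <= 4 :> R.
      by rewrite -natrX (ler_nat R _ 4) (leq_exp2r _ 2 (isT : 0 < 2)%N).
    by move=> h; have := ler_wpM2l C40 h; rewrite /K; have := C0; lra.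
  pose s := (j - i - 2)%N.
  have -> : j = (i + s.+2)%N by rewrite /s; lia.
  rewrite (Ex_centered (bU q i) (bU q _) (eE q i) (eE q _)).
  apply: le_trans (ler_norm _) _; apply: (le_trans (distant_blocks i s q0)).
  have sq0 : (0 < s.+1 * q)%N by rewrite muln_gt0.
  have q4 : 0 <= q%:R ^+ 4 :> R by rewrite exprn_ge0.
  apply: (le_trans (ler_wpM2l q4 (rho_decay rho0 rho_noninc rho_sum sq0))).
  have s1 : 1 <= s.+1%:R :> R by rewrite ler1n.
  have s10 : 0 < s.+1%:R :> R by rewrite ltr0n.
  have q0R : 0 < q%:R :> R by rewrite ltr0n.
  rewrite natrM.
  have -> : q%:R ^+ 4 * (3 * C / (s.+1%:R * q%:R) ^+ 3) = 3 * C * q%:R / s.+1%:R ^+ 3.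
    by field; rewrite !lt0r_neq0.
  rewrite addKn /g.
  have h1 : (s.+1%:R ^+ 3)^-1 <= 9 * (s.+3%:R ^+ 2)^-1 :> R.
    have s3 : s.+3%:R <= 3 * s.+1%:R :> R by rewrite -natrM ler_nat; lia.
    rewrite ler_pdivlMr ?exprn_gt0 ?ltr0n// mulrC ler_pdivrMr ?exprn_gt0//.
    have : s.+3%:R ^+ 2 <= (3 * s.+1%:R) ^+ 2 :> R by rewrite ler_sqr ?nnegrE// mulr_ge0.
    have : s.+1%:R ^+ 2 <= s.+1%:R ^+ 3 :> R by rewrite [leRHS]exprSr ler_peMr ?sqr_ge0.
    rewrite exprMn; lra.
  apply: (@le_trans _ _ (3 * C * q%:R ^+ 2 * (9 * (s.+3%:R ^+ 2)^-1))).
    apply: ler_pM => //; first by rewrite !mulr_ge0.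
      by rewrite ler_wpM2l ?mulr_ge0// expr2 ler_peMr.
  have -> : 3 * C * q%:R ^+ 2 * (9 * (s.+3%:R ^+ 2)^-1) =
    (27 * C) * (q%:R ^+ 2 * (s.+3%:R ^+ 2)^-1) by ring.
  rewrite -(mulrA K) ler_wpM2r ?mulr_ge0 ?invr_ge0 ?sqr_ge0//.
  by rewrite /K lerDr mulr_ge0.
apply: (le_trans (second_moment_sum m bZ g0 cross)).
have -> : 4 * (4 * C4 + 27 * C) * m%:R * q%:R ^+ 2 = m%:R * (2 * (K * q%:R ^+ 2 * 2)).
  by rewrite /K; ring.
rewrite ler_wpM2l// ler_wpM2l// -mulr_sumr ler_wpM2l ?mulr_ge0 ?sqr_ge0//.
exact: inverse_squares_sum.
Qed.

(** * The long-run variance *)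

Let gam h := Ex P (fun w => Y 1%N w * Y h.+1 w).
Hypothesis statY : forall i j,
  Ex P (fun w => Y i.+1 w * Y (i + j).+1 w) = gam j.

(** Adding the entry [m + 1] to a sum of [m] entries increases its second moment
    by [gam 0] plus twice the covariances with the previous entries. *)
Lemma second_moment_increments n : e n = \sum_(m < n) (gam 0 + 2 * \sum_(h < m) gam h.+1).
Proof.
have eS k : e k = Ex P (fun w => (\sum_(r < k) Y r.+1 w) ^+ 2).
  by rewrite -(eE k 0).
rewrite eS; elim: n => [|n IH].
  rewrite big_ord0 (_ : (fun w => _) = (fun=> 0)) ?Ex_cst//.
  by apply/funext => w; rewrite big_ord0 expr0n.
rewrite big_ord_recr/= -IH.
have bS k : bfun (fun w => \sum_(r < k) Y r.+1 w) by apply: bfun_sum => r _; exact: bY.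
have -> : (fun w => (\sum_(r < n.+1) Y r.+1 w) ^+ 2) = (fun w =>
    (\sum_(r < n) Y r.+1 w) ^+ 2 + (Y n.+1 w * Y n.+1 w +
     2 * \sum_(r < n) Y r.+1 w * Y n.+1 w)).
  by apply/funext => w; rewrite big_ord_recr/= -mulr_suml; ring.
have b2 : bfun (fun w => \sum_(r < n) Y r.+1 w * Y n.+1 w).
  by apply: bfun_sum => r _; exact: bfunM.
have b3 : bfun (fun w => 2 * \sum_(r < n) Y r.+1 w * Y n.+1 w).
  by apply: bfunM => //; exact: bfun_cst.
rewrite ExD; [|exact: bfunX|by apply: bfunD => //; exact: bfunM].
rewrite ExD; [|exact: bfunM|exact: b3].
rewrite ExZ// Ex_sum; last by move=> r _; exact: bfunM.
congr (_ + (_ + 2 * _)); first by have := statY n 0; rewrite addn0.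
rewrite -(big_mkord xpredT (fun r => Ex P (fun w => Y r.+1 w * Y n.+1 w))).
rewrite -(big_mkord xpredT (fun h => gam h.+1)) [RHS]big_nat_rev/= add0n.
apply: eq_big_nat => r /andP[_ rn].
by have := statY r (n - r); rewrite subnKC ?(ltnW rn)// => ->; congr gam; lia.
Qed.

Lemma covariance_series_cvg : cvgn (series (fun h => gam h.+1)).
Proof.
apply: normed_cvg; apply: summable_cvg => [h|]; first exact: normr_ge0.
exists C => n; apply: le_trans (rho_sum1 rho0 rho_sum n); apply: ler_sum => h _.
apply: (@le_trans _ _ (rho h.+1)); last exact: rho_noninc.
by have := two_point Y0 dec (i := 1) (j := h.+2) isT; rewrite subn1.
Qed.

(** By [second_moment_increments], [e n / n] is a Cesaro mean. *)
Lemma variance_limit : e n / n%:R @[n --> \oo] -->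
  gam 0 + 2 * limn (series (fun h => gam h.+1)).
Proof.
pose u m := gam 0 + 2 * series (fun h => gam h.+1) m.
have cu : u m @[m --> \oo] --> gam 0 + 2 * limn (series (fun h => gam h.+1)).
  apply: cvgD; first exact: cvg_cst.
  by apply: cvgM; [exact: cvg_cst|exact: covariance_series_cvg].
rewrite -(cvg_shiftS (fun n => e n / n%:R)).
apply: cvg_trans (cesaro cu); apply: near_eq_cvg.
apply: nearW => n; rewrite /arithmetic_mean /= second_moment_increments mulrC.
congr (_ * _); rewrite /series/= big_mkord; apply: eq_bigr => m _.
by rewrite /u /series/= big_mkord.
Qed.

End weak_dependence_blocks.

(** * The bootstrap of near epoch dependent sequences *)

Section running_minimum.
Context {R : realType}.
Implicit Types u : nat -> R.

(** The approximation constants and mixing coefficients need not be monotone.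
    Their running minima are, and they bound the covariances just as well, since
    the radius and the gap in [decoupling] may be chosen smaller. *)
Fixpoint running_min u n : R :=
  if n is m.+1 then Num.min (running_min u m) (u m.+1) else u 0%N.

Lemma running_min_le u n : running_min u n <= u n.
Proof. by case: n => //= n; rewrite ge_min lexx orbT. Qed.

Lemma running_min_noninc u m n : (m <= n)%N -> running_min u n <= running_min u m.
Proof.
move=> /subnK <-; elim: (n - m)%N => // k IH.
by rewrite addSn /= ge_min IH.
Qed.

Lemma running_min_attained u n : exists2 j, (j <= n)%N & running_min u n = u j.
Proof.
elim: n => [|n [j jn IH]]; first by exists 0%N.
rewrite /=; have [h|h] := leP (running_min u n) (u n.+1); last by exists n.+1.
by exists j => //; rewrite ltnW.
Qed.

Lemma running_min_ge0 u n : (forall j, 0 <= u j) -> 0 <= running_min u n.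
Proof. by move=> u0; have [j _ ->] := running_min_attained u n. Qed.

(** Each [l] occurs for the three values [3 l], [3 l + 1], [3 l + 2] of [g], and
    [g + 1 <= 3 (l + 1)]. *)
Lemma triple_sum_le u n : (forall l, 0 <= u l) ->
  \sum_(g < n) g.+1%:R ^+ 2 * u (g %/ 3)%N <= 27 * \sum_(l < n) l.+1%:R ^+ 2 * u l.
Proof.
move=> u0; pose F g := g.+1%:R ^+ 2 * u (g %/ 3)%N.
have F0 g : 0 <= F g by rewrite mulr_ge0 ?sqr_ge0.
apply: (@le_trans _ _ (\sum_(g < n * 3) F g)).
  rewrite -(big_mkord xpredT F) -[leRHS](big_mkord xpredT F).
  by rewrite [leRHS](@big_cat_nat _ _ _ n) ?leq_pmulr//= lerDl sumr_ge0.
elim: n => [|n IH]; first by rewrite !big_ord0 mulr0.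
rewrite mulSn !add3n !big_ord_recr/= mulrDr.
have h k : (k < 3)%N -> F (n * 3 + k)%N <= 9 * (n.+1%:R ^+ 2 * u n).
  move=> k3; rewrite /F divnMDl// divn_small// addn0 mulrA ler_wpM2r//.
  by rewrite (_ : 9 = 3 ^+ 2); [rewrite -exprMn ler_sqr ?nnegrE ?mulr_ge0// -natrM ler_nat; lia|ring].
have := h 0%N isT; have := h 1%N isT; have := h 2%N isT.
rewrite addn0 addn1 addn2; lra.
Qed.

Lemma successor_squares_sum u n : (forall l, 0 <= u l) ->
  \sum_(l < n) l.+1%:R ^+ 2 * u l <= u 0%N + 4 * \sum_(l < n) l%:R ^+ 2 * u l.
Proof.
move=> u0; case: n => [|n]; first by rewrite !big_ord0 mulr0 addr0.
rewrite !big_ord_recl/= expr1n mul1r expr0n mul0r add0r lerD2l mulr_sumr.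
apply: ler_sum => l _; rewrite mulrA ler_wpM2r//.
rewrite (_ : 4 = 2 ^+ 2); last by ring.
by rewrite -exprMn ler_sqr ?nnegrE ?mulr_ge0// -natrM ler_nat /bump/=; lia.
Qed.

End running_minimum.

Section near_epoch_case.
Context {d : measure_display} {T : measurableType d} {R : realType}
        (P : probability T R).

(** A gap [g] is divided into two window radii and one gap of [Z], each of length
    [g / 3]; the summability of [k ^ 2 * (a k + beta k)] then gives that of
    [(g + 1) ^ 2 * rho g]. The covariances of [X] are those of [Y], so that the
    series for [sigma2] is the limit found in [variance_limit]. *)
Theorem bootstrap_ned (X : nat -> T -> R) (p : nat -> nat) (M mu sigma2 : R)
    (mX : forall i, measurable_fun setT (X i))
    (sX : stationary P X)
    (M0 : 0 <= M)
    (XM : {ae P, forall w, `|X 1%N w| <= M})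
    (EX : ('E_P[X 1%N] = mu%:E)%E)
    (p0 : forall n, (1 <= n)%N -> (0 < p n)%N)
    (p_cvg : p n @[n --> \oo] --> \oo)
    (p_dyadic : forall l n, (1 <= l)%N -> (2 ^ l <= n < 2 ^ l.+1)%N ->
       p n = p (2 ^ l)%N)
    (p_small : ((p n)%:R ^+ 2 / n%:R : R) @[n --> \oo] --> (0 : R)) :
  ned_condition P X sigma2 ->
  {ae P, forall w,
     boot_scaled_variance (X ^~ w) (p n) n @[n --> \oo] --> sigma2} /\
  {ae P, forall w,
     cvg_in_distribution (fun n => boot_cdf (X ^~ w) (p n) n)
       (gaussian sigma2)}.
Proof.
move=> [d' [E [Z [a [beta [XZ areg _ sum_cvg sigmaE]]]]]].
have mZ i : measurable_fun setT (Z i) by exact: measurable_funPT.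
pose Y i w := clamp M (X i w) - mu.
pose e q := Ex P (fun w => block_sum (Y ^~ w) q 0 ^+ 2).
have eE q i : Ex P (fun w => block_sum (Y ^~ w) q i ^+ 2) = e q.
  exact: stationary_block_moment.
have bY i : bfun (Y i) by exact: bfun_truncated.
have mY i : measurable_fun setT (Y i) by case: (bY i).
have XY := truncated_ae mu mX sX XM.
have Y0 i : (1 <= i)%N -> Ex P (Y i) = 0.
  exact: (@truncated_mean0 _ _ _ P X M mu M0 mX sX XM EX).
pose B := M + `|mu| + 1.
have B1 : 1 <= B by rewrite lerDr addr_ge0.
have YB i w : `|Y i w| <= B by rewrite ler_wpDr// truncated_bound.
have approx l N : (0 < N)%N -> exists V : nat -> T -> R, forall m,
    [/\ depends_on [set i | - l%:Z <= i - m%:Z <= l%:Z] (Z : int -> T -> E) (V m),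
        measurable_fun setT (V m),
        forall w, `|V m w| <= B &
        Ex P (fun w => `|Y m.+1 w - V m w|) <= a l + 2 * M / N%:R].
  move=> N0; have [V HV] := window_approximation mu mX mZ M0 XZ l N0.
  exists V => m; have [h1 h2 h3 h4] := HV m; split => // w.
  by rewrite ler_wpDr// h3.
have mix n k A C := @absolute_regularity_ge _ _ _ _ _ P (Z : int -> T -> E) beta mZ areg n k A C.
have a0 := approx_ge0 approx.
have beta0 := beta_ge0 mix.
pose c := 8 * B ^+ 4.
have c0 : 0 <= c by rewrite mulr_ge0// exprn_ge0// (le_trans _ B1).
pose rho g := c * (running_min a (g %/ 3) + running_min beta (g %/ 3)).
have rho0 g : 0 <= rho g by rewrite mulr_ge0// addr_ge0// running_min_ge0.
have rho_noninc g h : (g <= h)%N -> rho h <= rho g.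
  by move=> gh; rewrite ler_wpM2l// lerD// running_min_noninc// leq_div2r.
have dec (s t : seq nat) n g : (size s + size t <= 4)%N ->
    (forall i, i \in s -> (1 <= i <= n)%N) -> (forall j, j \in t -> (n + g <= j)%N) ->
    (1 <= n)%N ->
    `|cov P (fun w => \prod_(i <- s) Y i w) (fun w => \prod_(j <- t) Y j w)| <= rho g.
  move=> st sn tn n1; rewrite /rho.
  have [l lg ->] := running_min_attained a (g %/ 3).
  have [k kg ->] := running_min_attained beta (g %/ 3).
  apply: (decoupling B1 mY YB approx mix st sn tn _ n1).
  by have := leq_divM g 3; lia.
have [S HS] : exists S, forall n, \sum_(l < n) l%:R ^+ 2 * (a l + beta l) <= S.
  have t0 k : (0 <= (k%:R ^+ 2 * (a k + beta k))%R%:E :> \bar R)%E.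
    by rewrite lee_fin mulr_ge0 ?sqr_ge0// addr_ge0.
  exists (fine (\sum_(0 <= k <oo) (k%:R ^+ 2 * (a k + beta k))%R%:E)%E) => n.
  have fin : ((\sum_(0 <= k <oo) (k%:R ^+ 2 * (a k + beta k))%R%:E)%E \is a fin_num).
    by rewrite ge0_fin_numE//; apply: nneseries_ge0 => k _ _; exact: t0.
  rewrite -lee_fin fineK// -sumEFin.
  rewrite -(big_mkord xpredT (fun k => (k%:R ^+ 2 * (a k + beta k))%:E)).
  by apply: nneseries_lim_ge => k _ _; exact: t0.
pose C := c * (27 * (a 0%N + beta 0%N + 4 * S)).
have rho_sum n : \sum_(g < n) g.+1%:R ^+ 2 * rho g <= C.
  pose u l := a l + beta l; have u0 l : 0 <= u l by rewrite addr_ge0.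
  apply: (@le_trans _ _ (c * \sum_(g < n) g.+1%:R ^+ 2 * u (g %/ 3)%N)).
    rewrite mulr_sumr; apply: ler_sum => g _; rewrite /rho mulrCA ler_wpM2l//.
    by rewrite ler_wpM2l ?sqr_ge0// lerD// running_min_le.
  rewrite ler_wpM2l//; apply: le_trans (triple_sum_le n u0) _; rewrite ler_wpM2l//.
  by apply: le_trans (successor_squares_sum n u0) _; rewrite lerD2l ler_wpM2l// HS.
have statY i j : Ex P (fun w => Y i.+1 w * Y (i + j).+1 w) = Ex P (fun w => Y 1%N w * Y j.+1 w).
  exact: stationary_product.
have e_cvg : e n / n%:R @[n --> \oo] --> sigma2.
  have covX i : (1 <= i)%N ->
      fine (covariance P (X 1%N) (X i)) = Ex P (fun w => Y 1%N w * Y i w).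
    move=> i1; pose h j w := Y j w - - mu.
    have bh j : bfun (h j) by apply: bfunB => //; exact: bfun_cst.
    have Xh j : (1 <= j)%N -> {ae P, forall w, X j w = h j w}.
      by move=> j1; apply: filterS XY => w ->//; rewrite /h opprK.
    rewrite (covariance_ae (mX 1%N) (mX i) (bh 1%N) (bh i) (Xh 1%N isT) (Xh i i1))/=.
    rewrite cov_cstr// covC cov_cstr// covC /cov Y0// mul0r subr0//.
  have series_cvg := covariance_series_cvg Y0 rho0 rho_noninc rho_sum dec.
  have := variance_limit mY YB Y0 rho0 rho_noninc rho_sum dec eE statY.
  set L := limn _ in series_cvg *; set G := (X in _ --> X).
  suff -> : sigma2 = G by [].
  rewrite sigmaE /G /variance covX//; congr (_ + 2 * _).
  apply: cvg_lim => //; rewrite -(cvg_shiftn 2); apply: cvg_trans series_cvg.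
  apply: near_eq_cvg; apply: nearW => n; rewrite /series/= [RHS](@big_addn _ _ _ 0 _ 2) addnK.
  by apply: eq_bigr => i _; rewrite addn2 covX.
pose K := 4 * (4 * (24 * (3 * C + C ^+ 2)) + 27 * C).
have C0 : 0 <= C by have := rho_sum 0%N; rewrite big_ord0.
have K0 : 0 <= K by have := sqr_ge0 C; rewrite /K; lra.
apply: (@bootstrap_reduction _ _ _ P Y B e
  (fun l => 2 * K * ((p (2 ^ l)%N)%:R / (2 ^ l)%:R)) sigma2 p mY YB p0 p_cvg p_dyadic p_small
  eE e_cvg _ _ X mu XY).
  by apply: summableZ; [rewrite mulr_ge0|exact: block_ratio_summable].
move=> l m; set q := p (2 ^ l)%N => ml.
have q0 : (0 < q)%N by rewrite p0// expn_gt0.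
apply: le_trans (weak_deviation_bound mY YB Y0 rho0 rho_noninc rho_sum dec eE m q0) _.
have L0 : (2 ^ l)%:R != 0 :> R by rewrite pnatr_eq0 expn_eq0.
rewrite (_ : 2 * K * _ * _ = K * ((2 ^ l.+1)%:R * q%:R)).
  by rewrite -/K -mulrA ler_wpM2l// expr2 [leLHS]mulrA ler_wpM2r// -natrM ler_nat.
by rewrite expnS natrM; field.
Qed.

End near_epoch_case.

Theorem theorem2p3 (d : measure_display) (T : measurableType d) (R : realType)
    (P : probability T R) (X : nat -> {RV P >-> R}) (p : nat -> nat)
    (mu sigma2 : R)
    (stationary_X : stationary P X)
    (bounded_X : forall i, (1 <= i)%N ->
       exists M : R, {ae P, forall w, `|X i w| <= M})
    (mean_X : ('E_P[X 1%N] = mu%:E)%E)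
    (p_gt0 : forall n, (1 <= n)%N -> (0 < p n)%N)
    (p_cvg : p n @[n --> \oo] --> \oo)
    (p_dyadic : forall l n, (1 <= l)%N -> (2 ^ l <= n < 2 ^ l.+1)%N ->
       p n = p (2 ^ l)%N)
    (p_small : ((p n)%:R ^+ 2 / n%:R : R) @[n --> \oo] --> (0 : R))
    (conditions : mixing_condition P X p mu sigma2 \/ ned_condition P X sigma2) :
  {ae P, forall w,
     boot_scaled_variance (X ^~ w) (p n) n @[n --> \oo] --> sigma2} /\
  {ae P, forall w,
     cvg_in_distribution (fun n => boot_cdf (X ^~ w) (p n) n)
       (gaussian sigma2)}.
Proof.
have [M XM] := bounded_X 1%N isT.
have mX i : measurable_fun setT (X i) by exact: measurable_funPT.
have XM' : {ae P, forall w, `|X 1%N w| <= `|M| }.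
  by apply: filterS XM => w /le_trans; apply; exact: ler_norm.
case: conditions => cond.
  exact: (bootstrap_mixing mX stationary_X (normr_ge0 M) XM' mean_X
    p_gt0 p_cvg p_dyadic p_small cond).
exact: (bootstrap_ned mX stationary_X (normr_ge0 M) XM' mean_X
  p_gt0 p_cvg p_dyadic p_small cond).
Qed.
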